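(* For every complex number $s$ with $\Re s>0$, $$\int_0^1x^{2s-1}E'(x)K'(x)\,dx=\frac{\pi^3}{8}\,s^2\,\Gamma(s)^4\;L\!\left(s+1,\,s,\,\tfrac12,\,\tfrac12;\;1;\;s+\tfrac32,\,s+\tfrac12\right).$$
   Context: $K(k)=\int_0^{\pi/2}\frac{d\theta}{\sqrt{1-k^2\sin^2\theta}}$ and $E(k)=\int_0^{\pi/2}\sqrt{1-k^2\sin^2\theta}\,d\theta$ are the complete elliptic integrals, and $K'(x):=K(\sqrt{1-x^2})$, $E'(x):=E(\sqrt{1-x^2})$ (the prime denotes the complementary modulus, not a derivative). ${}_4F_3(a_1,\dots,a_4;b_1,b_2,b_3;1)=\sum_{n\ge0}\frac{(a_1)_n\cdots(a_4)_n}{(b_1)_n(b_2)_n(b_3)_n\,n!}$ with $(a)_0=1$, $(a)_n=a(a+1)\cdots(a+n-1)$. Mishev's completed function $L(a,b,c,d;e;f,g)$ is defined on the Saalschützian hyperplane $e+f+g-a-b-c-d=1$ in $\mathbb C^7$; for generic parameters, $$L(a,b,c,d;e;f,g)=\frac{{}_4F_3(a,b,c,d;\,e,f,g;\,1)}{\sin(\pi e)\Gamma(e)\Gamma(f)\Gamma(g)\prod_{\xi\in\{a,b,c,d\}}\Gamma(1+\xi-e)}-\frac{{}_4F_3(1+a-e,1+b-e,1+c-e,1+d-e;\,1+f-e,1+g-e,2-e;\,1)}{\sin(\pi e)\Gamma(a)\Gamma(b)\Gamma(c)\Gamma(d)\Gamma(1+f-e)\Gamma(1+g-e)\Gamma(2-e)},$$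 and at parameter values where the individual terms are singular (for instance $e=1$), $L$ denotes the meromorphic continuation of this expression along the hyperplane. *)

(* Defs.v *)
From Stdlib Require Import Reals ZArith.
From Coquelicot Require Import Coquelicot.

Set Implicit Arguments.
Unset Strict Implicit.
Unset Printing Implicit Defensive.

(** ** Complete elliptic integrals, real modulus [0 <= k < 1] *)

Definition ellK (k : R) : R :=
  RInt (fun t => / sqrt (1 - k ^ 2 * sin t ^ 2))%R 0 (PI / 2).

Definition ellE (k : R) : R :=
  RInt (fun t => sqrt (1 - k ^ 2 * sin t ^ 2))%R 0 (PI / 2).

(** The prime is the complementary modulus, not a derivative. *)
Definition ellK' (x : R) : R := ellK (sqrt (1 - x ^ 2)).
Definition ellE' (x : R) : R := ellE (sqrt (1 - x ^ 2)).

Local Open Scope C_scope.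

(** ** Complex elementary functions *)

Definition Cexp (z : C) : C :=
  (exp (fst z) * cos (snd z), exp (fst z) * sin (snd z))%R.

Definition Csin (z : C) : C :=
  (Cexp (Ci * z) - Cexp (- (Ci * z))) / (2 * Ci).

(** [x ^ z] with the real logarithm; meaningful for [0 < x] only. *)
Definition Rpow_C (x : R) (z : C) : C := Cexp (z * ln x).

(** ** Gamma function and hypergeometric series *)

(** The complex number satisfying [P] when there is exactly one
    ([iota_correct]). *)
Definition Cthe (P : C -> Prop) : C := iota (T := C_CompleteNormedModule) P.

Fixpoint poch (a : C) (n : nat) : C :=
  match n with
  | O => 1
  | S m => poch a m * (a + INR m)
  end.

(** Gauss's limit [n! n^z / (z (z+1) ... (z+n))], valid at every [z] that is
    not a pole; the value at a pole is never used. *)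
Definition Gamma (z : C) : C :=
  Cthe (fun w : C =>
    filterlim (fun n : nat => INR (fact n) * Rpow_C (INR n) z / poch z (S n))
      eventually (locally w)).

(** Argument 1. *)
Definition hyp4F3 (a1 a2 a3 a4 b1 b2 b3 : C) : C :=
  Cthe (fun w : C =>
    is_series (fun n : nat =>
      (poch a1 n * poch a2 n * poch a3 n * poch a4 n)
      / (poch b1 n * poch b2 n * poch b3 n * INR (fact n))) w).

(** ** Mishev's function *)

(** The tuple [(a, b, c, d, e, f, g)]. *)
Definition C7 : Type := (C * C * C * C * C * C * C)%type.

Definition saalschutzian (p : C7) : Prop :=
  let '(a, b, c, d, e, f, g) := p in
  e + f + g - a - b - c - d = 1.

Definition is_Cint (z : C) : Prop := exists n : Z, z = IZR n.
Definition Gamma_pole (z : C) : Prop := exists n : nat, z = - INR n.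

(** The parameters at which every factor of the defining formula is finite and
    [sin (pi e)] does not vanish. *)
Definition generic (p : C7) : Prop :=
  let '(a, b, c, d, e, f, g) := p in
  ~ is_Cint e /\
  ~ Gamma_pole f /\ ~ Gamma_pole g /\
  ~ Gamma_pole (1 + f - e) /\ ~ Gamma_pole (1 + g - e) /\
  ~ Gamma_pole a /\ ~ Gamma_pole b /\ ~ Gamma_pole c /\ ~ Gamma_pole d /\
  ~ Gamma_pole (1 + a - e) /\ ~ Gamma_pole (1 + b - e) /\
  ~ Gamma_pole (1 + c - e) /\ ~ Gamma_pole (1 + d - e).

Definition mishev_formula (p : C7) : C :=
  let '(a, b, c, d, e, f, g) := p in
  hyp4F3 a b c d e f g
  / (Csin (PI * e) * Gamma e * Gamma f * Gamma g
     * (Gamma (1 + a - e) * Gamma (1 + b - e)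
        * Gamma (1 + c - e) * Gamma (1 + d - e)))
  - hyp4F3 (1 + a - e) (1 + b - e) (1 + c - e) (1 + d - e)
           (1 + f - e) (1 + g - e) (2 - e)
    / (Csin (PI * e) * Gamma a * Gamma b * Gamma c * Gamma d
       * Gamma (1 + f - e) * Gamma (1 + g - e) * Gamma (2 - e)).

(** [h] is holomorphic on the hyperplane near [p]: at every point [q] of the
    hyperplane close to [p], its restriction to the hyperplane has a
    [C]-linear differential. *)
Definition holomorphic_on_hyperplane_near (h : C7 -> C) (p : C7) : Prop :=
  locally p (fun q : C7 => saalschutzian q ->
    ex_filterdiff (K := C_AbsRing) h (within saalschutzian (locally q))).

(** [w] is the value at [p] of the continuation of [mishev_formula] along the
    hyperplane: that of a holomorphic function near [p] agreeing with the
    formula at generic points.  As the generic points are open, dense and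
    connected in the hyperplane, [w] is unique, and it is the value at [p] of
    the meromorphic continuation wherever the latter is holomorphic. *)
Definition is_mishevL (p : C7) (w : C) : Prop :=
  exists h : C7 -> C,
    holomorphic_on_hyperplane_near h p /\
    locally p (fun q : C7 =>
      saalschutzian q -> generic q -> h q = mishev_formula q) /\
    h p = w.

Definition mishevL (a b c d e f g : C) : C :=
  Cthe (is_mishevL (a, b, c, d, e, f, g)).

(* Main.v *)
Require Import Defs.
From Stdlib Require Import Reals ZArith Factorial Lra Lia Psatz ClassicalEpsilon.
From Coquelicot Require Import Coquelicot.
Local Open Scope C_scope.

(** The Mellin moment [int_0^1 x^(2 z - 1) E' x dx] is the Gamma quotient
    [W z = (pi/4) Gamma z Gamma (z + 1) / (Gamma (z + 1/2) Gamma (z + 3/2))],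
    because integrating an exact derivative gives a two-term recursion in [z]
    whose solution is pinned down by its behaviour as [z] tends to infinity.
    Expanding [K' x = sum_n b_n x^(2 n) (lambda_n - ln x)] and integrating
    termwise turns the moment into [sum_n b_n (lambda_n W(s+n) - W'(s+n) / 2)],
    with the derivative computed through the logarithmic moments.

    On the other side, put [d = 1 - e] and let [phi k] be the ratio of
    consecutive terms of the first series.  Up to Gamma factors the two series
    in the defining formula are [sum_n P_n] and [sum_n P_n T_n], where
    [P_n = prod_(j < n) phi j] and [T_n = prod_(j >= n) phi j / phi (j + d)],
    and [T_n = 1 + d D_n] with [D_n] holomorphic also at [d = 0].  Hence
    [- (d / sin (pi e)) sum_n P_n D_n], times Gamma factors, is the
    continuation across [e = 1], and its value there is the sum above. *)

(** The continuation lives in seven variables, so an infinite sum of infinite products must be shown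
    holomorphic on an open set of parameters containing points with [e = 1]. Everything is measured
    in one submultiplicative norm that bounds values, differentials and quadratic remainders
    together, and convergence is reduced to orders in [1 / (k + 1)]. The numerator parameters are
    paired with [e], [f], [g] and [1]; each pair gives a factor [1 + d m] with [m] of order
    [1 / k^2], which exposes [d] without a division. Eliminating [g] by the Saalschutzian relation
    extends all functions to the ambient space and makes the terms of size [1 / n^2]. The value is
    unique because two functions that are Lipschitz at the point agree on a line of generic
    parameters leading to it. At the point of the theorem [D_n] telescopes: its terms are
    differences of the logarithmic derivative of [W] and of [lambda], which is why the two sides
    coincide. The expansion of [K'] rests on a vanishing Wronskian, its constants being fixed by
    [K' = - ln x + 2 ln 2 + O(x)] at the origin. *)

Lemma filterlim_C_iff {T : Type} (F : (T -> Prop) -> Prop) {FF : Filter F} (f : T -> C) (l : C) :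
  filterlim f F (locally l) <->
  forall eps : R, (0 < eps)%R -> F (fun x => (Cmod (f x - l) < eps)%R).
Proof.
  rewrite (filterlim_locally_ball_norm (U := C_NormedModule)).
  split; intros H eps.
  - intros He. exact (H (mkposreal eps He)).
  - apply (H eps (cond_pos eps)).
Qed.


Lemma filterlim_C_mult {T : Type} (F : (T -> Prop) -> Prop) {FF : Filter F} (f g : T -> C) (a b : C) :
  filterlim f F (locally a) -> filterlim g F (locally b) ->
  filterlim (fun x => f x * g x) F (locally (a * b)).
Proof.
  rewrite !(filterlim_C_iff F). intros Hf Hg eps He.
  set (A := Cmod a). set (B := Cmod b).
  assert (HA : (0 <= A)%R) by apply Cmod_ge_0. assert (HB : (0 <= B)%R) by apply Cmod_ge_0.
  set (d := Rmin 1 (eps / (2 * (A + B + 1)))%R).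
  assert (Hd : (0 < d)%R).
  { apply Rmin_pos; [lra|]. apply Rdiv_lt_0_compat; lra. }
  generalize (filter_and _ _ (Hf d Hd) (Hg d Hd)). apply filter_imp. intros x [H1 H2].
  replace (f x * g x - a * b) with ((f x - a) * (g x - b) + (f x - a) * b + a * (g x - b)) by ring.
  eapply Rle_lt_trans. apply Cmod_triangle.
  eapply Rle_lt_trans. apply Rplus_le_compat_r. apply Cmod_triangle.
  rewrite !Cmod_mult. fold A B.
  assert (d <= 1)%R by apply Rmin_l.
  assert (d * (2 * (A + B + 1)) <= eps)%R.
  { apply Rle_trans with (eps / (2 * (A + B + 1)) * (2 * (A + B + 1)))%R.
    apply Rmult_le_compat_r. lra. apply Rmin_r. right. field. lra. }
  generalize (Cmod_ge_0 (f x - a)) (Cmod_ge_0 (g x - b)). intros.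
  nra.
Qed.

Lemma filterlim_C_plus {T : Type} (F : (T -> Prop) -> Prop) {FF : Filter F} (f g : T -> C) (a b : C) :
  filterlim f F (locally a) -> filterlim g F (locally b) ->
  filterlim (fun x => f x + g x) F (locally (a + b)).
Proof.
  rewrite !(filterlim_C_iff F). intros Hf Hg eps He.
  assert (He2 : (0 < eps / 2)%R) by lra.
  generalize (filter_and _ _ (Hf _ He2) (Hg _ He2)). apply filter_imp. intros x [H1 H2].
  replace (f x + g x - (a + b)) with ((f x - a) + (g x - b)) by ring.
  eapply Rle_lt_trans. apply Cmod_triangle. lra.
Qed.


Lemma filterlim_C_inv {T : Type} (F : (T -> Prop) -> Prop) {FF : Filter F} (f : T -> C) (a : C) :
  a <> 0 -> filterlim f F (locally a) -> filterlim (fun x => / f x) F (locally (/ a)).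
Proof.
  intros Ha. rewrite !(filterlim_C_iff F). intros Hf eps He.
  assert (HA := proj1 (Cmod_gt_0 a) Ha). set (A := Cmod a) in *.
  set (d := Rmin (A / 2) (eps * (A * A / 2))%R).
  assert (Hd : (0 < d)%R).
  { apply Rmin_pos; [lra|]. apply Rmult_lt_0_compat; nra. }
  generalize (Hf d Hd). apply filter_imp. intros x H.
  assert (d <= A / 2)%R by apply Rmin_l.
  assert (H2 : (A / 2 <= Cmod (f x))%R).
  { generalize (Cmod_triangle (f x) (a - f x)). replace (f x + (a - f x)) with a by ring.
    rewrite <- (Cmod_opp (a - f x)). replace (- (a - f x)) with (f x - a) by ring. fold A. lra. }
  assert (Hx : f x <> 0) by (apply Cmod_gt_0; lra).
  replace (/ f x - / a) with (- ((f x - a) / (f x * a))) by (field; auto).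
  rewrite Cmod_opp, Cmod_div, Cmod_mult by (apply Cmult_neq_0; auto). fold A.
  assert (d <= eps * (A * A / 2))%R by apply Rmin_r.
  apply Rmult_lt_reg_r with (Cmod (f x) * A)%R. nra.
  unfold Rdiv. rewrite Rmult_assoc, Rinv_l by nra.
  assert (eps * (A*A/2) <= eps * (Cmod (f x) * A))%R.
  { apply Rmult_le_compat_l. lra. nra. }
  nra.
Qed.

Lemma filterlim_C_unique {T : Type} (F : (T -> Prop) -> Prop) {FF : ProperFilter F} (f : T -> C) (a b : C) :
  filterlim f F (locally a) -> filterlim f F (locally b) -> a = b.
Proof.
  rewrite !(filterlim_C_iff F). intros H1 H2.
  destruct (Ceq_dec a b) as [E|E]; auto. exfalso.
  assert (P : (0 < Cmod (a - b) / 2)%R).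
  { apply Rdiv_lt_0_compat; [|lra]. apply Cmod_gt_0. intros H. apply E.
    replace a with (a - b + b) by ring. rewrite H. ring. }
  destruct (filter_ex _ (filter_and _ _ (H1 _ P) (H2 _ P))) as [x [A B]].
  generalize (Cmod_triangle (a - f x) (f x - b)). rewrite <- (Cmod_opp (a - f x)).
  replace (- (a - f x)) with (f x - a) by ring.
  replace (a - f x + (f x - b)) with (a - b) by ring. lra.
Qed.

(** * Definite descriptions and absolutely convergent complex series *)

Lemma Cthe_unique (P : C -> Prop) (x : C) : (forall y, P y -> y = x) -> P x -> Cthe P = x.
Proof. apply (iota_unique (V := C_CompleteNormedModule)). Qed.

(** A total function of the terms: on a divergent series it is whatever [Series] returns, so its
    meaning always comes through [is_series_Csum] or [Csum_unique]. *)
Definition Csum (u : nat -> C) : C := (Series (fun n => Re (u n)), Series (fun n => Im (u n))).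

Lemma sum_n_pair (u : nat -> C) (n : nat) :
  sum_n (G := C_AbelianGroup) u n = (sum_n (fun n => Re (u n)) n, sum_n (fun n => Im (u n)) n).
Proof.
  induction n. rewrite !sum_O. destruct (u 0%nat); reflexivity.
  rewrite !sum_Sn, IHn. reflexivity.
Qed.

Lemma im_le_Cmod (c : C) : (Rabs (Im c) <= Cmod c)%R.
Proof. apply Rle_trans with (2 := Rmax_Cmod c). apply Rmax_r. Qed.

Lemma is_series_Csum (u : nat -> C) (M : nat -> R) :
  (forall n, (Cmod (u n) <= M n)%R) -> ex_series M ->
  is_series (V := C_NormedModule) u (Csum u).
Proof.
  intros Hu HM.
  assert (H1 : is_series (fun n => Re (u n)) (Series (fun n => Re (u n)))).
  { apply Series_correct. apply (ex_series_le (V := R_CompleteNormedModule) _ M); auto.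
    intros n. eapply Rle_trans; [apply re_le_Cmod|apply Hu]. }
  assert (H2 : is_series (fun n => Im (u n)) (Series (fun n => Im (u n)))).
  { apply Series_correct. apply (ex_series_le (V := R_CompleteNormedModule) _ M); auto.
    intros n. eapply Rle_trans; [apply im_le_Cmod|apply Hu]. }
  unfold is_series in *.
  intros P [eps HP].
  assert (E1 := H1 _ (locally_ball (Series (fun n => Re (u n))) eps)).
  assert (E2 := H2 _ (locally_ball (Series (fun n => Im (u n))) eps)).
  unfold filtermap in *. generalize (filter_and _ _ E1 E2). apply filter_imp.
  intros n [B1 B2]. apply HP.
  change (@sum_n C_NormedModule u n) with (sum_n (G := C_AbelianGroup) u n).
  rewrite sum_n_pair. split; [exact B1|exact B2].
Qed.

Lemma sum_n_norm_le (u : nat -> C) (M : nat -> R) (n : nat) :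
  (forall n, (Cmod (u n) <= M n)%R) -> (Cmod (sum_n (G := C_AbelianGroup) u n) <= sum_n M n)%R.
Proof.
  intros H. induction n. rewrite !sum_O. apply H.
  rewrite !sum_Sn. eapply Rle_trans. apply Cmod_triangle.
  apply Rplus_le_compat; auto.
Qed.

Lemma is_series_C_le (u : nat -> C) (M : nat -> R) (l : C) :
  (forall n, (Cmod (u n) <= M n)%R) -> ex_series M -> is_series (V := C_NormedModule) u l ->
  (Cmod l <= Series M)%R.
Proof.
  intros Hu HM Hl.
  apply Rnot_lt_le. intros Hlt.
  unfold is_series in Hl. rewrite (filterlim_C_iff eventually) in Hl.
  assert (He : (0 < Cmod l - Series M)%R) by lra.
  destruct (Hl _ He) as [N HN]. specialize (HN N (Nat.le_refl _)).
  assert (HS : (sum_n M N <= Series M)%R).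
  { assert (L := Series_correct _ HM).
    apply (is_lim_seq_incr_compare (sum_n M)); auto.
    intros n. rewrite sum_Sn. assert (0 <= M (S n))%R by (eapply Rle_trans; [apply Cmod_ge_0| apply Hu]).
    unfold plus; simpl. lra. }
  assert (L := sum_n_norm_le u M N Hu).
  change (@sum_n C_NormedModule u N) with (sum_n (G := C_AbelianGroup) u N) in HN.
  generalize (Cmod_triangle (sum_n (G := C_AbelianGroup) u N) (l - sum_n (G := C_AbelianGroup) u N)).
  rewrite <- (Cmod_opp (l - _)). 
  replace (- (l - sum_n (G := C_AbelianGroup) u N)) with (sum_n (G := C_AbelianGroup) u N - l) by ring.
  replace (sum_n (G := C_AbelianGroup) u N + (l - sum_n (G := C_AbelianGroup) u N)) with l by ring. lra.
Qed.

Lemma is_series_C_unique (u : nat -> C) (l1 l2 : C) :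
  is_series (V := C_NormedModule) u l1 -> is_series (V := C_NormedModule) u l2 -> l1 = l2.
Proof. apply filterlim_C_unique, eventually_filter. Qed.

Lemma is_series_C_scal (c : C) (u : nat -> C) (l : C) :
  is_series (V := C_NormedModule) u l -> is_series (V := C_NormedModule) (fun n => c * u n) (c * l).
Proof. apply (is_series_scal (V := C_NormedModule) c). Qed.

Lemma is_series_C_plus (u v : nat -> C) (l m : C) :
  is_series (V := C_NormedModule) u l -> is_series (V := C_NormedModule) v m ->
  is_series (V := C_NormedModule) (fun n => u n + v n) (l + m).
Proof. apply (is_series_plus (V := C_NormedModule)). Qed.

Lemma is_series_C_minus (u v : nat -> C) (l m : C) :
  is_series (V := C_NormedModule) u l -> is_series (V := C_NormedModule) v m ->
  is_series (V := C_NormedModule) (fun n => u n - v n) (l - m).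
Proof. apply (is_series_minus (V := C_NormedModule)). Qed.

Lemma is_series_C_ext (u v : nat -> C) (l : C) :
  (forall n, u n = v n) ->
  is_series (V := C_NormedModule) u l -> is_series (V := C_NormedModule) v l.
Proof. apply (is_series_ext (V := C_NormedModule)). Qed.

Lemma Cmod_minus_sym (a b : C) : Cmod (a - b) = Cmod (b - a).
Proof. rewrite <- Cmod_opp. f_equal. ring. Qed.

(** * Functions with bounded second-order Taylor remainder *)

Section C2.
Context {V : NormedModule C_AbsRing}.
Implicit Types (f g : V -> C) (U : V -> Prop).

(** The operator bound is explicit so that the differentials of the terms of a series can be
    summed. *)
Definition clinear (l : V -> C) (M : R) : Prop :=
  (forall u v, l (plus u v) = l u + l v) /\ (forall (k : C) u, l (scal k u) = k * l u) /\
  (forall u, (Cmod (l u) <= M * norm u)%R).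

(** The least such [M] is a submultiplicative norm, which turns infinite sums
    and products of holomorphic functions into Banach algebra estimates. *)
Definition C2norm_le U f (M : R) : Prop :=
  exists (l : V -> V -> C) (M0 M1 M2 : R),
    (0 <= M0)%R /\ (0 <= M1)%R /\ (0 <= M2)%R /\ (M0 + M1 + M2 <= M)%R /\
    (forall x, U x -> (Cmod (f x) <= M0)%R) /\
    (forall x, U x -> clinear (l x) M1) /\
    (forall x y, U x -> U y -> (Cmod (f y - f x) <= M1 * norm (minus y x))%R) /\
    (forall x y, U x -> U y ->
      (Cmod (f y - f x - l x (minus y x)) <= M2 * (norm (minus y x) * norm (minus y x)))%R).

Lemma C2norm_le_mono U f M N : (M <= N)%R -> C2norm_le U f M -> C2norm_le U f N.
Proof.
  intros HN (l & M0 & M1 & M2 & H). exists l, M0, M1, M2. intuition. lra.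
Qed.

Lemma C2norm_le_ext U f g M :
  (forall x, U x -> f x = g x) -> C2norm_le U f M -> C2norm_le U g M.
Proof.
  intros E (l & M0 & M1 & M2 & H0 & H1 & H2 & H3 & H4 & H5 & H6 & H7).
  exists l, M0, M1, M2. repeat split; auto; intros; rewrite <- ?E; auto;
  apply H5; auto.
Qed.

Lemma C2norm_le_pos U f M : C2norm_le U f M -> (0 <= M)%R.
Proof. intros (l & M0 & M1 & M2 & H0 & H1 & H2 & H3 & _). lra. Qed.

Lemma C2norm_le_bound U f M x : C2norm_le U f M -> U x -> (Cmod (f x) <= M)%R.
Proof.
  intros (l & M0 & M1 & M2 & H0 & H1 & H2 & H3 & H4 & _) Hx.
  eapply Rle_trans; [apply H4; auto | lra].
Qed.

Lemma C2norm_le_const U (c : C) : C2norm_le U (fun _ => c) (Cmod c).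
Proof.
  exists (fun _ _ => 0), (Cmod c), 0%R, 0%R.
  assert (E : c - c = 0) by ring.
  repeat split; try apply Cmod_ge_0; try lra; intros; rewrite ?E; try ring;
   try (rewrite ?Rmult_0_l, ?Cmod_0; lra).
  replace (0 - 0) with (RtoC 0) by ring. rewrite Cmod_0. lra.
Qed.

Lemma C2norm_le_plus U f g M N :
  C2norm_le U f M -> C2norm_le U g N -> C2norm_le U (fun x => f x + g x) (M + N).
Proof.
  intros (l & M0 & M1 & M2 & H0 & H1 & H2 & H3 & H4 & H5 & H6 & H7)
         (k & N0 & N1 & N2 & K0 & K1 & K2 & K3 & K4 & K5 & K6 & K7).
  exists (fun x v => l x v + k x v), (M0 + N0)%R, (M1 + N1)%R, (M2 + N2)%R.
  split; [lra|]. split; [lra|]. split; [lra|]. split; [lra|].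
  split; [|split; [|split]].
  - intros x Hx. eapply Rle_trans; [apply Cmod_triangle|]. apply Rplus_le_compat; auto.
  - intros x Hx. destruct (H5 x Hx) as (A1 & A2 & A3). destruct (K5 x Hx) as (B1 & B2 & B3).
    repeat split; intros.
    + rewrite A1, B1. ring.
    + rewrite A2, B2. ring.
    + rewrite Rmult_plus_distr_r. eapply Rle_trans; [apply Cmod_triangle|]. apply Rplus_le_compat; auto.
  - intros x y Hx Hy. replace (f y + g y - (f x + g x)) with ((f y - f x) + (g y - g x)) by ring.
    rewrite Rmult_plus_distr_r. eapply Rle_trans; [apply Cmod_triangle|]. apply Rplus_le_compat; auto.
  - intros x y Hx Hy.
    replace (f y + g y - (f x + g x) - (l x (minus y x) + k x (minus y x))) with
      ((f y - f x - l x (minus y x)) + (g y - g x - k x (minus y x))) by ring.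
    rewrite Rmult_plus_distr_r. eapply Rle_trans; [apply Cmod_triangle|]. apply Rplus_le_compat; auto.
Qed.

(** By the Leibniz rule the triples [(M0, M1, M2)] and [(N0, N1, N2)] multiply like polynomials
    truncated after degree two, so the total is at most the full product. *)
Lemma C2norm_le_mult U f g M N :
  C2norm_le U f M -> C2norm_le U g N -> C2norm_le U (fun x => f x * g x) (M * N).
Proof.
  intros (l & M0 & M1 & M2 & H0 & H1 & H2 & H3 & H4 & H5 & H6 & H7)
         (k & N0 & N1 & N2 & K0 & K1 & K2 & K3 & K4 & K5 & K6 & K7).
  exists (fun x v => l x v * g x + f x * k x v), (M0 * N0)%R, (M0 * N1 + M1 * N0)%R,
     (M0 * N2 + M2 * N0 + M1 * N1)%R.
  split; [nra|]. split; [nra|]. split; [assert (0 <= M0 * N2)%R by nra; assert (0 <= M2 * N0)%R by nra; nra|].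
  split.
  { apply Rle_trans with ((M0 + M1 + M2) * (N0 + N1 + N2))%R.
    - assert (0 <= M1 * N2)%R by nra. assert (0 <= M2 * N1)%R by nra. assert (0 <= M2 * N2)%R by nra. lra.
    - apply Rmult_le_compat; lra. }
  split; [|split; [|split]].
  - intros x Hx. rewrite Cmod_mult. apply Rmult_le_compat; auto; apply Cmod_ge_0.
  - intros x Hx. destruct (H5 x Hx) as (A1 & A2 & A3). destruct (K5 x Hx) as (B1 & B2 & B3).
    repeat split; intros.
    + rewrite A1, B1. ring.
    + rewrite A2, B2. ring.
    + eapply Rle_trans; [apply Cmod_triangle|]. rewrite !Cmod_mult.
      generalize (A3 u) (B3 u) (H4 x Hx) (K4 x Hx) (Cmod_ge_0 (f x)) (Cmod_ge_0 (g x))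
        (Cmod_ge_0 (l x u)) (Cmod_ge_0 (k x u)). intros.
      assert (Cmod (l x u) * Cmod (g x) <= (M1 * norm u) * N0)%R by (apply Rmult_le_compat; auto).
      assert (Cmod (f x) * Cmod (k x u) <= M0 * (N1 * norm u))%R by (apply Rmult_le_compat; auto).
      lra.
  - intros x y Hx Hy.
    replace (f y * g y - f x * g x) with ((f y - f x) * g y + f x * (g y - g x)) by ring.
    eapply Rle_trans; [apply Cmod_triangle|]. rewrite !Cmod_mult.
    assert (Cmod (f y - f x) * Cmod (g y) <= (M1 * norm (minus y x)) * N0)%R
      by (apply Rmult_le_compat; auto; apply Cmod_ge_0).
    assert (Cmod (f x) * Cmod (g y - g x) <= M0 * (N1 * norm (minus y x)))%R
      by (apply Rmult_le_compat; auto; apply Cmod_ge_0).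
    lra.
  - intros x y Hx Hy. set (v := minus y x).
    replace (f y * g y - f x * g x - (l x v * g x + f x * k x v)) with
      (f x * (g y - g x - k x v) + (f y - f x - l x v) * g x + (f y - f x) * (g y - g x)) by ring.
    eapply Rle_trans; [apply Cmod_triangle|].
    eapply Rle_trans; [apply Rplus_le_compat_r; apply Cmod_triangle|].
    rewrite !Cmod_mult.
    assert (Cmod (f x) * Cmod (g y - g x - k x v) <= M0 * (N2 * (norm v * norm v)))%R
      by (apply Rmult_le_compat; auto; try apply Cmod_ge_0; apply K7; auto).
    assert (Cmod (f y - f x - l x v) * Cmod (g x) <= (M2 * (norm v * norm v)) * N0)%R
      by (apply Rmult_le_compat; auto; try apply Cmod_ge_0; apply H7; auto).
    assert (Cmod (f y - f x) * Cmod (g y - g x) <= (M1 * norm v) * (N1 * norm v))%R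
      by (apply Rmult_le_compat; auto; apply Cmod_ge_0).
    lra.
Qed.

Lemma C2norm_le_scal U (c : C) f M :
  C2norm_le U f M -> C2norm_le U (fun x => c * f x) (Cmod c * M).
Proof. intros H. apply (C2norm_le_mult U (fun _ => c) f); auto. apply C2norm_le_const. Qed.

Lemma C2norm_le_opp U f M : C2norm_le U f M -> C2norm_le U (fun x => - f x) M.
Proof.
  intros H. apply C2norm_le_ext with (fun x => (- (1)) * f x). intros; ring.
  replace M with (Cmod (- (1)) * M)%R. now apply C2norm_le_scal. rewrite Cmod_m1. ring.
Qed.


Lemma C2norm_le_affine U (l : V -> C) (c : C) (K M : R) :
  (0 <= K)%R -> (0 <= M)%R -> clinear l K -> (forall x, U x -> (Cmod (l x + c) <= M)%R) ->
  C2norm_le U (fun x => l x + c) (M + K).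
Proof.
  intros HK HM Hl Hb. exists (fun _ => l), M, K, 0%R.
  assert (E : forall x y : V, l (minus y x) = l y - l x).
  { intros x y. destruct Hl as (A & _).
    assert (E0 : l (plus (minus y x) x) = l y).
    { f_equal. unfold minus. rewrite <- plus_assoc, plus_opp_l. apply plus_zero_r. }
    rewrite <- E0, A. ring. }
  split; [lra|]. split; [lra|]. split; [lra|]. split; [lra|].
  split; [|split; [|split]].
  - exact Hb.
  - intros; exact Hl.
  - intros x y Hx Hy. replace (l y + c - (l x + c)) with (l (minus y x)) by (rewrite E; ring).
    apply Hl.
  - intros x y Hx Hy. rewrite E. replace (l y + c - (l x + c) - (l y - l x)) with (RtoC 0) by ring.
    rewrite Cmod_0. lra.
Qed.

(** The bounds for [1 / f] added up: [/ eta] for the values, [M / eta ^ 2] for the differential, and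
    for the remainder [M / eta ^ 2] from the remainder of [f] plus [M ^ 2 / eta ^ 3] from the
    squared increment. *)
Definition invK (M eta : R) : R := (/ eta + M / eta ^ 2 + (M / eta ^ 2 + M ^ 2 / eta ^ 3))%R.

Lemma C2norm_le_inv U f M eta :
  (0 < eta)%R -> (forall x, U x -> (eta <= Cmod (f x))%R) ->
  C2norm_le U f M -> C2norm_le U (fun x => / f x) (invK M eta).
Proof.
  intros He Hf (l & M0 & M1 & M2 & H0 & H1 & H2 & H3 & H4 & H5 & H6 & H7).
  assert (Hn : forall x, U x -> f x <> 0).
  { intros x Hx. apply Cmod_gt_0. specialize (Hf x Hx). lra. }
  assert (Hi : forall x, U x -> (Cmod (/ f x) <= / eta)%R).
  { intros x Hx. rewrite Cmod_inv by auto. apply Rinv_le_contravar; auto. }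
  assert (P1 : (0 < / eta)%R) by (apply Rinv_0_lt_compat; auto).
  set (e := (/ eta)%R) in *.
  assert (Hi2 : forall x y, U x -> U y -> (Cmod (/ f x) * Cmod (/ f y) <= e * e)%R).
  { intros. apply Rmult_le_compat; auto; apply Cmod_ge_0. }
  assert (Hi3 : forall x y, U x -> U y -> (Cmod (/ f x) * Cmod (/ f x) * Cmod (/ f y) <= e * e * e)%R).
  { intros. apply Rmult_le_compat; auto; try apply Cmod_ge_0.
    apply Rmult_le_pos; apply Cmod_ge_0. }
  assert (0 < e * e)%R by nra. assert (0 < e * e * e)%R by nra.
  exists (fun x v => - (/ f x * / f x * l x v)), e, (e * e * M1)%R, (e * e * M2 + e * e * e * (M1 * M1))%R.
  split; [lra|]. split; [nra|]. split; [assert (0 <= M1 * M1)%R by nra; nra|].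
  split.
  { unfold invK. fold e. replace (M / eta ^ 2)%R with (e * e * M)%R by (unfold e; field; lra).
    replace (M ^ 2 / eta ^ 3)%R with (e * e * e * (M * M))%R by (unfold e; field; lra).
    assert (M1 * M1 <= M * M)%R by (apply Rmult_le_compat; lra).
    assert (M1 <= M)%R by lra. assert (M2 <= M)%R by lra.
    nra. }
  split; [|split; [|split]].
  - exact Hi.
  - intros x Hx. destruct (H5 x Hx) as (A1 & A2 & A3).
    repeat split; intros.
    + rewrite A1. ring.
    + rewrite A2. ring.
    + rewrite Cmod_opp, !Cmod_mult, (Rmult_assoc (e * e)).
      apply Rmult_le_compat; [apply Rmult_le_pos; apply Cmod_ge_0|apply Cmod_ge_0|apply Hi2; auto|apply A3].
  - intros x y Hx Hy.
    replace (/ f y - / f x) with (- (/ f x * / f y * (f y - f x))) by (field; auto).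
    rewrite Cmod_opp, !Cmod_mult, (Rmult_assoc (e * e)).
    apply Rmult_le_compat; [apply Rmult_le_pos; apply Cmod_ge_0|apply Cmod_ge_0|apply Hi2; auto|apply H6; auto].
  - intros x y Hx Hy. set (v := minus y x).
    replace (/ f y - / f x - - (/ f x * / f x * l x v)) with
      (- (/ f x * / f x * (f y - f x - l x v)) + / f x * / f x * / f y * ((f y - f x) * (f y - f x))) by (field; auto).
    eapply Rle_trans; [apply Cmod_triangle|]. rewrite Cmod_opp, !Cmod_mult.
    rewrite Rmult_plus_distr_r. apply Rplus_le_compat.
    + rewrite (Rmult_assoc (e * e)). apply Rmult_le_compat;
      [apply Rmult_le_pos; apply Cmod_ge_0|apply Cmod_ge_0|apply Hi2; auto|apply H7; auto].
    + rewrite (Rmult_assoc (e * e * e)). apply Rmult_le_compat.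
      apply Rmult_le_pos; [apply Rmult_le_pos|]; apply Cmod_ge_0.
      apply Rmult_le_pos; apply Cmod_ge_0.
      apply Hi3; auto.
      replace (M1 * M1 * (norm v * norm v))%R with ((M1 * norm v) * (M1 * norm v))%R by ring.
      apply Rmult_le_compat; try apply Cmod_ge_0; apply H6; auto.
Qed.

(** Weierstrass M-test: values, differentials and remainder estimates are summed term by term
    against the same majorant. Replacing each of the three partial bounds of a term by its full norm
    costs the factor 3. *)
Lemma C2norm_le_series U (f : nat -> V -> C) (M : nat -> R) :
  (forall n, C2norm_le U (f n) (M n)) -> ex_series M ->
  C2norm_le U (fun x => Csum (fun n => f n x)) (3 * Series M).
Proof.
  intros H HM.
  assert (HM0 : forall n, (0 <= M n)%R) by (intros n; apply (C2norm_le_pos U (f n)); auto).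
  assert (HS : (0 <= Series M)%R).
  { replace 0%R with (Series (fun n => 0 * M n)%R) by (rewrite Series_scal_l; ring).
    apply Series_le; auto. intros n. specialize (HM0 n). lra. }
  (* The differentials sit under an existential for each [n]; they are chosen simultaneously so that
     they can be summed. *)
  set (l := fun n => proj1_sig (constructive_indefinite_description _ (H n))).
  assert (Hl : forall n, exists M0 M1 M2, (0 <= M0)%R /\ (0 <= M1)%R /\ (0 <= M2)%R /\ (M0 + M1 + M2 <= M n)%R /\
    (forall x, U x -> (Cmod (f n x) <= M0)%R) /\
    (forall x, U x -> clinear (l n x) M1) /\
    (forall x y, U x -> U y -> (Cmod (f n y - f n x) <= M1 * norm (minus y x))%R) /\
    (forall x y, U x -> U y -> (Cmod (f n y - f n x - l n x (minus y x)) <= M2 * (norm (minus y x) * norm (minus y x)))%R)).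
  { intros n. unfold l. apply (proj2_sig (constructive_indefinite_description _ (H n))). }
  clearbody l.
  assert (B0 : forall n x, U x -> (Cmod (f n x) <= M n)%R).
  { intros n x Hx. apply C2norm_le_bound with U; auto. }
  assert (B1 : forall n x, U x -> clinear (l n x) (M n)).
  { intros n x Hx. destruct (Hl n) as (M0 & M1 & M2 & a & b & c & d & A1 & A2 & A3 & A4).
    destruct (A2 x Hx) as (C1 & C2 & C3). split; [|split]; auto.
    intros u. eapply Rle_trans; [apply C3|]. apply Rmult_le_compat_r. apply norm_ge_0. lra. }
  assert (B2 : forall n x y, U x -> U y -> (Cmod (f n y - f n x) <= M n * norm (minus y x))%R).
  { intros n x y Hx Hy. destruct (Hl n) as (M0 & M1 & M2 & a & b & c & d & A1 & A2 & A3 & A4).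
    eapply Rle_trans; [apply A3; auto|]. apply Rmult_le_compat_r. apply norm_ge_0. lra. }
  assert (B3 : forall n x y, U x -> U y -> (Cmod (f n y - f n x - l n x (minus y x)) <= M n * (norm (minus y x) * norm (minus y x)))%R).
  { intros n x y Hx Hy. destruct (Hl n) as (M0 & M1 & M2 & a & b & c & d & A1 & A2 & A3 & A4).
    eapply Rle_trans; [apply A4; auto|]. apply Rmult_le_compat_r. 
    apply Rmult_le_pos; apply norm_ge_0. lra. }
  assert (SC : forall c, ex_series (fun n => M n * c)%R) by (intros; apply ex_series_scal_r; auto).
  assert (Hf : forall x, U x -> is_series (V := C_NormedModule) (fun n => f n x) (Csum (fun n => f n x))).
  { intros x Hx. apply is_series_Csum with M; auto. }
  assert (Hk : forall x v, U x -> is_series (V := C_NormedModule) (fun n => l n x v) (Csum (fun n => l n x v))).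
  { intros x v Hx. apply is_series_Csum with (fun n => M n * norm v)%R; auto. intros n. apply B1; auto. }
  exists (fun x v => Csum (fun n => l n x v)), (Series M), (Series M), (Series M).
  split; [lra|]. split; [lra|]. split; [lra|]. split; [lra|].
  split; [|split; [|split]].
  - intros x Hx. apply is_series_C_le with (fun n => f n x); auto.
  - intros x Hx. split; [|split].
    + intros u v. apply is_series_C_unique with (fun n => l n x (plus u v)); auto.
      apply is_series_C_ext with (fun n => l n x u + l n x v).
      intros n. symmetry. apply (B1 n x Hx). apply is_series_C_plus; auto.
    + intros k u. apply is_series_C_unique with (fun n => l n x (scal k u)); auto.
      apply is_series_C_ext with (fun n => k * l n x u).
      intros n. symmetry. apply (B1 n x Hx). apply is_series_C_scal; auto.
    + intros u. rewrite <- Series_scal_r. apply is_series_C_le with (fun n => l n x u); auto.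
      intros n. apply B1; auto.
  - intros x y Hx Hy. rewrite <- Series_scal_r.
    apply is_series_C_le with (fun n => f n y - f n x); auto.
    apply is_series_C_minus; auto.
  - intros x y Hx Hy. rewrite <- Series_scal_r.
    apply is_series_C_le with (fun n => f n y - f n x - l n x (minus y x)); auto.
    apply is_series_C_minus; auto. apply is_series_C_minus; auto.
Qed.

End C2.

(** * The complex exponential and its Taylor remainders *)

Lemma RtoC_neq (a b : R) : a <> b -> RtoC a <> RtoC b.
Proof. intros H E. apply H. now apply RtoC_inj. Qed.

Lemma Cexp_plus (a b : C) : Cexp (a + b) = Cexp a * Cexp b.
Proof.
  destruct a as [a1 a2], b as [b1 b2]. unfold Cexp, Cplus, Cmult; simpl.
  rewrite exp_plus, cos_plus, sin_plus. f_equal; ring.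
Qed.

Lemma Cexp_0 : Cexp 0 = 1.
Proof. unfold Cexp; simpl. rewrite exp_0, cos_0, sin_0. unfold RtoC. f_equal; ring. Qed.

Lemma Cexp_neq_0 (z : C) : Cexp z <> 0.
Proof.
  intros H. assert (E : Cexp (z + - z) = 1) by (replace (z + - z) with (RtoC 0) by ring; apply Cexp_0).
  rewrite Cexp_plus, H in E. rewrite Cmult_0_l in E. injection E. lra.
Qed.

Lemma Cexp_opp (z : C) : Cexp (- z) = / Cexp z.
Proof.
  assert (E : Cexp (z + - z) = 1) by (replace (z + - z) with (RtoC 0) by ring; apply Cexp_0).
  rewrite Cexp_plus in E. rewrite <- (Cmult_1_l (/ Cexp z)), <- E. field. apply Cexp_neq_0.
Qed.

Lemma Cmod_Cexp (z : C) : Cmod (Cexp z) = exp (Re z).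
Proof.
  unfold Cmod, Cexp; simpl.
  replace (exp (fst z) * cos (snd z) * (exp (fst z) * cos (snd z) * 1) +
    exp (fst z) * sin (snd z) * (exp (fst z) * sin (snd z) * 1))%R with
   (exp (fst z) * exp (fst z) * (Rsqr (sin (snd z)) + Rsqr (cos (snd z))))%R by (unfold Rsqr; ring).
  rewrite sin2_cos2, Rmult_1_r. apply sqrt_square. left; apply exp_pos.
Qed.

Lemma Cmod_Cexp_le (z : C) : (Cmod (Cexp z) <= exp (Cmod z))%R.
Proof.
  rewrite Cmod_Cexp. assert (H : (Re z <= Cmod z)%R).
  { eapply Rle_trans; [apply Rle_abs|apply re_le_Cmod]. }
  destruct H as [H|H]. left; now apply exp_increasing. rewrite H; lra.
Qed.

Lemma exp_le (a b : R) : (a <= b)%R -> (exp a <= exp b)%R.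
Proof. intros [H|H]. left; now apply exp_increasing. rewrite H; lra. Qed.

(** With [z] the total increment, the real mean value theorem applied to the real part of
    [conj z * f t] gives [|z|^2] as a value of its derivative, and Cauchy-Schwarz cancels one factor
    [|z|]. *)
Lemma C_mean_value (f f' : R -> C) :
  (forall t : R, (0 <= t <= 1)%R -> is_derive (fun t => Re (f t)) t (Re (f' t)) /\
      is_derive (fun t => Im (f t)) t (Im (f' t))) ->
  exists c : R, (0 <= c <= 1)%R /\ (Cmod (f 1%R - f 0%R) <= Cmod (f' c))%R.
Proof.
  intros H. set (z := f 1%R - f 0%R).
  set (phi := fun t : R => (Re z * Re (f t) + Im z * Im (f t))%R).
  destruct (MVT_gen phi 0 1 (fun t => Re z * Re (f' t) + Im z * Im (f' t))%R) as (c & Hc & E).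
  - intros x Hx. rewrite Rmin_left, Rmax_right in Hx by lra. destruct (H x) as [A B]; [lra|].
    unfold phi. apply (is_derive_plus (fun t => Re z * Re (f t))%R (fun t => Im z * Im (f t))%R);
    apply is_derive_scal; assumption.
  - intros x Hx. rewrite Rmin_left, Rmax_right in Hx by lra. destruct (H x) as [A B]; [lra|].
    apply derivable_continuous_pt.
    exists (Re z * Re (f' x) + Im z * Im (f' x))%R. apply is_derive_Reals.
    unfold phi. apply (is_derive_plus (fun t => Re z * Re (f t))%R (fun t => Im z * Im (f t))%R);
    apply is_derive_scal; assumption.
  - rewrite Rmin_left, Rmax_right in Hc by lra. exists c; split; auto.
    rewrite Rminus_0_r, Rmult_1_r in E.
    assert (E2 : (phi 1 - phi 0 = Cmod z ^ 2)%R).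
    { rewrite Cmod2_alt. unfold phi. unfold z. unfold Cminus, Cplus, Copp, Re, Im; simpl. ring. }
    assert (E3 : (Re z * Re (f' c) + Im z * Im (f' c) <= Cmod z * Cmod (f' c))%R).
    { rewrite <- (Cmod_conj z), <- Cmod_mult.
      eapply Rle_trans; [|eapply Rle_trans; [apply Rle_abs|apply re_le_Cmod]].
      right. unfold Cmult, Cconj, Re, Im; simpl. ring. }
    generalize (Cmod_ge_0 z) (Cmod_ge_0 (f' c)). intros P Q.
    destruct P as [P|P]; [|rewrite <- P; lra].
    apply Rmult_le_reg_l with (Cmod z); auto. 
    apply Rle_trans with (2 := E3). rewrite <- E, E2. right; ring.
Qed.

Lemma is_derive_Cexp_line (w : C) (t : R) :
  is_derive (fun t : R => Re (Cexp (t * w))) t (Re (w * Cexp (t * w))) /\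
  is_derive (fun t : R => Im (Cexp (t * w))) t (Im (w * Cexp (t * w))).
Proof.
  destruct w as [a b]. unfold Cexp, Cmult, Re, Im, RtoC; simpl.
  unfold Rminus; split; auto_derive; auto; ring.
Qed.

Lemma Cmod_scale_le (c : R) (w : C) : (0 <= c <= 1)%R -> (Cmod (c * w) <= Cmod w)%R.
Proof.
  intros H. rewrite Cmod_mult, Cmod_R, Rabs_pos_eq by lra. generalize (Cmod_ge_0 w); nra.
Qed.

(** Along the segment [t * w] the derivative of each Taylor remainder is [w] times the preceding
    remainder, so this bound and the next two follow one from another by [C_mean_value]; the
    factorials are dropped. *)
Lemma Cexp_sub_1_le (w : C) : (Cmod (Cexp w - 1) <= Cmod w * exp (Cmod w))%R.
Proof.
  destruct (C_mean_value (fun t => Cexp (t * w)) (fun t => w * Cexp (t * w))) as (c & Hc & E).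
  { intros t _. apply is_derive_Cexp_line. }
  rewrite Cmult_1_l, Cmult_0_l, Cexp_0 in E. eapply Rle_trans; [apply E|].
  rewrite Cmod_mult. apply Rmult_le_compat_l. apply Cmod_ge_0.
  eapply Rle_trans; [apply Cmod_Cexp_le|]. apply exp_le. now apply Cmod_scale_le.
Qed.

Lemma Cexp_taylor2_le (w : C) : (Cmod (Cexp w - 1 - w) <= Cmod w * Cmod w * exp (Cmod w))%R.
Proof.
  destruct (C_mean_value (fun t => Cexp (t * w) - 1 - t * w) (fun t => w * (Cexp (t * w) - 1))) as (c & Hc & E).
  { intros t _. destruct (is_derive_Cexp_line w t) as [A B]. split.
    - apply is_derive_ext with (fun t : R => Re (Cexp (t * w)) - 1 - t * Re w)%R.
      { intros u. destruct w; unfold Cexp, Cmult, Cminus, Cplus, Copp, Re, Im, RtoC; simpl. ring. }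
      replace (Re (w * (Cexp (t * w) - 1))) with (Re (w * Cexp (t * w)) - 0 - Re w)%R.
      2:{ destruct w; unfold Cexp, Cmult, Cminus, Cplus, Copp, Re, Im, RtoC; simpl. ring. }
      apply (is_derive_minus (fun t : R => (Re (Cexp (t * w)) - 1)%R) (fun t => t * Re w)%R).
      apply (is_derive_minus (fun t : R => (Re (Cexp (t * w)))%R) (fun t => 1%R)). auto.
      apply (is_derive_const (V := R_NormedModule)). auto_derive; auto; ring.
    - apply is_derive_ext with (fun t : R => Im (Cexp (t * w)) - 0 - t * Im w)%R.
      { intros u. destruct w; unfold Cexp, Cmult, Cminus, Cplus, Copp, Re, Im, RtoC; simpl. ring. }
      replace (Im (w * (Cexp (t * w) - 1))) with (Im (w * Cexp (t * w)) - 0 - Im w)%R.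
      2:{ destruct w; unfold Cexp, Cmult, Cminus, Cplus, Copp, Re, Im, RtoC; simpl. ring. }
      apply (is_derive_minus (fun t : R => (Im (Cexp (t * w)) - 0)%R) (fun t => t * Im w)%R).
      apply (is_derive_minus (fun t : R => (Im (Cexp (t * w)))%R) (fun t => 0%R)). auto.
      apply (is_derive_const (V := R_NormedModule)). auto_derive; auto; ring. }
  rewrite !Cmult_1_l, !Cmult_0_l, Cexp_0 in E.
  replace (Cexp w - 1 - w - (1 - 1 - 0)) with (Cexp w - 1 - w) in E by ring.
  eapply Rle_trans; [apply E|]. rewrite Cmod_mult, Rmult_assoc. apply Rmult_le_compat_l. apply Cmod_ge_0.
  eapply Rle_trans; [apply Cexp_sub_1_le|].
  apply Rmult_le_compat. apply Cmod_ge_0. left; apply exp_pos. now apply Cmod_scale_le.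
  apply exp_le. now apply Cmod_scale_le.
Qed.

Lemma is_derive_quadratic (c a b t : R) :
  is_derive (fun t : R => c + t * a + t * t * / 2 * b)%R t (a + t * b)%R.
Proof. auto_derive; auto. field. Qed.

Lemma Cexp_taylor3_le (w : C) :
  (Cmod (Cexp w - 1 - w - w * w / 2) <= Cmod w * Cmod w * Cmod w * exp (Cmod w))%R.
Proof.
  destruct (C_mean_value (fun t => Cexp (t * w) - 1 - t * w - (t * w) * (t * w) / 2)
     (fun t => w * (Cexp (t * w) - 1 - t * w))) as (c & Hc & E).
  { intros t _. destruct (is_derive_Cexp_line w t) as [A B].
    assert (H2 : forall z : C, z / 2 = (RtoC (/ 2)) * z).
    { intros. rewrite RtoC_inv by lra. field. }
    split.
    - apply is_derive_ext with (fun t : R => Re (Cexp (t * w)) - (1 + t * Re w + t * t * / 2 * Re (w * w)))%R.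
      { intros u. rewrite H2. destruct w; unfold Cexp, Cmult, Cminus, Cplus, Copp, Re, Im, RtoC; simpl. ring. }
      replace (Re (w * (Cexp (t * w) - 1 - t * w))) with (Re (w * Cexp (t * w)) - (Re w + t * Re (w * w)))%R.
      2:{ destruct w; unfold Cexp, Cmult, Cminus, Cplus, Copp, Re, Im, RtoC; simpl. ring. }
      apply (is_derive_minus (fun t : R => (Re (Cexp (t * w)))%R)); auto.
      exact (is_derive_quadratic 1 (Re w) (Re (w * w)) t).
    - apply is_derive_ext with (fun t : R => Im (Cexp (t * w)) - (0 + t * Im w + t * t * / 2 * Im (w * w)))%R.
      { intros u. rewrite H2. destruct w; unfold Cexp, Cmult, Cminus, Cplus, Copp, Re, Im, RtoC; simpl. ring. }
      replace (Im (w * (Cexp (t * w) - 1 - t * w))) with (Im (w * Cexp (t * w)) - (Im w + t * Im (w * w)))%R.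
      2:{ destruct w; unfold Cexp, Cmult, Cminus, Cplus, Copp, Re, Im, RtoC; simpl. ring. }
      apply (is_derive_minus (fun t : R => (Im (Cexp (t * w)))%R)); auto.
      exact (is_derive_quadratic 0 (Im w) (Im (w * w)) t). }
  rewrite !Cmult_1_l, !Cmult_0_l, Cexp_0 in E.
  replace (Cexp w - 1 - w - w * w / 2 - (1 - 1 - 0 - 0 / 2)) with (Cexp w - 1 - w - w * w / 2) in E
    by field.
  eapply Rle_trans; [apply E|]. rewrite Cmod_mult, !Rmult_assoc. apply Rmult_le_compat_l. apply Cmod_ge_0.
  eapply Rle_trans; [apply Cexp_taylor2_le|]. rewrite <- Rmult_assoc.
  generalize (Cmod_scale_le c w Hc) (Cmod_ge_0 (c * w)) (Cmod_ge_0 w). intros.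
  apply Rmult_le_compat. apply Rmult_le_pos; apply Cmod_ge_0. left; apply exp_pos.
  apply Rmult_le_compat; auto. apply exp_le; auto.
Qed.

(** * Infinite products depending on parameters *)

Fixpoint Cprod (u : nat -> C) (n : nat) : C :=
  match n with O => 1 | S m => Cprod u m * u m end.

Lemma Cprod_ext (u v : nat -> C) (n : nat) :
  (forall k, (k < n)%nat -> u k = v k) -> Cprod u n = Cprod v n.
Proof. induction n; intros H; simpl; auto. rewrite IHn, H; auto. Qed.

Lemma Cprod_mult (u v : nat -> C) (n : nat) :
  Cprod (fun k => u k * v k) n = Cprod u n * Cprod v n.
Proof. induction n; simpl. ring. rewrite IHn. ring. Qed.

Lemma Cprod_neq_0 (u : nat -> C) (n : nat) : (forall k, u k <> 0) -> Cprod u n <> 0.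
Proof.
  intros H. induction n; simpl. intros E; injection E; lra. apply Cmult_neq_0; auto.
Qed.

Lemma Cprod_plus_index (u : nat -> C) (n m : nat) :
  Cprod u (n + m) = Cprod u n * Cprod (fun k => u (n + k)%nat) m.
Proof.
  induction m. rewrite Nat.add_0_r. simpl. ring.
  rewrite Nat.add_succ_r. simpl. rewrite IHm. ring.
Qed.

(** The divided difference [(prod_k (1 + d g k) - 1) / d], written so that it
    also makes sense at [d = 0]. *)
Definition prodquot (d : C) (g : nat -> C) : C :=
  Csum (fun j => Cprod (fun i => 1 + d * g i) j * g j).

Section Products.
Context {V : NormedModule C_AbsRing}.
Variables (U : V -> Prop) (d : V -> C) (D : R) (g : nat -> V -> C) (m : nat -> R).
Hypothesis Hd : C2norm_le U d D.
Hypothesis Hg : forall k, C2norm_le U (g k) (m k).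
Hypothesis Hm : ex_series m.

Lemma sum_n_le_Series (a : nat -> R) (n : nat) :
  (forall k, (0 <= a k)%R) -> ex_series a -> (sum_n a n <= Series a)%R.
Proof using.
  intros Ha H. apply (is_lim_seq_incr_compare (sum_n a)). apply (Series_correct _ H).
  intros k. rewrite sum_Sn. specialize (Ha (S k)). unfold plus; simpl. lra.
Qed.

(** Submultiplicativity together with [1 + D m_k <= exp (D m_k)]; the bound is uniform in [n], as
    the summation in [prodquot] requires. *)
Lemma C2norm_le_Cprod n :
  C2norm_le U (fun x => Cprod (fun k => 1 + d x * g k x) n) (exp (D * Series m)).
Proof.
  assert (Hm0 : forall k, (0 <= m k)%R) by (intros k; apply (C2norm_le_pos U (g k)); auto).
  assert (HD : (0 <= D)%R) by (apply (C2norm_le_pos U d); auto).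
  assert (B1 : forall k, C2norm_le U (fun x => 1 + d x * g k x) (exp (D * m k))).
  { intros k. apply C2norm_le_mono with (Cmod 1 + D * m k)%R.
    rewrite Cmod_1. apply exp_ineq1_le.
    apply C2norm_le_plus. apply C2norm_le_const. now apply C2norm_le_mult. }
  assert (B : C2norm_le U (fun x => Cprod (fun k => 1 + d x * g k x) (S n)) (exp (D * sum_n m n))).
  { induction n.
    - rewrite sum_O. apply C2norm_le_ext with (2 := B1 0%nat). intros; simpl. ring.
    - rewrite sum_Sn. unfold plus; simpl. rewrite Rmult_plus_distr_l, exp_plus.
      apply (C2norm_le_mult U (fun x => Cprod (fun k => 1 + d x * g k x) (S n))); auto. }
  clear B.
  (* [sum_n m p] has [p + 1] terms, so it goes with the product of [S p] factors, and the empty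
     product gets the bound 1 separately. *)
  assert (B : C2norm_le U (fun x => Cprod (fun k => 1 + d x * g k x) n)
     (match n with O => 1 | S p => exp (D * sum_n m p) end)).
  { induction n.
    - apply C2norm_le_mono with (Cmod 1). rewrite Cmod_1; lra. apply C2norm_le_const.
    - simpl. eapply C2norm_le_mono; [|apply (C2norm_le_mult U (fun x => Cprod (fun k => 1 + d x * g k x) n)); [apply IHn|apply B1]].
      destruct n. rewrite sum_O. lra.
      rewrite sum_Sn. unfold plus; simpl. rewrite Rmult_plus_distr_l, exp_plus. lra. }
  apply C2norm_le_mono with (2 := B). destruct n.
  - rewrite <- exp_0. apply exp_le. apply Rmult_le_pos; auto.
    apply Rle_trans with (sum_n m 0). rewrite sum_O; auto. now apply sum_n_le_Series.
  - apply exp_le. apply Rmult_le_compat_l; auto. now apply sum_n_le_Series.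
Qed.

Lemma C2norm_le_prodquot :
  C2norm_le U (fun x => prodquot (d x) (fun k => g k x)) (3 * (exp (D * Series m) * Series m)).
Proof.
  rewrite <- Series_scal_l. apply C2norm_le_series.
  - intros n. apply C2norm_le_mult; auto. apply C2norm_le_Cprod.
  - apply (ex_series_scal_l (V := R_NormedModule) (exp (D * Series m)) m); auto.
Qed.

Lemma is_series_prodquot x : U x ->
  is_series (V := C_NormedModule) (fun j => Cprod (fun i => 1 + d x * g i x) j * g j x)
    (prodquot (d x) (fun k => g k x)).
Proof.
  intros Hx. apply is_series_Csum with (fun n => exp (D * Series m) * m n)%R.
  - intros n. apply (C2norm_le_bound U (fun x => Cprod (fun i => 1 + d x * g i x) n * g n x)); auto.
    apply C2norm_le_mult; auto. apply C2norm_le_Cprod.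
  - apply (ex_series_scal_l (V := R_NormedModule) (exp (D * Series m)) m); auto.
Qed.

(** Telescoping: consecutive partial products differ by [d * P j * g j], so a partial product minus
    1 is [d] times a partial sum of the series defining [prodquot]. *)
Lemma Cprod_lim_prodquot x : U x ->
  filterlim (fun n => Cprod (fun k => 1 + d x * g k x) n) eventually
    (locally (1 + d x * prodquot (d x) (fun k => g k x))).
Proof.
  intros Hx. assert (H := is_series_prodquot x Hx). unfold is_series in H.
  set (P := fun n => Cprod (fun k => 1 + d x * g k x) n) in *.
  assert (E : forall n, P (S n) = 1 + d x * sum_n (G := C_AbelianGroup) (fun j => P j * g j x) n).
  { induction n. rewrite sum_O. unfold P; simpl. ring.
    rewrite sum_Sn. change (P (S (S n))) with (P (S n) * (1 + d x * g (S n) x)).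
    match goal with |- context [@plus ?G ?a ?b] => change (@plus G a b) with (Cplus a b) end.
    set (T := P (S n)) in *. clearbody T. set (G := sum_n (G := C_AbelianGroup) (fun j : nat => P j * g j x) n) in *.
    transitivity (T + d x * (T * g (S n) x)); [ring|]. rewrite IHn at 1. ring. }
  assert (H2 : filterlim (fun n => P (S n)) eventually (locally (1 + d x * prodquot (d x) (fun k => g k x)))).
  { eapply filterlim_ext. intros n; symmetry; apply E.
    apply (filterlim_C_plus eventually); [apply filterlim_const|].
    apply (filterlim_C_mult eventually); [apply filterlim_const|exact H]. }
  intros Q HQ. destruct (H2 Q HQ) as [N HN]. exists (S N). intros n Hn.
  destruct n; [lia|]. apply HN. lia.
Qed.

End Products.

(** The bound is quadratic in [W], so that an exponent of size [xi k] leaves a remainder of size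
    [xi k ^ 2] in [expands_exp]. The increment [D] of [w] enters through
    [Cexp (w x) * (Cexp D - 1 - D)] and [(Cexp (w x) - 1) * D], each of which keeps two factors [W].
    The constants 1, 3 and 2 of the three bounds are rounded up to 10. *)
Lemma C2norm_le_exp_taylor2 {V : NormedModule C_AbsRing} (U : V -> Prop) (w : V -> C) (W : R) :
  C2norm_le U w W -> C2norm_le U (fun x => Cexp (w x) - 1 - w x) (10 * (W * W) * exp (3 * W)).
Proof.
  intros Hw. assert (HW := C2norm_le_pos _ _ _ Hw).
  destruct Hw as (l & M0 & M1 & M2 & H0 & H1 & H2 & H3 & H4 & H5 & H6 & H7).
  assert (X1 : (1 <= exp W)%R) by (rewrite <- exp_0; apply exp_le; lra).
  assert (X3 : (exp (3 * W) = exp W * exp W * exp W)%R) by (rewrite <- !exp_plus; f_equal; ring).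
  assert (X2 : (exp (2 * W) = exp W * exp W)%R) by (rewrite <- !exp_plus; f_equal; ring).
  set (e := exp W) in *. rewrite X3.
  assert (e <= e * e)%R by nra. assert (e * e <= e * e * e)%R by nra.
  assert (Bw : forall x, U x -> (Cmod (w x) <= W)%R) by (intros x Hx; specialize (H4 x Hx); lra).
  assert (Be : forall x, U x -> (Cmod (Cexp (w x)) <= e)%R).
  { intros x Hx. eapply Rle_trans; [apply Cmod_Cexp_le|]. apply exp_le; auto. }
  assert (B1 : forall x, U x -> (Cmod (Cexp (w x) - 1) <= W * e)%R).
  { intros x Hx. eapply Rle_trans; [apply Cexp_sub_1_le|]. apply Rmult_le_compat; auto.
    apply Cmod_ge_0. left; apply exp_pos. apply exp_le; auto. }
  assert (BD : forall x y, U x -> U y -> (Cmod (w y - w x) <= 2 * W)%R).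
  { intros x y Hx Hy. unfold Cminus. eapply Rle_trans; [apply Cmod_triangle|]. rewrite Cmod_opp.
    generalize (Bw x Hx) (Bw y Hy). lra. }
  assert (BT : forall x y, U x -> U y -> (Cmod (Cexp (w y - w x) - 1 - (w y - w x)) <=
      Cmod (w y - w x) * Cmod (w y - w x) * (e * e))%R).
  { intros x y Hx Hy. eapply Rle_trans; [apply Cexp_taylor2_le|]. apply Rmult_le_compat_l.
    apply Rmult_le_pos; apply Cmod_ge_0. rewrite <- X2. apply exp_le. auto. }
  exists (fun x v => (Cexp (w x) - 1) * l x v), (W * W * e)%R, (3 * (W * W) * (e * e * e))%R, (2 * (W * W) * (e * e * e))%R.
  assert (PW : (0 <= W * W)%R) by nra.
  assert (W * W * e <= W * W * (e * e * e))%R by (apply Rmult_le_compat_l; lra).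
  assert (0 <= W * W * e)%R by nra.
  split; [lra|]. split; [nra|]. split; [nra|]. split; [nra|].
  split; [|split; [|split]].
  - intros x Hx. eapply Rle_trans; [apply Cexp_taylor2_le|].
    assert (exp (Cmod (w x)) <= e)%R by (apply exp_le; auto).
    generalize (Bw x Hx) (Cmod_ge_0 (w x)) (exp_pos (Cmod (w x))). intros.
    apply Rmult_le_compat; auto; try lra. nra. apply Rmult_le_compat; auto.
  - intros x Hx. destruct (H5 x Hx) as (A1 & A2 & A3). repeat split; intros.
    + rewrite A1. ring.
    + rewrite A2. ring.
    + rewrite Cmod_mult. generalize (A3 u) (norm_ge_0 u) (B1 x Hx) (Cmod_ge_0 (l x u)) (Cmod_ge_0 (Cexp (w x) - 1)). intros.
      assert (M1 * norm u <= W * norm u)%R by (apply Rmult_le_compat_r; lra).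
      assert (Cmod (Cexp (w x) - 1) * Cmod (l x u) <= (W * e) * (W * norm u))%R by (apply Rmult_le_compat; lra).
      assert (W * W * e * norm u <= 3 * (W * W) * (e * e * e) * norm u)%R by (apply Rmult_le_compat_r; lra).
      lra.
  - intros x y Hx Hy. set (v := minus y x). set (D := w y - w x).
    replace (Cexp (w y)) with (Cexp (w x) * Cexp D) by (rewrite <- Cexp_plus; f_equal; unfold D; ring).
    replace (Cexp (w x) * Cexp D - 1 - w y - (Cexp (w x) - 1 - w x)) with
      (Cexp (w x) * (Cexp D - 1 - D) + (Cexp (w x) - 1) * D) by (unfold D; ring).
    eapply Rle_trans; [apply Cmod_triangle|]. rewrite !Cmod_mult.
    generalize (BT x y Hx Hy) (BD x y Hx Hy) (H6 x y Hx Hy) (Be x Hx) (B1 x Hx). fold D v. intros T1 T2 T3 T4 T5.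
    generalize (Cmod_ge_0 D) (Cmod_ge_0 (Cexp (w x))) (Cmod_ge_0 (Cexp (w x) - 1)) (Cmod_ge_0 (Cexp D - 1 - D)) (norm_ge_0 v). intros.
    assert (T6 : (Cmod D <= W * norm v)%R) by nra.
    assert (Cmod D * Cmod D <= (2 * W) * (W * norm v))%R by (apply Rmult_le_compat; auto).
    assert (Cmod (Cexp D - 1 - D) <= (2 * W) * (W * norm v) * (e * e))%R.
    { eapply Rle_trans; [apply T1|]. apply Rmult_le_compat_r; nra. }
    assert (Cmod (Cexp (w x)) * Cmod (Cexp D - 1 - D) <= e * ((2 * W) * (W * norm v) * (e * e)))%R by (apply Rmult_le_compat; auto).
    assert (Cmod (Cexp (w x) - 1) * Cmod D <= (W * e) * (W * norm v))%R by (apply Rmult_le_compat; auto).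
    assert ((W * W * e) * norm v <= W * W * (e * e * e) * norm v)%R by (apply Rmult_le_compat_r; auto).
    lra.
  - intros x y Hx Hy. set (v := minus y x). set (D := w y - w x).
    replace (Cexp (w y)) with (Cexp (w x) * Cexp D) by (rewrite <- Cexp_plus; f_equal; unfold D; ring).
    replace (Cexp (w x) * Cexp D - 1 - w y - (Cexp (w x) - 1 - w x) - (Cexp (w x) - 1) * l x v) with
      (Cexp (w x) * (Cexp D - 1 - D) + (Cexp (w x) - 1) * (D - l x v)) by (unfold D; ring).
    eapply Rle_trans; [apply Cmod_triangle|]. rewrite !Cmod_mult.
    generalize (BT x y Hx Hy) (H7 x y Hx Hy) (H6 x y Hx Hy) (Be x Hx) (B1 x Hx). fold D v. intros T1 T2 T3 T4 T5.
    generalize (Cmod_ge_0 D) (Cmod_ge_0 (Cexp (w x))) (Cmod_ge_0 (Cexp (w x) - 1)) (Cmod_ge_0 (Cexp D - 1 - D)) (norm_ge_0 v) (Cmod_ge_0 (D - l x v)). intros.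
    assert (T6 : (Cmod D <= W * norm v)%R) by nra.
    assert (Cmod D * Cmod D <= (W * norm v) * (W * norm v))%R by (apply Rmult_le_compat; auto).
    assert (Cmod (Cexp D - 1 - D) <= (W * norm v) * (W * norm v) * (e * e))%R.
    { eapply Rle_trans; [apply T1|]. apply Rmult_le_compat_r; nra. }
    assert (Cmod (Cexp (w x)) * Cmod (Cexp D - 1 - D) <= e * ((W * norm v) * (W * norm v) * (e * e)))%R by (apply Rmult_le_compat; auto).
    assert (P2 : (0 <= norm v * norm v)%R) by nra.
    assert (M2 * (norm v * norm v) <= W * (norm v * norm v))%R by (apply Rmult_le_compat_r; lra).
    assert (Cmod (Cexp (w x) - 1) * Cmod (D - l x v) <= (W * e) * (W * (norm v * norm v)))%R by (apply Rmult_le_compat; lra).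
    assert ((W * W * e) * (norm v * norm v) <= W * W * (e * e * e) * (norm v * norm v))%R by (apply Rmult_le_compat_r; auto).
    lra.
Qed.

(** * Expansions in powers of 1 / (k + 1) *)

Definition xi (k : nat) : R := (/ INR (S k))%R.

Lemma xi_pos k : (0 < xi k)%R.
Proof. apply Rinv_0_lt_compat, lt_0_INR. lia. Qed.

Lemma xi_le_1 k : (xi k <= 1)%R.
Proof.
  unfold xi. rewrite <- Rinv_1. apply Rinv_le_contravar. lra.
  change 1%R with (INR 1). apply le_INR. lia.
Qed.

Lemma xi_pow_le k p q : (q <= p)%nat -> (xi k ^ p <= xi k ^ q)%R.
Proof.
  intros H. replace p with (q + (p - q))%nat by lia. rewrite pow_add.
  assert (xi k ^ (p - q) <= 1)%R.
  { rewrite <- (pow1 (p - q)). apply pow_incr. generalize (xi_pos k) (xi_le_1 k). lra. }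
  assert (0 <= xi k ^ q)%R by (apply pow_le; left; apply xi_pos). nra.
Qed.

Lemma xi_lim : is_lim_seq xi 0.
Proof.
  apply is_lim_seq_ext with (fun n => / (INR (S n)))%R. reflexivity.
  replace (Finite 0) with (Rbar_inv p_infty) by reflexivity.
  apply is_lim_seq_inv. apply -> is_lim_seq_incr_1. apply is_lim_seq_INR. easy.
Qed.

Lemma ex_series_telescope : ex_series (fun k => xi k - xi (S k))%R.
Proof.
  exists 1%R. 
  assert (E : forall n, sum_n (fun k => xi k - xi (S k))%R n = (1 - xi (S n))%R).
  { induction n. rewrite sum_O. unfold xi at 1. simpl. f_equal. apply Rinv_1.
    rewrite sum_Sn, IHn. unfold plus; simpl. ring. }
  cut (is_lim_seq (sum_n (fun k => xi k - xi (S k))%R) 1); [intros L; exact L|].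
  apply is_lim_seq_ext with (fun n => 1 - xi (S n))%R. intros; now rewrite E.
  replace (Finite 1) with (Finite (1 - 0)) by (f_equal; ring).
  apply is_lim_seq_minus'. apply is_lim_seq_const. apply -> is_lim_seq_incr_1. apply xi_lim.
Qed.

(** Comparison with the telescoping series: [xi n ^ 2] is at most [2 * (xi n - xi (S n))]. *)
Lemma ex_series_xi2 : ex_series (fun k => xi k ^ 2)%R.
Proof.
  apply (ex_series_le (V := R_CompleteNormedModule)) with (fun k => 2 * (xi k - xi (S k)))%R.
  - intros n. change (Rabs (xi n ^ 2) <= 2 * (xi n - xi (S n)))%R.
    rewrite Rabs_pos_eq by (apply pow_le; left; apply xi_pos).
    unfold xi. rewrite !S_INR. generalize (pos_INR n). intros P. set (y := INR n) in *. clearbody y.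
    apply Rmult_le_reg_l with ((y + 1) ^ 2 * (y + 1 + 1))%R. apply Rmult_lt_0_compat; nra.
    replace ((y + 1) ^ 2 * (y + 1 + 1) * (/ (y + 1)) ^ 2)%R with (y + 1 + 1)%R by (field; lra).
    replace ((y + 1) ^ 2 * (y + 1 + 1) * (2 * (/ (y + 1) - / (y + 1 + 1))))%R with (2 * (y + 1))%R by (field; lra).
    lra.
  - apply (ex_series_scal_l (V := R_NormedModule) 2%R). apply ex_series_telescope.
Qed.

Lemma ex_series_xi_pow M p : (2 <= p)%nat -> ex_series (fun k => M * xi k ^ p)%R.
Proof.
  intros Hp. apply (ex_series_scal_l (V := R_NormedModule) M (fun k => xi k ^ p)%R).
  apply (ex_series_le (V := R_CompleteNormedModule)) with (fun k => xi k ^ 2)%R; [|apply ex_series_xi2].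
  intros n. change (Rabs (xi n ^ p) <= xi n ^ 2)%R.
  rewrite Rabs_pos_eq by (apply pow_le; left; apply xi_pos). now apply xi_pow_le.
Qed.

(** Both sides come from [1 + y <= exp y], taken at [y = ln (1 + x)] and at [y = - ln (1 + x)]. *)
Lemma ln_1p_bound (x : R) : (0 <= x)%R -> (x - x * x <= ln (1 + x) <= x)%R.
Proof.
  intros Hx. split.
  - assert (H : (1 + ln (/ (1 + x)) <= / (1 + x))%R).
    { replace (/ (1 + x))%R with (exp (ln (/ (1 + x)))) at 2. apply exp_ineq1_le.
      apply exp_ln. apply Rinv_0_lt_compat; lra. }
    rewrite ln_Rinv in H by lra.
    assert (/ (1 + x) <= 1 - x + x * x)%R.
    { apply Rmult_le_reg_l with (1 + x)%R. lra. rewrite Rinv_r by lra. assert (0 <= x * x)%R by nra. nra. }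
    lra.
  - assert (H : (1 + ln (1 + x) <= 1 + x)%R).
    { replace (1 + x)%R with (exp (ln (1 + x))) at 2. apply exp_ineq1_le.
      apply exp_ln; lra. } lra.
Qed.

Section Orders.
Context {V : NormedModule C_AbsRing}.
Implicit Types (U : V -> Prop) (F G : nat -> V -> C) (al be : V -> C).

(** Order of magnitude in the norm [C2norm_le], uniform on [U]. Order 2 is the threshold at which
    the product of the [1 + F k] converges to a holomorphic function. *)
Definition C2O U F (p : nat) : Prop :=
  exists M, (0 <= M)%R /\ forall k, C2norm_le U (F k) (M * xi k ^ p).

Definition C2bdd U al : Prop := exists M, C2norm_le U al M.

Lemma C2O_ext U F G p : (forall k x, U x -> F k x = G k x) -> C2O U F p -> C2O U G p.
Proof.
  intros E (M & HM & H). exists M; split; auto. intros k.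
  apply C2norm_le_ext with (F k); auto.
Qed.

Lemma C2O_plus U F G p : C2O U F p -> C2O U G p -> C2O U (fun k x => F k x + G k x) p.
Proof.
  intros (M & HM & H) (N & HN & K). exists (M + N)%R; split; [lra|]. intros k.
  rewrite Rmult_plus_distr_r. apply C2norm_le_plus; auto.
Qed.



Lemma C2O_mult U F G p q : C2O U F p -> C2O U G q -> C2O U (fun k x => F k x * G k x) (p + q).
Proof.
  intros (M & HM & H) (N & HN & K). exists (M * N)%R; split; [nra|]. intros k.
  rewrite pow_add. replace (M * N * (xi k ^ p * xi k ^ q))%R with ((M * xi k ^ p) * (N * xi k ^ q))%R by ring.
  apply C2norm_le_mult; auto.
Qed.

Lemma C2O_weaken U F p q : (q <= p)%nat -> C2O U F p -> C2O U F q.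
Proof.
  intros Hpq (M & HM & H). exists M; split; auto. intros k. apply C2norm_le_mono with (2 := H k).
  apply Rmult_le_compat_l; auto. now apply xi_pow_le.
Qed.

Lemma C2O_const U al : C2bdd U al -> C2O U (fun _ => al) 0.
Proof.
  intros (M & H). exists M. split. apply (C2norm_le_pos U al); auto. intros k. simpl. now rewrite Rmult_1_r.
Qed.

Lemma C2bdd_const U c : C2bdd U (fun _ => c).
Proof. exists (Cmod c). apply C2norm_le_const. Qed.

Lemma C2bdd_plus U al be : C2bdd U al -> C2bdd U be -> C2bdd U (fun x => al x + be x).
Proof. intros (M & H) (N & K). exists (M + N)%R. now apply C2norm_le_plus. Qed.

Lemma C2bdd_mult U al be : C2bdd U al -> C2bdd U be -> C2bdd U (fun x => al x * be x).
Proof. intros (M & H) (N & K). exists (M * N)%R. now apply C2norm_le_mult. Qed.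

Lemma C2bdd_opp U al : C2bdd U al -> C2bdd U (fun x => - al x).
Proof. intros (M & H). exists M. now apply C2norm_le_opp. Qed.

Lemma C2bdd_minus U al be : C2bdd U al -> C2bdd U be -> C2bdd U (fun x => al x - be x).
Proof. intros. apply C2bdd_plus; auto. now apply C2bdd_opp. Qed.

Lemma C2O_xi U p : C2O U (fun k _ => RtoC (xi k) ^ p) p.
Proof.
  exists 1%R. split; [lra|]. intros k. rewrite Rmult_1_l.
  assert (P := xi_pos k).
  apply C2norm_le_mono with (Cmod (RtoC (xi k) ^ p)); [|apply C2norm_le_const].
  rewrite Cmod_pow, Cmod_R, Rabs_pos_eq; lra.
Qed.

Lemma C2O_inv U F eta : (0 < eta)%R -> (forall k x, U x -> (eta <= Cmod (F k x))%R) ->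
  C2O U F 0 -> C2O U (fun k x => / F k x) 0.
Proof.
  intros He Hb (M & HM & H). exists (invK M eta). split.
  - unfold invK. assert (0 < / eta)%R by (apply Rinv_0_lt_compat; auto).
    assert (0 <= M / eta ^ 2)%R.
    { apply Rmult_le_pos; auto. left. apply Rinv_0_lt_compat, pow_lt; auto. }
    assert (0 <= M ^ 2 / eta ^ 3)%R.
    { apply Rmult_le_pos. apply pow_le; auto. left. apply Rinv_0_lt_compat, pow_lt; auto. } lra.
  - intros k. simpl. rewrite Rmult_1_r. apply C2norm_le_inv; auto.
    specialize (H k). simpl in H. now rewrite Rmult_1_r in H.
Qed.

(** The coefficient [al] of [1 / (k + 1)] is additive under products ([expands_mult]), so
    convergence of an infinite product reduces to the vanishing of a sum of coefficients
    ([expands_0]). *)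
Definition expands U F al : Prop :=
  C2bdd U al /\ exists Rm, C2O U Rm 0 /\
    forall k x, U x -> F k x = 1 + al x * xi k + RtoC (xi k) ^ 2 * Rm k x.

Lemma expands_C2O U F al : expands U F al -> C2O U F 0.
Proof.
  intros (Ha & Rm & HR & E).
  apply C2O_ext with (fun k x => (1 + al x * RtoC (xi k) ^ 1) + RtoC (xi k) ^ 2 * Rm k x).
  { intros k x Hx. rewrite E; auto. simpl. ring. }
  apply C2O_plus. apply C2O_plus. apply C2O_const, C2bdd_const.
  apply C2O_weaken with (0 + 1)%nat. lia. apply C2O_mult. now apply C2O_const. apply C2O_xi.
  apply C2O_weaken with (2 + 0)%nat. lia. apply C2O_mult; auto. apply C2O_xi.
Qed.

Lemma expands_ext U F G al be :
  (forall k x, U x -> F k x = G k x) -> (forall x, U x -> al x = be x) -> expands U F al -> expands U G be.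
Proof.
  intros E1 E2 ((M & Ha) & Rm & HR & E). split.
  exists M. apply C2norm_le_ext with al; auto.
  exists Rm. split; auto. intros k x Hx. rewrite <- E1, <- E2; auto.
Qed.

Lemma expands_mult U F G al be :
  expands U F al -> expands U G be -> expands U (fun k x => F k x * G k x) (fun x => al x + be x).
Proof.
  intros HF HG. assert (OG := expands_C2O _ _ _ HG).
  destruct HF as (Ha & Rm & HR & E), HG as (Hb & Sm & HS & E2).
  split. now apply C2bdd_plus.
  exists (fun k x => Rm k x * G k x + (Sm k x + al x * (be x + RtoC (xi k) ^ 1 * Sm k x))). split.
  - apply C2O_plus. apply (C2O_mult U _ _ 0 0); auto.
    apply C2O_plus; auto. apply (C2O_mult U _ _ 0 0). now apply C2O_const.
    apply C2O_plus. now apply C2O_const. apply C2O_weaken with (1 + 0)%nat. lia. apply C2O_mult; auto. apply C2O_xi.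
  - intros k x Hx. rewrite E, E2; auto. simpl. ring.
Qed.

Lemma expands_linear U al : C2bdd U al -> expands U (fun k x => 1 + al x * xi k) al.
Proof.
  intros H. split; auto. exists (fun _ _ => 0). split. apply C2O_const, C2bdd_const.
  intros. ring.
Qed.

Lemma expands_linear_inv U al eta : C2bdd U al -> (0 < eta)%R ->
  (forall k x, U x -> (eta <= Cmod (1 + al x * xi k))%R) ->
  expands U (fun k x => / (1 + al x * xi k)) (fun x => - al x).
Proof.
  intros H He Hb. split. now apply C2bdd_opp.
  assert (H0 : C2O U (fun k x => / (1 + al x * xi k)) 0).
  { apply C2O_inv with eta; auto. apply (expands_C2O U _ al). now apply expands_linear. }
  exists (fun k x => al x * al x * / (1 + al x * xi k)). split.
  - apply (C2O_mult U _ _ 0 0); auto. apply C2O_const. now apply C2bdd_mult.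
  - intros k x Hx. simpl. field. intros E. specialize (Hb k x Hx). rewrite E, Cmod_0 in Hb. lra.
Qed.

(** This is [(1 + 1 / (k + 1)) ^ al]. Two errors of second order occur: [ln (1 + xi k) - xi k],
    multiplied by [al], and the quadratic Taylor remainder of the exponential. *)
Lemma expands_exp U al : C2bdd U al -> expands U (fun k x => Cexp (al x * ln (1 + xi k))) al.
Proof.
  intros Hal. split; auto. destruct Hal as (A & HA). assert (A0 := C2norm_le_pos _ _ _ HA).
  set (lam := fun k => ln (1 + xi k)).
  assert (L : forall k, (0 <= lam k <= xi k)%R /\ (Rabs (lam k - xi k) <= xi k ^ 2)%R).
  { intros k. assert (P := xi_pos k). assert (P1 := xi_le_1 k). destruct (ln_1p_bound (xi k)) as [B1 B2]; [lra|]. unfold lam.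
    split. split; auto. nra. rewrite Rabs_left1 by lra. simpl. lra. }
  exists (fun k x => (al x * RtoC (lam k - xi k) + (Cexp (al x * lam k) - 1 - al x * lam k)) * / RtoC (xi k) ^ 2).
  split.
  - set (M := (A + 10 * (A * A) * exp (3 * A))%R).
    assert (0 <= 10 * (A * A) * exp (3 * A))%R.
    { apply Rmult_le_pos. nra. left; apply exp_pos. }
    exists M. split. unfold M; lra.
    intros k. destruct (L k) as [[L1 L2] L3]. assert (P := xi_pos k). assert (P1 := xi_le_1 k).
    apply C2norm_le_mono with ((A * Cmod (RtoC (lam k - xi k)) + 10 * ((A * Cmod (lam k)) * (A * Cmod (lam k))) * exp (3 * (A * Cmod (lam k)))) * Cmod (/ RtoC (xi k) ^ 2))%R.
    + rewrite Cmod_inv. 2:{ apply Cpow_nz. apply RtoC_neq. lra. }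
      rewrite Cmod_pow, !Cmod_R. rewrite (Rabs_pos_eq (lam k)), (Rabs_pos_eq (xi k)) by lra.
      change (xi k ^ 0)%R with 1%R. rewrite Rmult_1_r.
      apply Rmult_le_reg_r with (xi k ^ 2)%R. apply pow_lt; auto.
      rewrite Rmult_assoc, Rinv_l, Rmult_1_r by (apply pow_nonzero; lra).
      unfold M. rewrite Rmult_plus_distr_r. apply Rplus_le_compat.
      apply Rmult_le_compat_l; auto.
      replace (10 * (A * A) * exp (3 * A) * xi k ^ 2)%R with (10 * (A * xi k * (A * xi k)) * exp (3 * A))%R by ring.
      apply Rmult_le_compat. apply Rmult_le_pos; [lra|]. apply Rmult_le_pos; apply Rmult_le_pos; lra.
      left; apply exp_pos.
      apply Rmult_le_compat_l. lra. assert (0 <= A * lam k)%R by nra. assert (A * lam k <= A * xi k)%R by nra. 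
      apply Rmult_le_compat; auto.
      apply exp_le. assert (A * lam k <= A * 1)%R by (apply Rmult_le_compat_l; lra). lra.
    + apply (C2norm_le_mult U (fun x => al x * RtoC (lam k - xi k) + (Cexp (al x * lam k) - 1 - al x * lam k)) (fun _ => / RtoC (xi k) ^ 2)); [|apply C2norm_le_const].
      apply C2norm_le_plus.
      apply C2norm_le_mult; auto; apply C2norm_le_const.
      apply C2norm_le_exp_taylor2. apply C2norm_le_mult; auto; apply C2norm_le_const.
  - intros k x Hx. rewrite RtoC_minus. fold (lam k). field. apply RtoC_neq. generalize (xi_pos k). lra.
Qed.

Lemma expands_0 U F al : (forall x, U x -> al x = 0) -> expands U F al -> C2O U (fun k x => F k x - 1) 2.
Proof.
  intros H0 (Ha & Rm & HR & E).
  apply C2O_ext with (fun k x => RtoC (xi k) ^ 2 * Rm k x).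
  { intros k x Hx. rewrite E, H0; auto. ring. }
  apply (C2O_mult U _ _ 2 0); auto. apply C2O_xi.
Qed.

(** Taking [d = 1] turns [prodquot] into the infinite product minus 1, so the parametrised estimates
    also serve for plain products. *)
Lemma C2O_prod_lim U F x : C2O U (fun k x => F k x - 1) 2 -> U x ->
  filterlim (Cprod (fun k => F k x)) eventually
    (locally (1 + 1 * prodquot 1 (fun k => F k x - 1))).
Proof.
  intros (M & HM & H) Hx.
  eapply filterlim_ext; [|apply (Cprod_lim_prodquot U (fun _ => 1) (Cmod 1) (fun k x => F k x - 1) _
     (C2norm_le_const U 1) H); [apply ex_series_xi_pow; lia|exact Hx]].
  intros n. apply Cprod_ext. intros. ring.
Qed.

Lemma C2O_prod_C2bdd U F : C2O U (fun k x => F k x - 1) 2 ->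
  C2bdd U (fun x => 1 + 1 * prodquot 1 (fun k => F k x - 1)).
Proof.
  intros (M & HM & H). apply C2bdd_plus. apply C2bdd_const. apply C2bdd_mult. apply C2bdd_const.
  eexists. apply (C2norm_le_prodquot U (fun _ => 1) (Cmod 1) (fun k x => F k x - 1) _
     (C2norm_le_const U 1) H). apply ex_series_xi_pow; lia.
Qed.

End Orders.

(** * The reciprocal Gamma function *)

Definition rGfac (z : C) (k : nat) : C := (1 + z * xi k) * Cexp (- z * ln (1 + xi k)).
(** Euler's product [z * prod_k (1 + z / (k + 1)) (1 + 1 / (k + 1)) ^ (- z)] for [1 / Gamma z]. The
    reciprocal is entire, so its holomorphy follows from the product estimates on any bounded family
    of arguments. *)
Definition rGamma (z : C) : C := z * (1 + 1 * prodquot 1 (fun k => rGfac z k - 1)).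

Lemma rGfac_C2O {V : NormedModule C_AbsRing} (U : V -> Prop) (z : V -> C) :
  C2bdd U z -> C2O U (fun k x => rGfac (z x) k - 1) 2.
Proof.
  intros Hz. apply expands_0 with (al := fun x => z x + - z x). intros; ring.
  unfold rGfac. apply expands_mult. now apply expands_linear.
  apply (expands_exp U (fun x => - z x)). now apply C2bdd_opp.
Qed.

Lemma rGamma_C2bdd {V : NormedModule C_AbsRing} (U : V -> Prop) (z : V -> C) :
  C2bdd U z -> C2bdd U (fun x => rGamma (z x)).
Proof.
  intros Hz. unfold rGamma. apply C2bdd_mult; auto.
  apply (C2O_prod_C2bdd U (fun k x => rGfac (z x) k)). now apply rGfac_C2O.
Qed.

Lemma Cmod_ge_Re (z : C) : (Re z <= Cmod z)%R.
Proof. eapply Rle_trans; [apply Rle_abs|apply re_le_Cmod]. Qed.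

Definition gauss (z : C) (n : nat) : C := INR (fact n) * Rpow_C (INR n) z / poch z (S n).

Lemma Re_pos_neq (z : C) (a : R) : (0 < Re z)%R -> (0 <= a)%R -> z + a <> 0.
Proof. intros Hz Ha E. apply (f_equal Re) in E. unfold Re, Cplus, RtoC in *; simpl in *. lra. Qed.

Lemma poch_prod (z : C) (n : nat) : poch z n = Cprod (fun k => z + INR k) n.
Proof. induction n; simpl poch; simpl Cprod; [reflexivity|]. now rewrite IHn. Qed.

Lemma poch_neq_0 (z : C) (n : nat) : (0 < Re z)%R -> poch z n <> 0.
Proof. intros H. rewrite poch_prod. apply Cprod_neq_0. intros k. apply Re_pos_neq; auto. apply pos_INR. Qed.

(** The powers [(1 + 1 / (k + 1)) ^ (- z)] telescope to [(n + 1) ^ (- z)], while Gauss's sequence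
    carries [n ^ z]; the mismatch is the factor [(1 + 1 / n) ^ (- z)], which tends to 1. *)
Lemma gauss_rGfac (z : C) (n : nat) : (0 < Re z)%R -> (1 <= n)%nat ->
  gauss z n = Cexp (- z * ln (1 + / INR n)) / (z * Cprod (rGfac z) n).
Proof.
  intros Hz Hn. unfold gauss, Rpow_C.
  assert (E1 : forall n, poch z (S n) = z * Cprod (fun k => 1 + z * xi k) n * INR (fact n)).
  { intros m. rewrite poch_prod. induction m. simpl. ring.
    change (Cprod (fun k => z + INR k) (S (S m))) with (Cprod (fun k => z + INR k) (S m) * (z + INR (S m))).
    rewrite IHm. rewrite fact_simpl, mult_INR, RtoC_mult. simpl Cprod. unfold xi.
    rewrite RtoC_inv. field. apply RtoC_neq. apply not_0_INR. lia. apply not_0_INR. lia. }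
  assert (E2 : forall n, Cprod (fun k => Cexp (- z * ln (1 + xi k))) n = Cexp (- z * ln (INR (S n)))).
  { induction n0. simpl. rewrite ln_1. rewrite <- Cexp_0. f_equal. ring.
    simpl Cprod. rewrite IHn0, <- Cexp_plus. f_equal. rewrite <- Cmult_plus_distr_l, <- RtoC_plus.
    f_equal. f_equal. assert (0 < INR (S n0))%R by (apply lt_0_INR; lia). assert (P := xi_pos n0).
    rewrite <- ln_mult by lra. f_equal. unfold xi. rewrite (S_INR (S n0)). field. lra. }
  assert (E3 : Cexp (- z * ln (1 + / INR n)) = Cexp (- z * ln (INR (S n))) * Cexp (z * ln (INR n))).
  { rewrite <- Cexp_plus. f_equal. assert (0 < INR n)%R by (apply lt_0_INR; lia).
    replace (INR (S n)) with ((1 + / INR n) * INR n)%R by (rewrite S_INR; field; lra).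
    assert (0 < / INR n)%R by (apply Rinv_0_lt_compat; auto).
    rewrite ln_mult by lra. rewrite RtoC_plus. ring. }
  rewrite E1, E3. unfold rGfac. rewrite Cprod_mult, E2.
  assert (N1 : Cprod (fun k => 1 + z * xi k) n <> 0).
  { apply Cprod_neq_0. intros k E. assert (P := xi_pos k). apply (f_equal Re) in E.
    unfold Re, Cplus, Cmult, RtoC in *; simpl in *. nra. }
  field. repeat split; auto. apply Cexp_neq_0.
  intros E. rewrite E in Hz. simpl in Hz. lra.
  apply RtoC_neq, INR_fact_neq_0.
Qed.

(** Convergent partial products may tend to 0. Here the reciprocal factors also have vanishing
    first-order coefficient, so their product converges too, and the two limits multiply to 1. *)
Lemma rGamma_neq_0 (z : C) : (0 < Re z)%R -> rGamma z <> 0.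
Proof.
  intros Hz.
  assert (z0 : z <> 0) by (intros E; rewrite E in Hz; simpl in Hz; lra).
  assert (L1 : filterlim (Cprod (rGfac z)) eventually (locally (1 + 1 * prodquot 1 (fun k => rGfac z k - 1)))).
  { apply (C2O_prod_lim (V := C_NormedModule) (fun _ => True) (fun k _ => rGfac z k) (RtoC 0)); auto.
    apply (rGfac_C2O _ (fun _ => z)). apply C2bdd_const. }
  assert (N : forall k, 1 + z * xi k <> 0).
  { intros k E. assert (P := xi_pos k). apply (f_equal Re) in E.
    unfold Re, Cplus, Cmult, RtoC in *; simpl in *. nra. }
  set (Gf := fun k => / (1 + z * xi k) * Cexp (z * ln (1 + xi k))).
  assert (L2 : filterlim (Cprod Gf) eventually (locally (1 + 1 * prodquot 1 (fun k => Gf k - 1)))).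
  { apply (C2O_prod_lim (V := C_NormedModule) (fun _ => True) (fun k _ => Gf k) (RtoC 0)); auto.
    apply expands_0 with (al := fun x => - z + z). intros; ring.
    unfold Gf. apply (expands_mult _ (fun k _ => / (1 + z * xi k))). 
    apply (expands_linear_inv _ (fun _ => z) 1). apply C2bdd_const. lra.
    intros k _ _. eapply Rle_trans; [|apply Cmod_ge_Re]. assert (P := xi_pos k).
    unfold Re, Cplus, Cmult, RtoC in *; simpl in *. nra.
    apply (expands_exp _ (fun _ => z)). apply C2bdd_const. }
  assert (L3 := filterlim_C_mult eventually _ _ _ _ L1 L2).
  set (A := 1 + 1 * prodquot 1 (fun k => rGfac z k - 1)) in *.
  set (B := 1 + 1 * prodquot 1 (fun k => Gf k - 1)) in *.
  assert (AB : A * B = 1).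
  { apply (filterlim_C_unique eventually (fun n => Cprod (rGfac z) n * Cprod Gf n)); auto.
    apply filterlim_ext with (fun _ => RtoC 1). 2:apply filterlim_const.
    intros n. rewrite <- Cprod_mult. symmetry. induction n; simpl. reflexivity. rewrite IHn.
    unfold rGfac, Gf. replace (- z * ln (1 + xi n)) with (- (z * ln (1 + xi n))) by ring. rewrite Cexp_opp.
    field. split; auto. apply Cexp_neq_0. }
  unfold rGamma. fold A. apply Cmult_neq_0; auto. intros E. rewrite E in AB.
  rewrite Cmult_0_l in AB. apply RtoC_inj in AB. lra.
Qed.

Lemma Cexp_lim_1 (w : nat -> C) :
  filterlim w eventually (locally (RtoC 0)) -> filterlim (fun n => Cexp (w n)) eventually (locally (RtoC 1)).
Proof.
  rewrite !(filterlim_C_iff eventually). intros H eps He.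
  set (d := Rmin 1 (eps / exp 1)).
  assert (Hd : (0 < d)%R).
  { apply Rmin_pos. lra. apply Rdiv_lt_0_compat; auto. apply exp_pos. }
  generalize (H d Hd). apply filter_imp. intros n Hn.
  replace (w n - 0) with (w n) in Hn by ring.
  assert (d <= 1)%R by apply Rmin_l. assert (d <= eps / exp 1)%R by apply Rmin_r.
  eapply Rle_lt_trans. apply Cexp_sub_1_le.
  apply Rle_lt_trans with (Cmod (w n) * exp 1)%R.
  apply Rmult_le_compat_l. apply Cmod_ge_0. apply exp_le. lra.
  apply Rlt_le_trans with (d * exp 1)%R. apply Rmult_lt_compat_r; auto. apply exp_pos.
  replace eps with (eps / exp 1 * exp 1)%R. apply Rmult_le_compat_r; auto. left; apply exp_pos.
  field. generalize (exp_pos 1). lra.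
Qed.

Lemma filterlim_RtoC (u : nat -> R) (l : R) :
  is_lim_seq u l -> filterlim (fun n => RtoC (u n)) eventually (locally (RtoC l)).
Proof.
  intros H. apply (filterlim_C_iff eventually). intros eps He.
  apply is_lim_seq_spec in H. destruct (H (mkposreal eps He)) as [N HN]. exists N. intros n Hn.
  rewrite <- RtoC_minus, Cmod_R. apply HN; auto.
Qed.

Lemma gauss_lim (z : C) : (0 < Re z)%R ->
  filterlim (gauss z) eventually (locally (/ rGamma z)).
Proof.
  intros Hz.
  assert (z0 : z <> 0) by (intros E; rewrite E in Hz; simpl in Hz; lra).
  apply filterlim_ext_loc with (fun n => Cexp (- z * ln (1 + / INR n)) * / (z * Cprod (rGfac z) n)).
  { exists 1%nat. intros n Hn. rewrite gauss_rGfac; auto. }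
  replace (/ rGamma z) with (1 * / rGamma z) by ring.
  apply (filterlim_C_mult eventually).
  - apply Cexp_lim_1. replace (RtoC 0) with (- z * RtoC 0) by ring.
    apply (filterlim_C_mult eventually). apply filterlim_const. apply filterlim_RtoC.
    apply is_lim_seq_le_le_loc with (fun _ => 0)%R (fun n => / INR n)%R.
    + exists 1%nat. intros n Hn. assert (0 < / INR n)%R by (apply Rinv_0_lt_compat, lt_0_INR; lia).
      destruct (ln_1p_bound (/ INR n)) as [_ B]; [lra|]. split; auto.
      rewrite <- ln_1. left. apply ln_increasing; lra.
    + apply is_lim_seq_const.
    + replace (Finite 0) with (Rbar_inv p_infty) by reflexivity.
      apply is_lim_seq_inv. apply is_lim_seq_INR. easy.
  - apply (filterlim_C_inv eventually). now apply rGamma_neq_0.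
    apply (filterlim_C_mult eventually). apply filterlim_const.
    apply (C2O_prod_lim (V := C_NormedModule) (fun _ => True) (fun k _ => rGfac z k) (RtoC 0)); auto.
    apply (rGfac_C2O _ (fun _ => z)). apply C2bdd_const.
Qed.

Lemma Gamma_rGamma (z : C) : (0 < Re z)%R -> Gamma z = / rGamma z.
Proof.
  intros Hz. apply Cthe_unique. 2:now apply gauss_lim.
  intros y Hy. apply (filterlim_C_unique eventually (gauss z)); auto. now apply gauss_lim.
Qed.

Lemma Gamma_neq_0 (z : C) : (0 < Re z)%R -> Gamma z <> 0.
Proof. intros Hz. rewrite Gamma_rGamma; auto. 
  assert (H := rGamma_neq_0 z Hz). intros E. apply H. rewrite <- (Cmult_1_r (rGamma z)), <- (Cinv_r (rGamma z)) by auto.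
  rewrite E. ring.
Qed.

Lemma Gamma_lim (z : C) : (0 < Re z)%R -> filterlim (gauss z) eventually (locally (Gamma z)).
Proof. intros Hz. rewrite Gamma_rGamma; auto. now apply gauss_lim. Qed.

(** The Gauss sequences at [z + 1] and at [z] have quotient [z / (1 + (z + 1) / n)]. *)
Lemma Gamma_succ (z : C) : (0 < Re z)%R -> Gamma (z + 1) = z * Gamma z.
Proof.
  intros Hz.
  assert (Hz1 : (0 < Re (z + 1))%R) by (unfold Re, Cplus, RtoC in *; simpl in *; lra).
  apply (filterlim_C_unique eventually (gauss (z + 1))). now apply Gamma_lim.
  assert (E0 : forall n, poch z (S n) = z * poch (z + 1) n).
  { induction n. simpl. ring. change (poch z (S (S n))) with (poch z (S n) * (z + INR (S n))).
    rewrite IHn. simpl poch. rewrite S_INR, RtoC_plus. ring. }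
  apply filterlim_ext_loc with (fun n => z * gauss z n * / (1 + (z + 1) * / INR n)).
  { exists 1%nat. intros n Hn. unfold gauss, Rpow_C.
    assert (0 < INR n)%R by (apply lt_0_INR; lia).
    replace (Cexp ((z + 1) * ln (INR n))) with (Cexp (z * ln (INR n)) * INR n).
    2:{ rewrite Cmult_plus_distr_r, Cexp_plus. f_equal. rewrite Cmult_1_l. unfold Cexp, RtoC; simpl.
        rewrite exp_ln, cos_0, sin_0 by auto. f_equal; ring. }
    rewrite E0. change (poch (z + 1) (S n)) with (poch (z + 1) n * (z + 1 + INR n)).
    assert (P1 := poch_neq_0 (z + 1) n Hz1).
    assert (P2 : z + 1 + INR n <> 0) by (apply Re_pos_neq; auto; lra).
    assert (N : RtoC (INR n) <> 0) by (apply RtoC_neq; lra).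
    assert (z0 : z <> 0) by (intros E; rewrite E in Hz; simpl in Hz; lra).
    field; repeat split; auto. }
  replace (z * Gamma z) with (z * Gamma z * / (1 + (z + 1) * 0)) by (field).
  apply (filterlim_C_mult eventually). apply (filterlim_C_mult eventually). apply filterlim_const. now apply Gamma_lim.
  apply (filterlim_C_inv eventually). rewrite Cmult_0_r, Cplus_0_r. apply RtoC_neq; lra.
  apply (filterlim_C_plus eventually). apply filterlim_const.
  apply (filterlim_C_mult eventually). apply filterlim_const.
  apply filterlim_ext_loc with (fun n => RtoC (/ INR n)).
  { exists 1%nat. intros n Hn. apply RtoC_inv. apply not_0_INR. lia. }
  apply filterlim_RtoC. replace (Finite 0) with (Rbar_inv p_infty) by reflexivity.
  apply is_lim_seq_inv. apply is_lim_seq_INR. easy.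
Qed.

Lemma Gamma_1 : Gamma 1 = 1.
Proof.
  assert (H1 : (0 < Re 1)%R) by (simpl; lra).
  apply (filterlim_C_unique eventually (gauss 1)). now apply Gamma_lim.
  assert (E : forall n, poch 1 n = INR (fact n)).
  { induction n. reflexivity. simpl poch. rewrite IHn, fact_simpl, mult_INR, S_INR, RtoC_mult, RtoC_plus. ring. }
  apply filterlim_ext_loc with (fun n => RtoC (1 - xi n)).
  { exists 1%nat. intros n Hn. unfold gauss. rewrite E. unfold Rpow_C.
    replace (Cexp (1 * ln (INR n))) with (RtoC (INR n)).
    2:{ rewrite Cmult_1_l. unfold Cexp, RtoC; simpl.
        rewrite exp_ln, cos_0, sin_0. f_equal; ring. apply lt_0_INR; lia. }
    rewrite fact_simpl, mult_INR, RtoC_mult. unfold xi. rewrite RtoC_minus, RtoC_inv by (apply not_0_INR; lia).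
    rewrite S_INR, RtoC_plus. field. split. apply RtoC_neq, INR_fact_neq_0.
    rewrite <- RtoC_plus. apply RtoC_neq. generalize (pos_INR n). lra. }
  apply filterlim_RtoC. replace (Finite 1) with (Finite (1 - 0)) by (f_equal; ring).
  apply is_lim_seq_minus'. apply is_lim_seq_const. apply xi_lim.
Qed.

(** * Wallis integrals and the value of Gamma at one half *)

Section Wallis.
Local Open Scope R_scope.

Definition wallis (m : nat) : R := RInt (fun t => sin t ^ m) 0 (PI / 2).

Lemma continuous_sin_pow m t : continuous (fun t => sin t ^ m) t.
Proof. apply (ex_derive_continuous (V := R_NormedModule)). auto_derive. auto. Qed.

Lemma is_RInt_wallis m : is_RInt (fun t => sin t ^ m) 0 (PI / 2) (wallis m).
Proof. apply (RInt_correct (V := R_CompleteNormedModule)), (ex_RInt_continuous (V := R_CompleteNormedModule)). intros; apply continuous_sin_pow. Qed.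

Lemma wallis_0 : wallis 0 = PI / 2.
Proof.
  unfold wallis. simpl. rewrite (RInt_const (V := R_CompleteNormedModule)). unfold scal; simpl. unfold mult; simpl. ring.
Qed.

Lemma wallis_1 : wallis 1 = 1.
Proof.
  apply (is_RInt_unique (V := R_CompleteNormedModule)).
  replace 1 with (minus (- cos (PI / 2)) (- cos 0)) by (rewrite cos_PI2, cos_0; unfold minus, plus, opp; simpl; ring).
  apply (is_RInt_derive (V := R_CompleteNormedModule) (fun t => - cos t)).
  intros. auto_derive; auto. simpl. ring. intros; apply continuous_sin_pow.
Qed.

(** [(m + 2) sin^(m + 2) - (m + 1) sin^m] is the derivative of [- cos t * sin t ^ (m + 1)], which
    vanishes at both ends. *)
Lemma wallis_rec m : INR (m + 2) * wallis (m + 2) = INR (m + 1) * wallis m.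
Proof.
  assert (H : is_RInt (fun t => INR (m + 2) * sin t ^ (m + 2) - INR (m + 1) * sin t ^ m) 0 (PI / 2) 0).
  { replace 0 with (minus (- cos (PI / 2) * sin (PI / 2) ^ (m + 1)) (- cos 0 * sin 0 ^ (m + 1))) at 2.
    2:{ rewrite cos_PI2, sin_0, (Nat.add_comm m 1). unfold minus, plus, opp; simpl. ring. }
    apply (is_RInt_derive (V := R_CompleteNormedModule) (fun t => - cos t * sin t ^ (m + 1))).
    - intros t _. auto_derive; auto.
      replace (m + 2)%nat with (S (S m)) by lia. replace (m + 1)%nat with (S m) by lia. rewrite (S_INR (S m)). simpl pred. rewrite <- !tech_pow_Rmult.
      assert (E : cos t * cos t = 1 - sin t * sin t) by (generalize (sin2_cos2 t); unfold Rsqr; lra).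
      set (I := INR (S m)).
      transitivity (sin t * (sin t * sin t ^ m) - I * (cos t * cos t) * sin t ^ m); [ring|].
      rewrite E. ring.
    - intros t _. apply (ex_derive_continuous (V := R_NormedModule)). auto_derive. auto. }
  assert (H2 := is_RInt_minus (V := R_NormedModule) _ _ _ _ _ _ (is_RInt_scal (V := R_NormedModule) _ _ _ (INR (m + 2)) _ (is_RInt_wallis (m + 2)))
     (is_RInt_scal (V := R_NormedModule) _ _ _ (INR (m + 1)) _ (is_RInt_wallis m))).
  assert (E := eq_trans (eq_sym (is_RInt_unique (V := R_CompleteNormedModule) _ _ _ _ H)) (is_RInt_unique (V := R_CompleteNormedModule) _ _ _ _ H2)).
  unfold minus, plus, opp, scal in E; simpl in E. unfold mult in E; simpl in E. lra.
Qed.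

Lemma wallis_decr m : wallis (S m) <= wallis m.
Proof.
  assert (P : 0 <= PI / 2) by (generalize PI_RGT_0; lra).
  apply (is_RInt_le (fun t => sin t ^ (S m)) (fun t => sin t ^ m) 0 (PI / 2)); auto; try apply is_RInt_wallis.
  intros x Hx. assert (0 <= sin x <= 1) by (split; [apply sin_ge_0; lra|apply SIN_bound]).
  simpl. assert (0 <= sin x ^ m) by (apply pow_le; lra). nra.
Qed.

Lemma wallis_pos m : 0 < wallis m.
Proof.
  assert (H : 0 < wallis m /\ 0 < wallis (S m)).
  { induction m. rewrite wallis_0, wallis_1. generalize PI_RGT_0; lra.
    destruct IHm as [A B]. split; auto. assert (E := wallis_rec m). replace (m + 2)%nat with (S (S m)) in E by lia.
    assert (0 < INR (S (S m))) by (apply lt_0_INR; lia). assert (0 < INR (m + 1)) by (apply lt_0_INR; lia).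
    apply Rmult_lt_reg_l with (INR (S (S m))); auto. rewrite E, Rmult_0_r. now apply Rmult_lt_0_compat. }
  apply H.
Qed.

Lemma wallis_prod m : wallis m * wallis (S m) * INR (S m) = PI / 2.
Proof.
  induction m. rewrite wallis_0, wallis_1. simpl. ring.
  rewrite <- IHm. assert (E := wallis_rec m).
  replace (m + 2)%nat with (S (S m)) in E by lia. replace (m + 1)%nat with (S m) in E by lia.
  replace (wallis (S m) * wallis (S (S m)) * INR (S (S m))) with (wallis (S m) * (INR (S (S m)) * wallis (S (S m)))) by ring.
  rewrite E. ring.
Qed.

End Wallis.

Lemma Cmult_reg_l (a b c : C) : a <> 0 -> a * b = a * c -> b = c.
Proof. intros Ha E. rewrite <- (Cmult_1_l b), <- (Cmult_1_l c), <- (Cinv_l a Ha), <- !Cmult_assoc, E. reflexivity. Qed.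

(** Turns the Gauss sequence at [1 / 2] into [2 * sqrt n * wallis (2 * n + 1)]. *)
Lemma poch_half_wallis (n : nat) :
  INR (fact n) / poch (1 / 2) (S n) = 2 * wallis (2 * n + 1).
Proof.
  assert (H2 : (0 < Re (1 / 2))%R).
  { replace (1 / 2) with (RtoC (1 / 2)) by (rewrite RtoC_div by lra; reflexivity). simpl. lra. }
  induction n.
  - change (2 * 0 + 1)%nat with 1%nat. rewrite wallis_1. simpl. field.
  - change (poch (1 / 2) (S (S n))) with (poch (1 / 2) (S n) * (1 / 2 + INR (S n))).
    assert (P1 := poch_neq_0 (1 / 2) (S n) H2).
    assert (P2 : 1 / 2 + INR (S n) <> 0) by (apply Re_pos_neq; auto; apply pos_INR).
    assert (P4 : 1 + INR (S n) * 2 <> 0).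
    { rewrite <- RtoC_mult, <- RtoC_plus. apply RtoC_neq. generalize (pos_INR (S n)). lra. }
    assert (P3 : RtoC (INR (2 * n + 1 + 2)) <> 0) by (apply RtoC_neq, not_0_INR; lia).
    assert (E := f_equal RtoC (wallis_rec (2 * n + 1))). rewrite !RtoC_mult in E.
    replace (2 * S n + 1)%nat with (2 * n + 1 + 2)%nat by lia.
    rewrite fact_simpl, mult_INR, RtoC_mult.
    transitivity (INR (fact n) / poch (1 / 2) (S n) * (INR (S n) / (1 / 2 + INR (S n)))).
    { field. split; auto. }
    rewrite IHn.
    assert (E2 : RtoC (INR (2 * n + 1 + 1)) = 2 * INR (S n)).
    { replace (2 * n + 1 + 1)%nat with (2 * (S n))%nat by lia. rewrite mult_INR, RtoC_mult. reflexivity. }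
    assert (E3 : RtoC (INR (2 * n + 1 + 2)) = 2 * (1 / 2 + INR (S n))).
    { replace (2 * n + 1 + 2)%nat with (2 * (S n) + 1)%nat by lia. rewrite plus_INR, mult_INR, RtoC_plus, RtoC_mult.
      simpl (INR 1). simpl (INR 2). replace (RtoC (1 + 1)) with (RtoC 2) by reflexivity. field. }
    rewrite E2, E3 in E.
    apply (Cmult_reg_l (2 * (1 / 2 + INR (S n)))). 
    { apply Cmult_neq_0; auto. apply RtoC_neq; lra. }
    replace (2 * (1 / 2 + INR (S n)) * (2 * wallis (2 * n + 1 + 2))) with
      (2 * (2 * (1 / 2 + INR (S n)) * wallis (2 * n + 1 + 2))) by ring.
    rewrite E. field. auto.
Qed.

(** The squared Gauss sequence is [4 n w^2] with [w = wallis (2 * n + 1)]. Monotonicity puts [w^2]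
    between the products of [w] with its two neighbours, which [wallis_prod] evaluates; this gives
    the bounds [PI * n / (n + 1)] and [PI]. *)
Lemma Gamma_half_sqr : Gamma (1 / 2) * Gamma (1 / 2) = PI.
Proof.
  assert (H2 : (0 < Re (1 / 2))%R).
  { replace (1 / 2) with (RtoC (1 / 2)) by (rewrite RtoC_div by lra; reflexivity). simpl. lra. }
  apply (filterlim_C_unique eventually (fun n => gauss (1 / 2) n * gauss (1 / 2) n)).
  apply (filterlim_C_mult eventually); now apply Gamma_lim.
  apply filterlim_ext_loc with (fun n => RtoC (4 * INR n * wallis (2 * n + 1) * wallis (2 * n + 1))).
  { exists 1%nat. intros n Hn. unfold gauss, Rpow_C.
    assert (0 < INR n)%R by (apply lt_0_INR; lia).
    replace (INR (fact n) * Cexp (1 / 2 * ln (INR n)) / poch (1 / 2) (S n)) with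
     (INR (fact n) / poch (1 / 2) (S n) * Cexp (1 / 2 * ln (INR n))) by (unfold Cdiv; ring).
    rewrite poch_half_wallis.
    set (w := wallis (2 * n + 1)). set (E := Cexp (1 / 2 * ln (INR n))).
    replace (2 * w * E * (2 * w * E)) with (4 * (E * E) * w * w) by ring.
    unfold E. rewrite <- Cexp_plus.
    replace (1 / 2 * ln (INR n) + 1 / 2 * ln (INR n)) with (RtoC (ln (INR n))) by field.
    replace (Cexp (ln (INR n))) with (RtoC (INR n)).
    rewrite !RtoC_mult. reflexivity.
    unfold Cexp, RtoC; simpl. rewrite exp_ln, cos_0, sin_0 by auto. f_equal; ring. }
  apply filterlim_RtoC.
  apply is_lim_seq_le_le_loc with (fun n => PI * (1 - xi n))%R (fun n => PI)%R.
  - exists 1%nat. intros n Hn.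
    assert (E1 := wallis_prod (2 * n)). assert (E2 := wallis_prod (2 * n + 1)).
    assert (D1 := wallis_decr (2 * n)). assert (D2 := wallis_decr (2 * n + 1)).
    replace (S (2 * n)) with (2 * n + 1)%nat in * by lia. replace (S (2 * n + 1)) with (2 * n + 2)%nat in * by lia.
    rewrite (plus_INR (2 * n)), mult_INR in E1, E2. simpl (INR 2) in E1, E2. simpl (INR 1) in E1.
    assert (P := wallis_pos (2 * n + 1)). 
    assert (0 < INR n)%R by (apply lt_0_INR; lia).
    set (w := wallis (2 * n + 1)) in *. set (w0 := wallis (2 * n)) in *. set (w2 := wallis (2 * n + 2)) in *.
    set (y := INR n) in *.
    assert (L : (w * w2 <= w * w)%R) by nra. assert (L2 : (w * w <= w0 * w)%R) by nra.
    unfold xi. rewrite S_INR. fold y. split.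
    + apply Rle_trans with (4 * y * (w * w2))%R. 2:nra.
      right. apply Rmult_eq_reg_r with (2 * y + 2)%R. 2:lra.
      replace (4 * y * (w * w2) * (2 * y + 2))%R with (4 * y * (w * w2 * ((1 + 1) * y + (1 + 1))))%R by ring.
      rewrite E2. field. lra.
    + nra.
  - replace (Finite PI) with (Finite (PI * (1 - 0))) by (f_equal; ring).
    apply (is_lim_seq_scal_l (fun n => 1 - xi n)%R PI (1 - 0)%R).
    apply is_lim_seq_minus'. apply is_lim_seq_const. apply xi_lim.
  - apply is_lim_seq_const.
Qed.

(** * Holomorphic continuation of the Mishev function *)

Section Cdiff.
Context {V : NormedModule C_AbsRing}.
Implicit Types (f g : V -> C) (x : V).

(** A pointwise notion, weaker than [C2norm_le] but enough for [ex_filterdiff]. It allows the factor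
    [d / sin (pi e)] to be handled separately at its removable singularity. *)
Definition Cdiff f x : Prop := exists l K, (0 <= K)%R /\ clinear l K /\
  forall eps, (0 < eps)%R -> exists r, (0 < r)%R /\ forall y : V, (norm (minus y x) < r)%R ->
    (Cmod (f y - f x - l (minus y x)) <= eps * norm (minus y x))%R.

Definition nbhd (U : V -> Prop) x : Prop :=
  exists r, (0 < r)%R /\ forall y : V, (norm (minus y x) < r)%R -> U y.

Lemma Cdiff_C2bdd (U : V -> Prop) f x : C2bdd U f -> U x -> nbhd U x -> Cdiff f x.
Proof.
  intros (M & l & M0 & M1 & M2 & H0 & H1 & H2 & H3 & H4 & H5 & H6 & H7) Hx (r & Hr & HU).
  exists (l x), M1. split; auto. split; auto. intros eps He.
  exists (Rmin r (eps / (M2 + 1))). split.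
  apply Rmin_pos; auto. apply Rdiv_lt_0_compat; lra.
  intros y Hy. assert (Hy1 := Rlt_le_trans _ _ _ Hy (Rmin_l _ _)). assert (Hy2 := Rlt_le_trans _ _ _ Hy (Rmin_r _ _)).
  eapply Rle_trans; [apply H7; auto|].
  rewrite <- Rmult_assoc. apply Rmult_le_compat_r. apply norm_ge_0.
  apply Rle_trans with (M2 * (eps / (M2 + 1)))%R. apply Rmult_le_compat_l; lra.
  apply Rmult_le_reg_r with (M2 + 1)%R. lra.
  replace (M2 * (eps / (M2 + 1)) * (M2 + 1))%R with (M2 * eps)%R by (field; lra). nra.
Qed.

Lemma Cdiff_lip f x : Cdiff f x -> exists L r, (0 < L)%R /\ (0 < r)%R /\
  forall y : V, (norm (minus y x) < r)%R -> (Cmod (f y - f x) <= L * norm (minus y x))%R.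
Proof.
  intros (l & K & HK & Hl & H). destruct (H 1%R Rlt_0_1) as (r & Hr & B).
  exists (K + 1)%R, r. split. lra. split; auto. intros y Hy.
  replace (f y - f x) with ((f y - f x - l (minus y x)) + l (minus y x)) by ring.
  eapply Rle_trans; [apply Cmod_triangle|]. rewrite Rmult_plus_distr_r.
  specialize (B y Hy). destruct Hl as (_ & _ & Hl). specialize (Hl (minus y x)). lra.
Qed.

Lemma Cdiff_mult f g x : Cdiff f x -> Cdiff g x -> Cdiff (fun y => f y * g y) x.
Proof.
  intros Df Dg. destruct (Cdiff_lip f x Df) as (L & r0 & HL & Hr0 & BL).
  destruct (Cdiff_lip g x Dg) as (L' & r0' & HL' & Hr0' & BL').
  destruct Df as (l & K & HK & (A1 & A2 & A3) & H), Dg as (k & K' & HK' & (B1 & B2 & B3) & H').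
  assert (PF := Cmod_ge_0 (f x)). assert (PG := Cmod_ge_0 (g x)).
  exists (fun v => l v * g x + f x * k v), (K * Cmod (g x) + Cmod (f x) * K')%R.
  split. nra. split; [split; [|split]|].
  - intros u v. rewrite A1, B1. ring.
  - intros c u. rewrite A2, B2. ring.
  - intros u. eapply Rle_trans; [apply Cmod_triangle|]. rewrite !Cmod_mult.
    generalize (A3 u) (B3 u). intros. nra.
  - intros eps He.
    set (F := (Cmod (f x) + Cmod (g x) + 1)%R).
    assert (HF : (0 < F)%R) by (unfold F; lra).
    assert (He1 : (0 < eps / (2 * F))%R) by (apply Rdiv_lt_0_compat; lra).
    destruct (H _ He1) as (r1 & Hr1 & C1). destruct (H' _ He1) as (r2 & Hr2 & C2).
    (* Keeps the product of the two increments, at most [L * L' * n * n], below [eps / 2 * n]. *)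
    set (r3 := (eps / (2 * L * L'))%R).
    assert (HLL : (0 < L * L')%R) by (apply Rmult_lt_0_compat; auto).
    assert (Hr3 : (0 < r3)%R) by (apply Rdiv_lt_0_compat; nra).
    exists (Rmin (Rmin r0 r0') (Rmin r1 (Rmin r2 r3))). split. repeat apply Rmin_pos; auto.
    intros y Hy. set (v := minus y x) in *. set (n := norm v) in *.
    assert (Hy1 := Rlt_le_trans _ _ _ Hy (Rmin_l _ _)). assert (Hy2 := Rlt_le_trans _ _ _ Hy (Rmin_r _ _)).
    assert (Hy3 := Rlt_le_trans _ _ _ Hy1 (Rmin_l _ _)). assert (Hy4 := Rlt_le_trans _ _ _ Hy1 (Rmin_r _ _)).
    assert (Hy5 := Rlt_le_trans _ _ _ Hy2 (Rmin_l _ _)). assert (Hy6 := Rlt_le_trans _ _ _ Hy2 (Rmin_r _ _)).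
    assert (Hy7 := Rlt_le_trans _ _ _ Hy6 (Rmin_l _ _)). assert (Hy8 := Rlt_le_trans _ _ _ Hy6 (Rmin_r _ _)).
    assert (Hn : (0 <= n)%R) by apply norm_ge_0.
    replace (f y * g y - f x * g x - (l v * g x + f x * k v)) with
      (f x * (g y - g x - k v) + (f y - f x - l v) * g x + (f y - f x) * (g y - g x)) by ring.
    eapply Rle_trans; [apply Cmod_triangle|].
    eapply Rle_trans; [apply Rplus_le_compat_r; apply Cmod_triangle|]. rewrite !Cmod_mult.
    assert (T1 : (Cmod (f x) * Cmod (g y - g x - k v) <= Cmod (f x) * (eps / (2 * F) * n))%R)
      by (apply Rmult_le_compat_l; auto; apply C2; auto).
    assert (T2 : (Cmod (f y - f x - l v) * Cmod (g x) <= (eps / (2 * F) * n) * Cmod (g x))%R)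
      by (apply Rmult_le_compat_r; auto; apply C1; auto).
    assert (T3 : (Cmod (f y - f x) * Cmod (g y - g x) <= (L * n) * (L' * n))%R)
      by (apply Rmult_le_compat; try apply Cmod_ge_0; [apply BL|apply BL']; auto).
    assert (T4 : ((L * n) * (L' * n) <= eps / 2 * n)%R).
    { replace (L * n * (L' * n))%R with (L * L' * n * n)%R by ring. apply Rmult_le_compat_r; auto.
      apply Rle_trans with (L * L' * r3)%R. apply Rmult_le_compat_l; lra.
      unfold r3. right. field. split; nra. }
    assert (T5 : ((Cmod (f x) + Cmod (g x)) * (eps / (2 * F) * n) <= eps / 2 * n)%R).
    { apply Rle_trans with (F * (eps / (2 * F) * n))%R. apply Rmult_le_compat_r. apply Rmult_le_pos; lra. unfold F; lra.
      right. field. lra. }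
    lra.
Qed.

Lemma Cdiff_inv f x : f x <> 0 -> Cdiff f x -> Cdiff (fun y => / f y) x.
Proof.
  intros Hfx Df. destruct (Cdiff_lip f x Df) as (L & r0 & HL & Hr0 & BL).
  destruct Df as (l & K & HK & (A1 & A2 & A3) & H).
  assert (PA := proj1 (Cmod_gt_0 _) Hfx). set (A := Cmod (f x)) in *.
  assert (PI : (0 < / A)%R) by (apply Rinv_0_lt_compat; auto).
  assert (Ei : Cmod (/ f x) = (/ A)%R) by (apply Cmod_inv; auto).
  exists (fun v => - (/ f x * / f x * l v)), (/ A * / A * K)%R.
  split. apply Rmult_le_pos; auto. nra. split; [split; [|split]|].
  - intros u v. rewrite A1. ring.
  - intros c u. rewrite A2. ring.
  - intros u. rewrite Cmod_opp, !Cmod_mult, Ei, (Rmult_assoc (/ A * / A)). apply Rmult_le_compat_l. nra. apply A3.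
  - intros eps He.
    set (e1 := (eps * (A * A) / 2)%R). assert (He1 : (0 < e1)%R) by (unfold e1; apply Rdiv_lt_0_compat; [apply Rmult_lt_0_compat; nra|lra]).
    destruct (H _ He1) as (r1 & Hr1 & C1).
    set (r3 := (eps * (A * A * A) / (4 * (L * L)))%R).
    assert (PL : (0 < L * L)%R) by nra.
    assert (PA3 : (0 < A * A * A)%R) by (apply Rmult_lt_0_compat; nra).
    assert (Hr3 : (0 < r3)%R) by (apply Rdiv_lt_0_compat; nra).
    set (r4 := (A / (2 * L))%R). assert (Hr4 : (0 < r4)%R) by (apply Rdiv_lt_0_compat; lra).
    exists (Rmin r0 (Rmin r1 (Rmin r3 r4))). split. repeat apply Rmin_pos; auto.
    intros y Hy. set (v := minus y x) in *. set (n := norm v) in *.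
    assert (Hy3 := Rlt_le_trans _ _ _ Hy (Rmin_l _ _)). assert (Hy4 := Rlt_le_trans _ _ _ Hy (Rmin_r _ _)).
    assert (Hy5 := Rlt_le_trans _ _ _ Hy4 (Rmin_l _ _)). assert (Hy6 := Rlt_le_trans _ _ _ Hy4 (Rmin_r _ _)).
    assert (Hy7 := Rlt_le_trans _ _ _ Hy6 (Rmin_l _ _)). assert (Hy8 := Rlt_le_trans _ _ _ Hy6 (Rmin_r _ _)).
    assert (Hn : (0 <= n)%R) by apply norm_ge_0.
    assert (BLy := BL y Hy3). fold v n in BLy.
    assert (LA : (A / 2 <= Cmod (f y))%R).
    { assert (L * n <= A / 2)%R. { apply Rle_trans with (L * r4)%R. apply Rmult_le_compat_l; lra. unfold r4. right; field. lra. }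
      generalize (Cmod_triangle (f y) (- (f y - f x))). rewrite Cmod_opp.
      replace (f y + - (f y - f x)) with (f x) by ring. fold A. lra. }
    assert (Hfy : f y <> 0) by (apply Cmod_gt_0; lra).
    replace (/ f y - / f x - - (/ f x * / f x * l v)) with
      (- (/ f x * / f x * (f y - f x - l v)) + / f x * / f x * / f y * ((f y - f x) * (f y - f x))) by (field; auto).
    eapply Rle_trans; [apply Cmod_triangle|]. rewrite Cmod_opp, !Cmod_mult, Ei, (Cmod_inv (f y)) by auto.
    assert (T1 : (/ A * / A * Cmod (f y - f x - l v) <= eps / 2 * n)%R).
    { apply Rle_trans with (/ A * / A * (e1 * n))%R. apply Rmult_le_compat_l. nra. apply C1; auto.
      unfold e1. right. field. lra. }
    assert (I2 : (/ Cmod (f y) <= 2 * / A)%R).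
    { replace (2 * / A)%R with (/ (A / 2))%R by (field; lra). apply Rinv_le_contravar; lra. }
    assert (T2 : (/ A * / A * / Cmod (f y) * (Cmod (f y - f x) * Cmod (f y - f x)) <= eps / 2 * n)%R).
    { apply Rle_trans with (/ A * / A * (2 * / A) * ((L * n) * (L * n)))%R.
      - apply Rmult_le_compat. apply Rmult_le_pos. nra. left; apply Rinv_0_lt_compat; lra.
        apply Rmult_le_pos; apply Cmod_ge_0. apply Rmult_le_compat_l; auto. nra.
        apply Rmult_le_compat; auto; apply Cmod_ge_0.
      - replace (/ A * / A * (2 * / A) * (L * n * (L * n)))%R with ((2 * (L * L) / (A * A * A)) * n * n)%R by (field; lra).
        apply Rmult_le_compat_r; auto.
        apply Rle_trans with (2 * (L * L) / (A * A * A) * r3)%R. apply Rmult_le_compat_l; [|lra].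
        apply Rmult_le_pos. lra. left; apply Rinv_0_lt_compat; auto.
        unfold r3. right. field. split; lra. }
    lra.
Qed.

Lemma Cdiff_ext f g x : nbhd (fun y => f y = g y) x -> Cdiff f x -> Cdiff g x.
Proof.
  intros (r & Hr & E) (l & K & HK & Hl & H). exists l, K. split; auto. split; auto.
  intros eps He. destruct (H eps He) as (r1 & Hr1 & B). exists (Rmin r r1). split. now apply Rmin_pos.
  intros y Hy. assert (Hy1 := Rlt_le_trans _ _ _ Hy (Rmin_l _ _)). assert (Hy2 := Rlt_le_trans _ _ _ Hy (Rmin_r _ _)).
  rewrite <- (E y Hy1), <- (E x). apply B; auto.
  assert (N : norm (minus x x) = 0%R).
  { transitivity (norm (zero : V)). apply f_equal, (minus_eq_zero x). apply (@norm_zero C_AbsRing V). }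
  rewrite N. exact Hr.
Qed.

Lemma nbhd_locally (U : V -> Prop) x : nbhd U x -> locally x U.
Proof.
  intros (r & Hr & H). apply (locally_le_locally_norm x). exists (mkposreal r Hr). intros y Hy. apply H. exact Hy.
Qed.

Lemma locally_nbhd (U : V -> Prop) x : locally x U -> nbhd U x.
Proof.
  intros H. destruct (locally_norm_le_locally x U H) as [r Hr]. exists r. split. apply cond_pos.
  intros y Hy. apply Hr. exact Hy.
Qed.

(** The ambient differential serves for the restriction to [D]; membership of [x] in [D] makes the
    restricted filter proper, which pins its limit point down to [x]. *)
Lemma Cdiff_ex_filterdiff (D : V -> Prop) f x : D x -> Cdiff f x ->
  ex_filterdiff (V := C_NormedModule) f (within D (locally x)).
Proof.
  intros HD (l & K & HK & (A1 & A2 & A3) & H). exists l.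
  assert (PF : ProperFilter (within D (locally x))).
  { constructor. 2:apply within_filter, locally_filter.
    intros P HP. exists x. apply (locally_singleton x _ HP). exact HD. }
  apply (filterdiff_locally (F := within D (locally x)) f x l).
  - intros P HP. unfold within. generalize HP. apply filter_imp. auto.
  - split.
    + split. exact A1. exact A2. exists (K + 1)%R. split. lra. intros u.
      eapply Rle_trans; [apply A3|]. apply Rmult_le_compat_r. apply norm_ge_0. lra.
    + intros z Hz. assert (E := is_filter_lim_locally_unique _ _ Hz). subst z.
      intros eps. apply nbhd_locally. destruct (H eps (cond_pos eps)) as (r & Hr & B). exists r; split; auto.
Qed.

End Cdiff.

(** * The factor d / sin (pi e) near d = 0 *)

Lemma Csin_PI_sub (w : C) : Csin (PI * (1 - w)) = Csin (PI * w).
Proof.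
  unfold Csin. f_equal.
  assert (E1 : Cexp (Ci * PI) = - (1)).
  { unfold Cexp, Ci, Cmult, Copp, RtoC; simpl. 
    replace (0 * PI - 1 * 0)%R with 0%R by ring. replace (0 * 0 + 1 * PI)%R with PI by ring.
    rewrite exp_0, cos_PI, sin_PI. f_equal; ring. }
  replace (Ci * (PI * (1 - w))) with (Ci * PI + - (Ci * (PI * w))) by ring.
  replace (- (Ci * PI + - (Ci * (PI * w)))) with (- (Ci * PI) + Ci * (PI * w)) by ring.
  rewrite !Cexp_plus, (Cexp_opp (Ci * PI)), E1. field.
Qed.

(** In the odd combination of [Cexp (Ci * z)] and [Cexp (- (Ci * z))] the constant and quadratic
    terms cancel, so the third-order remainders of the exponential bound the error. *)
Lemma Csin_taylor (z : C) : (Cmod (Csin z - z) <= Cmod z * Cmod z * Cmod z * exp (Cmod z))%R.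
Proof.
  assert (Ci0 : Ci <> 0) by (intros E; injection E; lra).
  set (u := Ci * z). assert (Eu : Cmod u = Cmod z) by (unfold u; rewrite Cmod_mult, Cmod_Ci; ring).
  assert (T1 := Cexp_taylor3_le u). assert (T2 := Cexp_taylor3_le (- u)).
  rewrite Cmod_opp in T2. rewrite Eu in T1, T2.
  assert (E : Csin z - z = ((Cexp u - 1 - u - u * u / 2) + - (Cexp (- u) - 1 - (- u) - (- u) * (- u) / 2)) / (2 * Ci)).
  { unfold Csin. fold u. assert (Ez : z = u / Ci) by (unfold u; field; auto).
    rewrite Ez at 1. generalize (Cexp u) (Cexp (- u)). clearbody u. intros A B. field. auto. }
  rewrite E, Cmod_div, Cmod_mult, Cmod_Ci, Cmod_R, Rabs_pos_eq by (try lra; apply Cmult_neq_0; auto; apply RtoC_neq; lra).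
  apply Rmult_le_reg_r with (2 * 1)%R. lra. unfold Rdiv. rewrite Rmult_assoc, Rinv_l, Rmult_1_r by lra.
  eapply Rle_trans; [apply Cmod_triangle|]. rewrite Cmod_opp. lra.
Qed.

(** From [PI <= 4] one gets [|PI * w| <= 1 / 4], so the exponential factor of [Csin_taylor] is at
    most 3, and [192 = 3 * 4 ^ 3]. The lower bound then follows by the triangle inequality. *)
Lemma Csin_PI_bounds (w : C) : (Cmod w <= 1 / 16)%R ->
  (Cmod w / 4 <= Cmod (Csin (PI * w)))%R /\ (Cmod (Csin (PI * w) - PI * w) <= 192 * (Cmod w * Cmod w * Cmod w))%R.
Proof.
  intros Hw. assert (P := Cmod_ge_0 w). assert (T := Csin_taylor (PI * w)).
  assert (P4 := PI_4). assert (P3 := PI2_1).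
  rewrite !Cmod_mult, Cmod_R, (Rabs_pos_eq PI) in T by lra.
  assert (E : (exp (PI * Cmod w) <= 3)%R).
  { apply Rle_trans with (exp 1). apply exp_le. nra. apply exp_le_3. }
  set (n := Cmod w) in *. set (x := (PI * n)%R) in *.
  assert (Hx : (0 <= x)%R) by (unfold x; nra).
  assert (T2 : (Cmod (Csin (PI * w) - PI * w) <= x * x * x * 3)%R).
  { eapply Rle_trans; [apply T|]. apply Rmult_le_compat_l; auto. apply Rmult_le_pos; auto. nra. }
  assert (Hx4 : (x <= 4 * n)%R) by (unfold x; nra).
  assert (Hx2 : (2 * n <= x)%R) by (unfold x; nra).
  split.
  - generalize (Cmod_triangle (Csin (PI * w)) (- (Csin (PI * w) - PI * w))). rewrite Cmod_opp.
    replace (Csin (PI * w) + - (Csin (PI * w) - PI * w)) with (PI * w) by ring.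
    rewrite Cmod_mult, Cmod_R, Rabs_pos_eq by lra. fold n. fold x. intros T3.
    assert (x * x <= 1 / 16)%R by (assert (x <= 1/4)%R by lra; nra).
    assert (x * x * x <= 1 / 16 * x)%R by (apply Rmult_le_compat_r; auto). lra.
  - eapply Rle_trans; [apply T2|]. assert (x * x <= (4 * n) * (4 * n))%R by (apply Rmult_le_compat; auto).
    assert (x * x * x <= (4 * n) * (4 * n) * (4 * n))%R by (apply Rmult_le_compat; auto; nra). lra.
Qed.

(** Here [w = 1 - e], so that [sin (pi (1 - w))] is the factor of the defining formula. *)
Definition sinq (w : C) : C := if Ceq_dec w 0 then / PI else w / Csin (PI * (1 - w)).

(** The error is quadratic, so the differential of [sinq] at 0 is zero. The constant is
    [768 = 4 * 192], the 4 coming from the lower bound [|w| / 4] for the sine. *)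
Lemma sinq_near_0 (w : C) : (Cmod w <= 1 / 16)%R -> (Cmod (sinq w - sinq 0) <= 768 * (Cmod w * Cmod w))%R.
Proof.
  intros Hw. unfold sinq. destruct (Ceq_dec 0 0) as [_|E]; [|now destruct E].
  destruct (Ceq_dec w 0) as [->|E].
  - replace (/ PI - / PI) with (RtoC 0) by ring. rewrite Cmod_0. lra.
  - rewrite Csin_PI_sub. destruct (Csin_PI_bounds w Hw) as [B1 B2].
    assert (P := proj1 (Cmod_gt_0 w) E). assert (P3 := PI2_1).
    assert (S0 : Csin (PI * w) <> 0) by (apply Cmod_gt_0; lra).
    assert (PI0 : RtoC PI <> 0) by (apply RtoC_neq; lra).
    replace (w / Csin (PI * w) - / PI) with (- ((Csin (PI * w) - PI * w) / (PI * Csin (PI * w)))) by (field; auto).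
    rewrite Cmod_opp, Cmod_div, Cmod_mult, Cmod_R, Rabs_pos_eq by (try lra; apply Cmult_neq_0; auto).
    set (n := Cmod w) in *. set (s := Cmod (Csin (PI * w))) in *.
    assert (n / 4 <= PI * s)%R by nra.
    apply Rmult_le_reg_r with (PI * s)%R. lra. unfold Rdiv at 1. rewrite Rmult_assoc, Rinv_l, Rmult_1_r by lra.
    assert (768 * (n * n) * (n / 4) <= 768 * (n * n) * (PI * s))%R by (apply Rmult_le_compat_l; nra). lra.
Qed.

Lemma Re_plus (a b : C) : Re (a + b) = (Re a + Re b)%R. Proof. reflexivity. Qed.
Lemma Re_minus (a b : C) : Re (a - b) = (Re a - Re b)%R. Proof. reflexivity. Qed.
Lemma Re_opp (a : C) : Re (- a) = (- Re a)%R. Proof. reflexivity. Qed.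
Lemma Re_RtoC (a : R) : Re (RtoC a) = a. Proof. reflexivity. Qed.

Lemma xi_INR k : RtoC (xi k) * (INR k + 1) = 1.
Proof.
  rewrite <- RtoC_plus, <- RtoC_mult. f_equal. unfold xi. rewrite S_INR. field.
  generalize (pos_INR k). lra.
Qed.

(** * Linear factors of a term ratio *)

Section Shifted.
Context {V : NormedModule C_AbsRing}.
Variables (U : V -> Prop) (eta : R).
Hypothesis eta_pos : (0 < eta <= 1)%R.

(** The [- 1] reflects [w + k = (k + 1) (1 + (w - 1) xi k)]. As [0 < xi k <= 1], the real part is a
    convex combination of [1] and [Re w], both at least [eta]. *)
Lemma shifted_bound (w : C) k : (eta <= Re w)%R -> (eta <= Cmod (1 + (w - 1) * xi k))%R.
Proof.
  intros Hw. eapply Rle_trans; [|apply Cmod_ge_Re].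
  assert (P := xi_pos k). assert (P1 := xi_le_1 k).
  unfold Re, Cminus, Cplus, Copp, Cmult, RtoC in *; simpl in *. nra.
Qed.

Lemma expands_shifted_inv (w : V -> C) : C2bdd U w -> (forall x, U x -> (eta <= Re (w x))%R) ->
  expands U (fun k x => / (1 + (w x - 1) * xi k)) (fun x => - (w x - 1)).
Proof.
  intros Hw Hb. apply (expands_linear_inv U (fun x => w x - 1) eta).
  apply C2bdd_minus; auto. apply C2bdd_const. lra. intros. apply shifted_bound; auto.
Qed.

Lemma C2O_shifted_inv (w : V -> C) : C2bdd U w -> (forall x, U x -> (eta <= Re (w x))%R) ->
  C2O U (fun k x => / (w x + INR k)) 1.
Proof.
  intros Hw Hb.
  apply C2O_ext with (fun k x => RtoC (xi k) ^ 1 * / (1 + (w x - 1) * xi k)).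
  - intros k x Hx. assert (P := xi_pos k).
    assert (N : RtoC (xi k) <> 0) by (apply RtoC_neq; lra).
    assert (N2 : w x + INR k <> 0) by (apply Re_pos_neq; [specialize (Hb x Hx); lra|apply pos_INR]).
    assert (E : 1 + (w x - 1) * xi k = xi k * (w x + INR k)).
    { replace (xi k * (w x + INR k)) with (xi k * (INR k + 1) + (w x - 1) * xi k) by ring. now rewrite xi_INR. }
    rewrite E. simpl. field. auto.
  - apply (C2O_mult U _ _ 1 0). apply C2O_xi.
    apply (expands_C2O U _ (fun x => - (w x - 1))). now apply expands_shifted_inv.
Qed.

(** By [pairm_spec] this is what remains of the quotient of two linear pairs after subtracting 1 and
    removing [d]; its two denominators account for the order 2. *)
Lemma C2O_pair (d w x : V -> C) : C2bdd U d -> C2bdd U w -> C2bdd U x ->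
  (forall q, U q -> (eta <= Re (w q))%R) -> (forall q, U q -> (eta <= Re (x q + d q))%R) ->
  C2O U (fun k q => (x q - w q) * (/ (w q + INR k) * / (x q + d q + INR k))) 2.
Proof.
  intros Hd Hw Hx H1 H2. apply (C2O_mult U _ _ 0 2). apply C2O_const. now apply C2bdd_minus.
  apply (C2O_mult U _ _ 1 1); apply C2O_shifted_inv; auto. now apply C2bdd_plus.
Qed.

End Shifted.

(** * Coordinates on the parameter space and the two term ratios *)

Definition C7N : NormedModule C_AbsRing :=
  prod_NormedModule C_AbsRing (prod_NormedModule C_AbsRing (prod_NormedModule C_AbsRing
  (prod_NormedModule C_AbsRing (prod_NormedModule C_AbsRing (prod_NormedModule C_AbsRing
  C_NormedModule C_NormedModule) C_NormedModule) C_NormedModule) C_NormedModule) C_NormedModule) C_NormedModule.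

Definition qa (q : C7N) : C := fst (fst (fst (fst (fst (fst q))))).
Definition qb (q : C7N) : C := snd (fst (fst (fst (fst (fst q))))).
Definition qc (q : C7N) : C := snd (fst (fst (fst (fst q)))).
Definition qd (q : C7N) : C := snd (fst (fst (fst q))).
Definition qe (q : C7N) : C := snd (fst (fst q)).
Definition qf (q : C7N) : C := snd (fst q).
Definition qg (q : C7N) : C := snd q.
(** The value of [g] forced by the Saalschutzian relation. Using it in place of [qg] makes every
    function below depend on free coordinates, so that it can be differentiated on the ambient
    space. *)
Definition qg' (q : C7N) : C := 1 + qa q + qb q + qc q + qd q - qe q - qf q.
Definition qdl (q : C7N) : C := 1 - qe q.

Lemma norm_fst_le (U V : NormedModule C_AbsRing) (x : prod_NormedModule C_AbsRing U V) :
  (norm (fst x) <= norm x)%R.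
Proof. destruct x as [u v]. eapply Rle_trans; [|apply (proj1 (norm_prod u v))]. apply Rmax_l. Qed.

Lemma norm_snd_le (U V : NormedModule C_AbsRing) (x : prod_NormedModule C_AbsRing U V) :
  (norm (snd x) <= norm x)%R.
Proof. destruct x as [u v]. eapply Rle_trans; [|apply (proj1 (norm_prod u v))]. apply Rmax_r. Qed.

Lemma norm_C_Cmod (x : C) : norm (K := C_AbsRing) (V := C_NormedModule) x = Cmod x.
Proof. reflexivity. Qed.

Lemma clinear_fst (U W : NormedModule C_AbsRing) (l : U -> C) :
  clinear l 1 -> clinear (V := prod_NormedModule C_AbsRing U W) (fun q => l (fst q)) 1.
Proof.
  intros (H1 & H2 & H3). split; [|split].
  - intros u v. exact (H1 (fst u) (fst v)).
  - intros k u. exact (H2 k (fst u)).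
  - intros u. eapply Rle_trans; [apply H3|]. rewrite !Rmult_1_l. apply norm_fst_le.
Qed.

Lemma clinear_snd (U : NormedModule C_AbsRing) :
  clinear (V := prod_NormedModule C_AbsRing U C_NormedModule) (fun q => snd q) 1.
Proof.
  split; [|split].
  - reflexivity.
  - reflexivity.
  - intros u. rewrite Rmult_1_l, <- norm_C_Cmod. apply norm_snd_le.
Qed.

Lemma clinear_id : clinear (V := C_NormedModule) (fun q => q) 1.
Proof.
  split; [|split]; try reflexivity.
  intros u. rewrite Rmult_1_l, <- norm_C_Cmod. apply Rle_refl.
Qed.

Lemma clinear_qa : clinear qa 1.
Proof. exact (clinear_fst _ _ _ (clinear_fst _ _ _ (clinear_fst _ _ _ (clinear_fst _ _ _ (clinear_fst _ _ _ (clinear_fst _ _ _ clinear_id)))))). Qed.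

Lemma clinear_qb : clinear qb 1.
Proof. exact (clinear_fst _ _ _ (clinear_fst _ _ _ (clinear_fst _ _ _ (clinear_fst _ _ _ (clinear_fst _ _ _ (clinear_snd _)))))). Qed.

Lemma clinear_qc : clinear qc 1.
Proof. exact (clinear_fst _ _ _ (clinear_fst _ _ _ (clinear_fst _ _ _ (clinear_fst _ _ _ (clinear_snd _))))). Qed.

Lemma clinear_qd : clinear qd 1.
Proof. exact (clinear_fst _ _ _ (clinear_fst _ _ _ (clinear_fst _ _ _ (clinear_snd _)))). Qed.

Lemma clinear_qe : clinear qe 1.
Proof. exact (clinear_fst _ _ _ (clinear_fst _ _ _ (clinear_snd _))). Qed.

Lemma clinear_qf : clinear qf 1.
Proof. exact (clinear_fst _ _ _ (clinear_snd _)). Qed.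

Lemma clinear_qg : clinear qg 1.
Proof. exact (clinear_snd _). Qed.

Lemma clinear_minus {V : NormedModule C_AbsRing} (l : V -> C) K (x y : V) :
  clinear l K -> l (minus y x) = l y - l x.
Proof.
  intros (A & _).
  assert (E0 : l (plus (minus y x) x) = l y).
  { f_equal. unfold minus. rewrite <- plus_assoc, plus_opp_l. apply plus_zero_r. }
  rewrite <- E0, A. ring.
Qed.

(** In the quotient of the Gauss sequences at [x + d], [w] by those at [x], [w + d] the factorials
    and the powers of [n] cancel, the arguments having equal sums, and only the Pochhammer products
    remain. *)
Lemma gauss_pair_lim (x w d : C) :
  (0 < Re x)%R -> (0 < Re w)%R -> (0 < Re (x + d))%R -> (0 < Re (w + d))%R ->
  filterlim (Cprod (fun k => (w + d + INR k) * (x + INR k) * (/ (w + INR k) * / (x + d + INR k)))) eventually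
    (locally (Gamma (x + d) * Gamma w * / (Gamma x * Gamma (w + d)))).
Proof.
  intros Hx Hw Hxd Hwd.
  assert (L : filterlim (fun n => gauss (x + d) n * gauss w n * / (gauss x n * gauss (w + d) n)) eventually
     (locally (Gamma (x + d) * Gamma w * / (Gamma x * Gamma (w + d))))).
  { apply (filterlim_C_mult eventually).
    apply (filterlim_C_mult eventually); now apply Gamma_lim.
    apply (filterlim_C_inv eventually). apply Cmult_neq_0; now apply Gamma_neq_0.
    apply (filterlim_C_mult eventually); now apply Gamma_lim. }
  (* The Gauss term of index [n] contains [S n] linear factors, whence the shift of the
     threshold. *)
  intros P HP. destruct (L P HP) as [N HN]. exists (S (S N)). intros n Hn.
  destruct n as [|n]; [lia|]. specialize (HN n ltac:(lia)).
  match type of HN with P ?A => replace (Cprod _ (S n)) with A; auto end.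
  unfold gauss, Rpow_C. rewrite !poch_prod.
  assert (N1 := Cprod_neq_0 (fun k => x + INR k) (S n) (fun k => Re_pos_neq x _ Hx (pos_INR k))).
  assert (N2 := Cprod_neq_0 (fun k => w + INR k) (S n) (fun k => Re_pos_neq w _ Hw (pos_INR k))).
  assert (N3 := Cprod_neq_0 (fun k => x + d + INR k) (S n) (fun k => Re_pos_neq (x + d) _ Hxd (pos_INR k))).
  assert (N4 := Cprod_neq_0 (fun k => w + d + INR k) (S n) (fun k => Re_pos_neq (w + d) _ Hwd (pos_INR k))).
  assert (E : Cprod (fun k => (w + d + INR k) * (x + INR k) * (/ (w + INR k) * / (x + d + INR k))) (S n) *
     (Cprod (fun k => w + INR k) (S n) * Cprod (fun k => x + d + INR k) (S n)) =
     Cprod (fun k => w + d + INR k) (S n) * Cprod (fun k => x + INR k) (S n)).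
  { rewrite <- !Cprod_mult. apply Cprod_ext. intros k _. field. 
    split; apply Re_pos_neq; auto; apply pos_INR. }
  set (A1 := Cprod (fun k => x + INR k) (S n)) in *.
  set (A2 := Cprod (fun k => w + INR k) (S n)) in *.
  set (A3 := Cprod (fun k => x + d + INR k) (S n)) in *.
  set (A4 := Cprod (fun k => w + d + INR k) (S n)) in *.
  set (B := Cprod (fun k => (w + d + INR k) * (x + INR k) * (/ (w + INR k) * / (x + d + INR k))) (S n)) in *.
  assert (E2 : B = A4 * A1 * / (A2 * A3)).
  { rewrite <- E. field. auto. }
  rewrite E2. rewrite !Cmult_plus_distr_r, !Cexp_plus.
  assert (M1 := Cexp_neq_0 (x * ln (INR n))). assert (M2 := Cexp_neq_0 (w * ln (INR n))).
  assert (M3 := Cexp_neq_0 (d * ln (INR n))).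
  assert (F : RtoC (INR (fact n)) <> 0) by apply RtoC_neq, INR_fact_neq_0.
  field. repeat split; auto.
Qed.

(** The quotient of two linear pairs, minus 1 and divided by [d], with the division carried out; at
    [d = 0] it is [1 / (w + k) - 1 / (x + k)]. *)
Definition pairm (d w x : C) (k : nat) : C := (x - w) * (/ (w + INR k) * / (x + d + INR k)).

Lemma pairm_spec (d w x : C) k : w + INR k <> 0 -> x + d + INR k <> 0 ->
  1 + d * pairm d w x k = (w + d + INR k) * (x + INR k) * (/ (w + INR k) * / (x + d + INR k)).
Proof. intros H1 H2. unfold pairm. field. auto. Qed.

(** The product of the four factors [1 + d * m], minus 1 and divided by [d], expanded as a
    polynomial; at [d = 0] it reduces to [m1 + m2 + m3 + m4]. *)
Definition pair4 (d m1 m2 m3 m4 : C) : C :=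
  m1 + m2 * (1 + d * m1) + m3 * ((1 + d * m1) * (1 + d * m2)) +
  m4 * ((1 + d * m1) * (1 + d * m2) * (1 + d * m3)).

Lemma pair4_spec (d m1 m2 m3 m4 : C) :
  1 + d * pair4 d m1 m2 m3 m4 = (1 + d * m1) * (1 + d * m2) * (1 + d * m3) * (1 + d * m4).
Proof. unfold pair4. ring. Qed.

(** [1 + qdl q * gfac q k] is the quotient [phi k / phi (k + d)] of consecutive
    term ratios of the two hypergeometric series, [d = 1 - e]. *)
Definition gfac (q : C7N) (k : nat) : C :=
  pair4 (qdl q) (pairm (qdl q) (qe q) (qa q) k) (pairm (qdl q) (qf q) (qb q) k)
    (pairm (qdl q) (qg' q) (qc q) k) (pairm (qdl q) 1 (qd q) k).

Definition phi (q : C7N) (k : nat) : C :=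
  (qa q + INR k) * (qb q + INR k) * (qc q + INR k) * (qd q + INR k) *
  (/ (qe q + INR k) * / (qf q + INR k) * / (qg' q + INR k) * / (1 + INR k)).

(** This is [phi] at [k + d]. Since [e + d = 1], the parameter [e] turns into the factorial and the
    factorial into [2 - e], which yields the second series of the defining formula. *)
Definition phid (q : C7N) (k : nat) : C :=
  (qa q + qdl q + INR k) * (qb q + qdl q + INR k) * (qc q + qdl q + INR k) * (qd q + qdl q + INR k) *
  (/ (1 + INR k) * / (qf q + qdl q + INR k) * / (qg' q + qdl q + INR k) * / (1 + qdl q + INR k)).

Definition mishev_sum (q : C7N) : C :=
  Csum (fun n => Cprod (phi q) n * prodquot (qdl q) (fun k => gfac q (n + k))).

(** * The continuation in a neighbourhood of a point with e = 1 *)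

Section Near.
Variables (p : C7N) (mu : R).
Hypothesis Hmu : (0 < mu <= 1)%R.
Hypothesis Hpa : (mu <= Re (qa p))%R.
Hypothesis Hpb : (mu <= Re (qb p))%R.
Hypothesis Hpc : (mu <= Re (qc p))%R.
Hypothesis Hpd : (mu <= Re (qd p))%R.
Hypothesis Hpe : qe p = 1.
Hypothesis Hpf : (mu <= Re (qf p))%R.
Hypothesis Hpg : (mu <= Re (qg' p))%R.

(** The worst case is [qg' + qdl], which moves by at most seven coordinate deviations and so keeps
    real part at least [9 * mu / 16]. Moreover [mu <= 1] gives [|1 - e| <= 1 / 16], as
    [Csin_PI_bounds] demands. *)
Definition near (q : C7N) : Prop := (norm (minus q p) < mu / 16)%R.
Definition eta : R := (mu / 16)%R.

Lemma near_coord (l : C7N -> C) q : clinear l 1 -> near q -> (Cmod (l q - l p) < mu / 16)%R.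
Proof.
  intros Hl Hq. rewrite <- (clinear_minus l 1 p q Hl). destruct Hl as (_ & _ & H).
  eapply Rle_lt_trans; [apply H|]. rewrite Rmult_1_l. exact Hq.
Qed.

Lemma near_Re (l : C7N -> C) q : clinear l 1 -> near q -> (Rabs (Re (l q) - Re (l p)) < mu / 16)%R.
Proof.
  intros Hl Hq. eapply Rle_lt_trans; [|apply (near_coord l q Hl Hq)].
  rewrite <- Re_minus. apply re_le_Cmod.
Qed.

Lemma near_bounds q : near q ->
  (eta <= Re (qa q) /\ eta <= Re (qb q) /\ eta <= Re (qc q) /\ eta <= Re (qd q) /\ eta <= Re (qe q) /\
   eta <= Re (qf q) /\ eta <= Re (qg' q) /\
   eta <= Re (qa q + qdl q) /\ eta <= Re (qb q + qdl q) /\ eta <= Re (qc q + qdl q) /\ eta <= Re (qd q + qdl q) /\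
   eta <= Re (qf q + qdl q) /\ eta <= Re (qg' q + qdl q) /\ eta <= Re (1 + qdl q))%R.
Proof.
  intros Hq.
  generalize (near_Re qa q clinear_qa Hq) (near_Re qb q clinear_qb Hq) (near_Re qc q clinear_qc Hq)
   (near_Re qd q clinear_qd Hq) (near_Re qe q clinear_qe Hq) (near_Re qf q clinear_qf Hq).
  revert Hpg. unfold eta, qg', qdl.
  rewrite ?Re_plus, ?Re_minus, ?Re_plus, ?Re_RtoC, Hpe, ?Re_RtoC.
  (* Each absolute value is replaced by a variable once its two-sided bound is recorded, which
     leaves a linear problem. *)
  repeat match goal with |- context [Rabs ?x] => 
    let H := fresh in assert (H : (- Rabs x <= x <= Rabs x)%R) by (unfold Rabs; destruct (Rcase_abs x); lra);
    generalize dependent (Rabs x); intros ? ? end.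
  intros. lra.
Qed.

Lemma C2bdd_coord (l : C7N -> C) : clinear l 1 -> C2bdd near l.
Proof.
  intros Hl. exists (Cmod (l p) + mu / 16 + 1)%R.
  apply C2norm_le_ext with (fun q => l q + 0). intros; ring.
  apply C2norm_le_affine; auto. lra. generalize (Cmod_ge_0 (l p)); lra.
  intros q Hq. assert (H := near_coord l q Hl Hq).
  replace (l q + 0) with (l p + (l q - l p)) by ring.
  eapply Rle_trans; [apply Cmod_triangle|]. lra.
Qed.

Lemma C2bdd_qdl : C2bdd near qdl.
Proof. apply C2bdd_minus. apply C2bdd_const. apply C2bdd_coord, clinear_qe. Qed.

Lemma C2bdd_qg' : C2bdd near qg'.
Proof.
  unfold qg'. repeat (first [apply C2bdd_minus | apply C2bdd_plus]);
  [apply C2bdd_const|..]; apply C2bdd_coord;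
  [apply clinear_qa|apply clinear_qb|apply clinear_qc|apply clinear_qd|apply clinear_qe|apply clinear_qf].
Qed.

Lemma eta_range : (0 < eta <= 1)%R.
Proof. unfold eta. lra. Qed.

(** Each of the four pairs is of order 2 by itself, and [pair4] combines them with cofactors of
    order 0. *)
Lemma C2O_gfac : C2O near (fun k q => gfac q k) 2.
Proof.
  assert (Hd := C2bdd_qdl). assert (Hg := C2bdd_qg').
  assert (M1 : C2O near (fun k q => pairm (qdl q) (qe q) (qa q) k) 2).
  { apply (C2O_pair near eta eta_range qdl qe qa); auto; try (apply C2bdd_coord; first [apply clinear_qa|apply clinear_qe]);
    intros q Hq; apply near_bounds; auto. }
  assert (M2 : C2O near (fun k q => pairm (qdl q) (qf q) (qb q) k) 2).
  { apply (C2O_pair near eta eta_range qdl qf qb); auto; try (apply C2bdd_coord; first [apply clinear_qb|apply clinear_qf]);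
    intros q Hq; apply near_bounds; auto. }
  assert (M3 : C2O near (fun k q => pairm (qdl q) (qg' q) (qc q) k) 2).
  { apply (C2O_pair near eta eta_range qdl qg' qc); auto; try (apply C2bdd_coord; apply clinear_qc);
    intros q Hq; apply near_bounds; auto. }
  assert (M4 : C2O near (fun k q => pairm (qdl q) 1 (qd q) k) 2).
  { apply (C2O_pair near eta eta_range qdl (fun _ => 1) qd); auto; try (apply C2bdd_coord; apply clinear_qd);
    try apply C2bdd_const; intros q Hq. simpl. generalize eta_range; lra. apply near_bounds; auto. }
  assert (O1 : forall m : nat -> C7N -> C, C2O near m 2 -> C2O near (fun k q => 1 + qdl q * m k q) 0).
  { intros m Hm. apply C2O_plus. apply C2O_const, C2bdd_const.
    apply C2O_weaken with 2%nat. lia. apply (C2O_mult near (fun _ => qdl) m 0 2); auto. now apply C2O_const. }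
  assert (P1 := O1 _ M1). assert (P2 := O1 _ M2). assert (P3 := O1 _ M3).
  assert (P12 := C2O_mult near _ _ 0 0 P1 P2). assert (P123 := C2O_mult near _ _ 0 0 P12 P3).
  exact (C2O_plus near _ _ 2 (C2O_plus near _ _ 2 (C2O_plus near _ _ 2 M1 (C2O_mult near _ _ 2 0 M2 P1))
    (C2O_mult near _ _ 2 0 M3 P12)) (C2O_mult near _ _ 2 0 M4 P123)).
Qed.

Lemma shifted_eq (w : C) k : 1 + (w - 1) * xi k = xi k * (w + INR k).
Proof. replace (xi k * (w + INR k)) with (xi k * (INR k + 1) + (w - 1) * xi k) by ring. now rewrite xi_INR. Qed.

Lemma xi_succ k : (1 + 1 * xi k) * xi (S k) = xi k.
Proof.
  unfold xi. rewrite <- RtoC_mult, <- RtoC_plus, <- RtoC_mult. f_equal. rewrite !S_INR. field.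
  generalize (pos_INR k). lra.
Qed.

(** With [g] eliminated, the coefficient of [1 / (k + 1)] in [phi] is
    [a + b + c + d - e - f - g - 1 = -2]. The factor [(1 + xi k) ^ 2] in [y] cancels it, so the
    product of the [y k] is bounded, while the product of these factors telescopes to
    [(n + 1) ^ 2]. *)
Lemma Cprod_phi_C2 : exists K, (0 <= K)%R /\ forall n, C2norm_le near (fun q => Cprod (phi q) n) (K * xi n ^ 2).
Proof.
  set (y := fun k q => phi q k * ((1 + 1 * xi k) * (1 + 1 * xi k))).
  assert (Hy : C2O near (fun k q => y k q - 1) 2).
  { apply expands_0 with (al := fun q => ((((qa q - 1) + (qb q - 1) + (qc q - 1) + (qd q - 1)) +
        (- (qe q - 1) + - (qf q - 1) + - (qg' q - 1))) + (1 + 1))).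
    - intros q _. unfold qg'. ring.
    - apply expands_ext with (F := fun k q => (((1 + (qa q - 1) * xi k) * (1 + (qb q - 1) * xi k) * (1 + (qc q - 1) * xi k) * (1 + (qd q - 1) * xi k)) *
         (/ (1 + (qe q - 1) * xi k) * / (1 + (qf q - 1) * xi k) * / (1 + (qg' q - 1) * xi k))) * ((1 + 1 * xi k) * (1 + 1 * xi k)))
         (al := fun q => ((((qa q - 1) + (qb q - 1) + (qc q - 1) + (qd q - 1)) +
        (- (qe q - 1) + - (qf q - 1) + - (qg' q - 1))) + (1 + 1))); auto.
      + intros k q Hq. unfold y, phi. rewrite !shifted_eq.
        destruct (near_bounds q Hq) as (B1 & B2 & B3 & B4 & B5 & B6 & B7 & _).
        assert (P := eta_range). assert (PI := pos_INR k).
        assert (qe q + INR k <> 0) by (apply Re_pos_neq; lra).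
        assert (qf q + INR k <> 0) by (apply Re_pos_neq; lra).
        assert (qg' q + INR k <> 0) by (apply Re_pos_neq; lra).
        assert (Px := xi_pos k). assert (N : RtoC (xi k) <> 0) by (apply RtoC_neq; lra).
        replace (/ (1 + INR k)) with (RtoC (xi k)). 2:{ unfold xi. rewrite S_INR, RtoC_inv, RtoC_plus. f_equal. ring. lra. }
        field. auto.
      + assert (CL : forall l, clinear l 1 -> C2bdd near (fun q => l q - 1)).
        { intros l Hl. apply C2bdd_minus. now apply C2bdd_coord. apply C2bdd_const. }
        apply (expands_mult near); [apply (expands_mult near)|].
        * repeat apply (expands_mult near); apply expands_linear; apply CL; [apply clinear_qa|apply clinear_qb|apply clinear_qc|apply clinear_qd].
        * repeat apply (expands_mult near); apply (expands_shifted_inv near eta eta_range); try (intros q Hq; apply near_bounds; auto).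
          apply C2bdd_coord, clinear_qe. apply C2bdd_coord, clinear_qf. apply C2bdd_qg'.
        * apply (expands_mult near _ _ (fun _ => 1) (fun _ => 1)); apply (expands_linear near (fun _ => 1)), C2bdd_const. }
  destruct Hy as (M & HM & Hy).
  assert (B := C2norm_le_Cprod near (fun _ => 1) (Cmod 1) (fun k q => y k q - 1) _ (C2norm_le_const near 1) Hy
     (ex_series_xi_pow M 2 (Nat.le_refl 2))).
  set (K := exp (Cmod 1 * Series (fun k => M * xi k ^ 2)%R)) in B.
  exists K. split. left; apply exp_pos.
  intros n. apply C2norm_le_ext with (fun q => Cprod (fun k => 1 + 1 * (y k q - 1)) n * RtoC (xi n) ^ 2).
  - intros q Hq. induction n. simpl. unfold xi. simpl. rewrite Rinv_1. ring.
    simpl Cprod. rewrite <- IHn. replace (1 + 1 * (y n q - 1)) with (y n q) by ring. unfold y at 2.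
    transitivity (Cprod (fun k => 1 + 1 * (y k q - 1)) n * phi q n * (((1 + 1 * xi n) * xi (S n)) * ((1 + 1 * xi n) * xi (S n)))).
    simpl; ring. rewrite xi_succ. simpl; ring.
  - replace (K * xi n ^ 2)%R with (K * Cmod (RtoC (xi n) ^ 2))%R.
    apply (C2norm_le_mult near (fun q => Cprod (fun k => 1 + 1 * (y k q - 1)) n) (fun _ => RtoC (xi n) ^ 2)); auto.
    apply C2norm_le_const.
    rewrite Cmod_pow, Cmod_R, Rabs_pos_eq. reflexivity. left; apply xi_pos.
Qed.

Lemma xi_decr n k : (xi (n + k) <= xi k)%R.
Proof. unfold xi. apply Rinv_le_contravar. apply lt_0_INR; lia. apply le_INR. lia. Qed.

(** As [xi] decreases, the majorant of [gfac q k] also bounds every shifted sequence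
    [gfac q (n + k)], so the constants do not depend on [n]. *)
Lemma prodquot_gfac : exists D M K, C2norm_le near qdl D /\ (0 <= K)%R /\ ex_series M /\
   forall n, (forall k, C2norm_le near (fun q => gfac q (n + k)) (M k)) /\
     C2norm_le near (fun q => prodquot (qdl q) (fun k => gfac q (n + k))) K.
Proof.
  destruct C2bdd_qdl as [D HD]. destruct C2O_gfac as (M & HM & H).
  assert (EX := ex_series_xi_pow M 2 (Nat.le_refl 2)).
  assert (HH : forall n k, C2norm_le near (fun q => gfac q (n + k)) (M * xi k ^ 2)).
  { intros n k. apply C2norm_le_mono with (2 := H (n + k)%nat). apply Rmult_le_compat_l; auto.
    apply pow_incr. split. left; apply xi_pos. apply xi_decr. }
  assert (X : forall n, C2norm_le near (fun q => prodquot (qdl q) (fun k => gfac q (n + k))) 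
     (3 * (exp (D * Series (fun k => M * xi k ^ 2)%R) * Series (fun k => M * xi k ^ 2)%R))).
  { intros n. apply (C2norm_le_prodquot near qdl D (fun k q => gfac q (n + k)%nat) (fun k => M * xi k ^ 2)%R); auto. }
  exists D, (fun k => M * xi k ^ 2)%R. eexists. split; [exact HD|].
  split; [apply (C2norm_le_pos _ _ _ (X 0%nat))|]. split; auto.
Qed.

Lemma C2_hS : C2bdd near mishev_sum /\ forall q, near q ->
  is_series (V := C_NormedModule) (fun n => Cprod (phi q) n * prodquot (qdl q) (fun k => gfac q (n + k))) (mishev_sum q).
Proof.
  destruct Cprod_phi_C2 as (K & HK & H1). destruct prodquot_gfac as (D & M & K2 & _ & HK2 & _ & H2).
  assert (H : forall n, C2norm_le near (fun q => Cprod (phi q) n * prodquot (qdl q) (fun k => gfac q (n + k))) (K * K2 * xi n ^ 2)).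
  { intros n. replace (K * K2 * xi n ^ 2)%R with ((K * xi n ^ 2) * K2)%R by ring.
    apply C2norm_le_mult; auto. apply H2. }
  assert (EX := ex_series_xi_pow (K * K2) 2 (Nat.le_refl 2)).
  split.
  - eexists. apply C2norm_le_series with (1 := H). exact EX.
  - intros q Hq. apply is_series_Csum with (2 := EX). intros n.
    apply (C2norm_le_bound near _ _ q (H n) Hq).
Qed.

Lemma is_series_phi q : near q -> is_series (V := C_NormedModule) (fun n => Cprod (phi q) n) (Csum (fun n => Cprod (phi q) n)).
Proof.
  intros Hq. destruct Cprod_phi_C2 as (K & HK & H1).
  apply is_series_Csum with (fun n => K * xi n ^ 2)%R. 2:apply ex_series_xi_pow; lia.
  intros n. apply (C2norm_le_bound near _ _ q (H1 n) Hq).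
Qed.

Lemma gfac_tail_lim q n : near q ->
  filterlim (Cprod (fun k => 1 + qdl q * gfac q (n + k))) eventually
    (locally (1 + qdl q * prodquot (qdl q) (fun k => gfac q (n + k)))).
Proof.
  intros Hq. destruct prodquot_gfac as (D & M & K2 & HD & HK2 & EX & H2).
  apply (Cprod_lim_prodquot near qdl D (fun k q => gfac q (n + k)%nat) M HD (proj1 (H2 n)) EX q Hq).
Qed.

(** The full product of [phi k / phi (k + d)]. It is also the quotient of the Gamma denominators of
    the two terms of the formula ([rho_Gamma]), which is why their leading parts cancel. *)
Definition rho (q : C7N) : C := 1 + qdl q * prodquot (qdl q) (fun k => gfac q k).

(** Splitting the product at [n] shows that the terms of the second series are those of the first,
    times the tail product, divided by [rho]. *)
Lemma rho_tail q n : near q ->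
  Cprod (fun k => 1 + qdl q * gfac q k) n * (1 + qdl q * prodquot (qdl q) (fun k => gfac q (n + k))) = rho q.
Proof.
  intros Hq. assert (L0 := gfac_tail_lim q 0 Hq). simpl in L0.
  assert (Ln := gfac_tail_lim q n Hq).
  apply (filterlim_C_unique eventually (fun m => Cprod (fun k => 1 + qdl q * gfac q k) (n + m))).
  - eapply filterlim_ext. intros m. symmetry. apply Cprod_plus_index.
    apply (filterlim_C_mult eventually). apply filterlim_const. exact Ln.
  - intros P HP. destruct (L0 P HP) as [N HN]. exists N. intros m Hm. apply HN. lia.
Qed.

Lemma qe_qdl q : qe q + qdl q = 1.
Proof. unfold qdl. ring. Qed.

Lemma gfac_spec q k : near q -> phi q k = phid q k * (1 + qdl q * gfac q k).
Proof.
  intros Hq. unfold gfac. rewrite pair4_spec.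
  destruct (near_bounds q Hq) as (B1 & B2 & B3 & B4 & B5 & B6 & B7 & B8 & B9 & B10 & B11 & B12 & B13 & B14).
  assert (P := eta_range). assert (PI := pos_INR k).
  assert (forall z, (eta <= Re z)%R -> z + INR k <> 0) by (intros z Hz; apply Re_pos_neq; lra).
  assert (1 + INR k <> 0) by (rewrite <- RtoC_plus; apply RtoC_neq; lra).
  rewrite !pairm_spec by auto. rewrite qe_qdl. unfold phi, phid. field. repeat split; auto.
Qed.

(** The infinite product splits into four instances of [gauss_pair_lim]; the factors [Gamma (e + d)]
    and [Gamma 1] that appear in excess both equal 1. *)
Lemma rho_Gamma q : near q ->
  rho q * (Gamma (qa q) * Gamma (qb q) * Gamma (qc q) * Gamma (qd q) *
    (Gamma (qf q + qdl q) * Gamma (qg' q + qdl q) * Gamma (1 + qdl q))) =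
  Gamma (qa q + qdl q) * Gamma (qb q + qdl q) * Gamma (qc q + qdl q) * Gamma (qd q + qdl q) *
    (Gamma (qe q) * Gamma (qf q) * Gamma (qg' q)).
Proof.
  intros Hq.
  destruct (near_bounds q Hq) as (B1 & B2 & B3 & B4 & B5 & B6 & B7 & B8 & B9 & B10 & B11 & B12 & B13 & B14).
  assert (P := eta_range).
  assert (G : forall z, (eta <= Re z)%R -> Gamma z <> 0) by (intros z Hz; apply Gamma_neq_0; lra).
  assert (Q : forall z, (eta <= Re z)%R -> (0 < Re z)%R) by (intros z Hz; lra).
  assert (R1 : (0 < Re 1)%R) by (simpl; lra).
  assert (R2 : (0 < Re (qe q + qdl q))%R) by (rewrite qe_qdl; simpl; lra).
  assert (L1 := gauss_pair_lim (qa q) (qe q) (qdl q) (Q _ B1) (Q _ B5) (Q _ B8) R2).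
  assert (L2 := gauss_pair_lim (qb q) (qf q) (qdl q) (Q _ B2) (Q _ B6) (Q _ B9) (Q _ B12)).
  assert (L3 := gauss_pair_lim (qc q) (qg' q) (qdl q) (Q _ B3) (Q _ B7) (Q _ B10) (Q _ B13)).
  assert (L4 := gauss_pair_lim (qd q) 1 (qdl q) (Q _ B4) R1 (Q _ B11) (Q _ B14)).
  assert (L := filterlim_C_mult eventually _ _ _ _ (filterlim_C_mult eventually _ _ _ _ (filterlim_C_mult eventually _ _ _ _ L1 L2) L3) L4).
  assert (L0 := gfac_tail_lim q 0 Hq). simpl in L0.
  assert (E : rho q = Gamma (qa q + qdl q) * Gamma (qe q) * / (Gamma (qa q) * Gamma (qe q + qdl q)) *
     (Gamma (qb q + qdl q) * Gamma (qf q) * / (Gamma (qb q) * Gamma (qf q + qdl q))) *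
     (Gamma (qc q + qdl q) * Gamma (qg' q) * / (Gamma (qc q) * Gamma (qg' q + qdl q))) *
     (Gamma (qd q + qdl q) * Gamma 1 * / (Gamma (qd q) * Gamma (1 + qdl q)))).
  { apply (filterlim_C_unique eventually (Cprod (fun k => 1 + qdl q * gfac q k))). exact L0.
    eapply filterlim_ext; [|exact L]. intros n. cbv beta. rewrite <- !Cprod_mult. apply Cprod_ext.
    intros k _. unfold gfac. rewrite pair4_spec.
    assert (PI := pos_INR k).
    assert (forall z, (eta <= Re z)%R -> z + INR k <> 0) by (intros z Hz; apply Re_pos_neq; lra).
    assert (1 + INR k <> 0) by (rewrite <- RtoC_plus; apply RtoC_neq; lra).
    rewrite !pairm_spec by auto. reflexivity. }
  rewrite E, qe_qdl, Gamma_1. field. repeat split; auto.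
Qed.

Lemma hyp4F3_series a b c d e f g w :
  (0 < Re e)%R -> (0 < Re f)%R -> (0 < Re g)%R ->
  is_series (V := C_NormedModule) (Cprod (fun k => (a + INR k) * (b + INR k) * (c + INR k) * (d + INR k) *
    (/ (e + INR k) * / (f + INR k) * / (g + INR k) * / (1 + INR k)))) w ->
  hyp4F3 a b c d e f g = w.
Proof.
  intros He Hf Hg H.
  assert (H2 : is_series (V := C_NormedModule) (fun n =>
      (poch a n * poch b n * poch c n * poch d n) / (poch e n * poch f n * poch g n * INR (fact n))) w).
  { apply is_series_C_ext with (2 := H). intros n. induction n.
    - simpl. field.
    - assert (PI := pos_INR n).
      assert (e + INR n <> 0) by (apply Re_pos_neq; auto).
      assert (f + INR n <> 0) by (apply Re_pos_neq; auto).
      assert (g + INR n <> 0) by (apply Re_pos_neq; auto).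
      assert (1 + INR n <> 0) by (rewrite <- RtoC_plus; apply RtoC_neq; lra).
      assert (P1 := poch_neq_0 e n He). assert (P2 := poch_neq_0 f n Hf). assert (P3 := poch_neq_0 g n Hg).
      assert (F : RtoC (INR (fact n)) <> 0) by apply RtoC_neq, INR_fact_neq_0.
      simpl Cprod. rewrite IHn. simpl poch. rewrite fact_simpl, mult_INR, S_INR, RtoC_mult, RtoC_plus.
      field. repeat split; auto. intros E. apply H3. rewrite <- E. ring. }
  apply Cthe_unique; auto. intros y Hy. apply (is_series_C_unique _ _ _ Hy H2).
Qed.

(** The Gamma factors of the first denominator, written through [rGamma] so that holomorphy is
    immediate from [rGamma_C2bdd]. *)
Definition rprod (q : C7N) : C :=
  rGamma (qe q) * rGamma (qf q) * rGamma (qg' q) *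
  (rGamma (qa q + qdl q) * rGamma (qb q + qdl q) * rGamma (qc q + qdl q) * rGamma (qd q + qdl q)).

Definition mishev_ext (q : C7N) : C := sinq (qdl q) * rprod q * - mishev_sum q.

(** Let [S * X] and [S * Y] be the two denominators, [F1] the first series and [M] the sum
    [mishev_sum]. The second series is [(F1 + d * M) / rho] and [rho * Y = X], so the contributions
    of [F1] cancel and [- d * M / (S * X)] is left. *)
Lemma mishev_formula_near q : near q -> qg q = qg' q -> qdl q <> 0 -> mishev_formula q = mishev_ext q.
Proof.
  intros Hq Hg Hd.
  destruct (near_bounds q Hq) as (B1 & B2 & B3 & B4 & B5 & B6 & B7 & B8 & B9 & B10 & B11 & B12 & B13 & B14).
  assert (P := eta_range).
  assert (G : forall z, (eta <= Re z)%R -> Gamma z <> 0) by (intros z Hz; apply Gamma_neq_0; lra).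
  assert (Q : forall z, (eta <= Re z)%R -> (0 < Re z)%R) by (intros z Hz; lra).
  assert (HS : Csin (PI * (1 - qdl q)) <> 0).
  { rewrite Csin_PI_sub. destruct (Csin_PI_bounds (qdl q)) as [S1 _].
    - assert (H := near_coord qe q clinear_qe Hq). rewrite Hpe in H. unfold qdl.
      rewrite Cmod_minus_sym. lra.
    - apply Cmod_gt_0. assert (S2 := proj1 (Cmod_gt_0 _) Hd). lra. }
  assert (R := rho_Gamma q Hq).
  set (F1 := Csum (fun n => Cprod (phi q) n)).
  assert (S1 : is_series (V := C_NormedModule) (fun n => Cprod (phi q) n) F1) by (apply is_series_phi; auto).
  assert (S2 := proj2 C2_hS q Hq).
  assert (rho0 : rho q <> 0).
  { intros E. rewrite E, Cmult_0_l in R. symmetry in R. revert R. repeat apply Cmult_neq_0; auto. }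
  (* Each term of the second series equals the corresponding [P_n] times its tail product
     [1 + d * D_n], up to the constant [/ rho q]. *)
  assert (S3 : is_series (V := C_NormedModule) (fun n => Cprod (phid q) n) (/ rho q * (F1 + qdl q * mishev_sum q))).
  { apply is_series_C_ext with (fun n => / rho q * (Cprod (phi q) n + qdl q * (Cprod (phi q) n * prodquot (qdl q) (fun k => gfac q (n + k))))).
    2:{ apply is_series_C_scal. apply is_series_C_plus; auto. apply is_series_C_scal; auto. }
    intros n. assert (T := rho_tail q n Hq). 
    assert (E : Cprod (phi q) n = Cprod (phid q) n * Cprod (fun k => 1 + qdl q * gfac q k) n).
    { rewrite <- Cprod_mult. apply Cprod_ext. intros; now apply gfac_spec. }
    rewrite E. transitivity (/ rho q * (Cprod (phid q) n * rho q)). rewrite <- T. ring. field. auto. }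
  assert (H1 : hyp4F3 (qa q) (qb q) (qc q) (qd q) (qe q) (qf q) (qg q) = F1).
  { rewrite Hg. apply hyp4F3_series; auto. }
  assert (H2 : hyp4F3 (1 + qa q - qe q) (1 + qb q - qe q) (1 + qc q - qe q) (1 + qd q - qe q)
      (1 + qf q - qe q) (1 + qg q - qe q) (2 - qe q) = / rho q * (F1 + qdl q * mishev_sum q)).
  { rewrite Hg.
    replace (1 + qa q - qe q) with (qa q + qdl q) by (unfold qdl; ring).
    replace (1 + qb q - qe q) with (qb q + qdl q) by (unfold qdl; ring).
    replace (1 + qc q - qe q) with (qc q + qdl q) by (unfold qdl; ring).
    replace (1 + qd q - qe q) with (qd q + qdl q) by (unfold qdl; ring).
    replace (1 + qf q - qe q) with (qf q + qdl q) by (unfold qdl; ring).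
    replace (1 + qg' q - qe q) with (qg' q + qdl q) by (unfold qdl; ring).
    replace (2 - qe q) with (1 + qdl q) by (unfold qdl; ring).
    apply hyp4F3_series; auto. apply is_series_C_ext with (2 := S3). intros n. apply Cprod_ext.
    intros k _. unfold phid. ring. }
  set (Z := / rho q * (F1 + qdl q * mishev_sum q)) in *.
  transitivity (F1 / (Csin (PI * qe q) * Gamma (qe q) * Gamma (qf q) * Gamma (qg' q)
     * (Gamma (qa q + qdl q) * Gamma (qb q + qdl q) * Gamma (qc q + qdl q) * Gamma (qd q + qdl q)))
    - Z / (Csin (PI * qe q) * Gamma (qa q) * Gamma (qb q) * Gamma (qc q) * Gamma (qd q)
       * Gamma (qf q + qdl q) * Gamma (qg' q + qdl q) * Gamma (1 + qdl q))).
  { rewrite <- H1, <- H2. rewrite <- Hg.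
    replace (qa q + qdl q) with (1 + qa q - qe q) by (unfold qdl; ring).
    replace (qb q + qdl q) with (1 + qb q - qe q) by (unfold qdl; ring).
    replace (qc q + qdl q) with (1 + qc q - qe q) by (unfold qdl; ring).
    replace (qd q + qdl q) with (1 + qd q - qe q) by (unfold qdl; ring).
    replace (qf q + qdl q) with (1 + qf q - qe q) by (unfold qdl; ring).
    replace (qg q + qdl q) with (1 + qg q - qe q) by (unfold qdl; ring).
    replace (1 + qdl q) with (2 - qe q) by (unfold qdl; ring).
    clear. destruct q as [[[[[[a b] c] d] e] f] g]. reflexivity. }
  unfold Z. unfold mishev_ext, rprod, sinq. destruct (Ceq_dec (qdl q) 0) as [E|_]; [contradiction|].
  replace (qe q) with (1 - qdl q) at 1 3 by (unfold qdl; ring).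
  set (S := Csin (PI * (1 - qdl q))) in *.
  assert (RG : forall z, (eta <= Re z)%R -> rGamma z = / Gamma z).
  { intros z Hz. rewrite Gamma_rGamma; auto. assert (N := rGamma_neq_0 z (Q z Hz)). field; auto. }
  rewrite !RG by auto.
  set (Y := Gamma (qa q) * Gamma (qb q) * Gamma (qc q) * Gamma (qd q) *
    (Gamma (qf q + qdl q) * Gamma (qg' q + qdl q) * Gamma (1 + qdl q))) in *.
  set (X := Gamma (qa q + qdl q) * Gamma (qb q + qdl q) * Gamma (qc q + qdl q) * Gamma (qd q + qdl q) *
    (Gamma (qe q) * Gamma (qf q) * Gamma (qg' q))) in *.
  assert (Y0 : Y <> 0) by (unfold Y; repeat apply Cmult_neq_0; auto).
  assert (X0 : X <> 0) by (unfold X; repeat apply Cmult_neq_0; auto).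
  transitivity (F1 / (S * X) - / rho q * (F1 + qdl q * mishev_sum q) / (S * Y)).
  { unfold X, Y. apply (f_equal2 Cminus); [apply (f_equal2 Cdiv); [reflexivity|ring]|apply (f_equal2 Cdiv); [reflexivity|ring]]. }
  transitivity (qdl q / S * / X * - mishev_sum q).
  { rewrite <- R. field. auto. }
  unfold X. field. repeat split; auto.
Qed.

Lemma nbhd_near q : near q -> nbhd near q.
Proof.
  intros Hq. unfold near in Hq. exists (mu / 16 - norm (minus q p))%R. split. lra.
  intros y Hy. unfold near. replace (minus y p) with (plus (minus y q) (minus q p)).
  eapply Rle_lt_trans; [apply norm_triangle|]. lra.
  unfold minus. rewrite <- plus_assoc. f_equal. rewrite plus_assoc, plus_opp_l. apply plus_zero_l.
Qed.

Lemma near_p : near p.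
Proof.
  unfold near. assert (N : norm (minus p p) = 0%R).
  { transitivity (norm (zero : C7N)). apply f_equal, (minus_eq_zero p). apply (@norm_zero C_AbsRing C7N). }
  rewrite N. lra.
Qed.

Lemma Cdiff_near f q : C2bdd near f -> near q -> Cdiff f q.
Proof. intros Hf Hq. apply Cdiff_C2bdd with near; auto. now apply nbhd_near. Qed.

Lemma qdl_near q : near q -> (Cmod (qdl q) <= 1 / 16)%R.
Proof.
  intros Hq. assert (H := near_coord qe q clinear_qe Hq). rewrite Hpe in H. unfold qdl.
  rewrite Cmod_minus_sym. lra.
Qed.

Lemma C2bdd_Cexp (w : C7N -> C) : C2bdd near w -> C2bdd near (fun q => Cexp (w q)).
Proof.
  intros (W & HW). eexists. apply C2norm_le_ext with (fun q => (Cexp (w q) - 1 - w q) + (1 + w q)).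
  intros; ring. apply C2norm_le_plus. apply C2norm_le_exp_taylor2; exact HW.
  apply C2norm_le_plus; [apply C2norm_le_const|exact HW].
Qed.

(** Where [qdl] vanishes the differential is zero by the quadratic estimate [sinq_near_0]; elsewhere
    the function is a quotient whose denominator is non-zero by [Csin_PI_bounds]. *)
Lemma Cdiff_sinq q : near q -> Cdiff (fun y => sinq (qdl y)) q.
Proof.
  intros Hq. destruct (Ceq_dec (qdl q) 0) as [E|E].
  - exists (fun _ => 0), 0%R. split. lra. split; [split; [|split]|].
    + intros; ring.
    + intros; ring.
    + intros. rewrite Cmod_0. lra.
    + intros eps He. destruct (nbhd_near q Hq) as (r & Hr & HN).
      exists (Rmin r (eps / 768)). split. apply Rmin_pos; auto. lra.
      intros y Hy. assert (Hy1 := Rlt_le_trans _ _ _ Hy (Rmin_l _ _)). assert (Hy2 := Rlt_le_trans _ _ _ Hy (Rmin_r _ _)).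
      rewrite E. replace (sinq (qdl y) - sinq 0 - 0) with (sinq (qdl y) - sinq 0) by ring.
      eapply Rle_trans; [apply sinq_near_0, qdl_near; auto|].
      assert (L : (Cmod (qdl y) <= norm (minus y q))%R).
      { replace (qdl y) with (- (qe y - qe q)). 
        rewrite Cmod_opp, <- (clinear_minus qe 1 q y clinear_qe). destruct clinear_qe as (_ & _ & H).
        eapply Rle_trans; [apply H|]. lra.
        assert (E2 : qe q = 1) by (unfold qdl in E; replace (qe q) with (1 - (1 - qe q)) by ring; rewrite E; ring).
        rewrite E2. unfold qdl. ring. }
      assert (P := Cmod_ge_0 (qdl y)). assert (PN := norm_ge_0 (minus y q)).
      assert (Cmod (qdl y) * Cmod (qdl y) <= norm (minus y q) * norm (minus y q))%R by (apply Rmult_le_compat; auto).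
      apply Rle_trans with ((768 * norm (minus y q)) * norm (minus y q))%R. lra.
      apply Rmult_le_compat_r; auto. lra.
  - assert (HS : C2bdd near (fun y => Csin (PI * (1 - qdl y)))).
    { unfold Csin. assert (HL : C2bdd near (fun y => Ci * (PI * (1 - qdl y)))).
      { apply C2bdd_mult. apply C2bdd_const. apply C2bdd_mult. apply C2bdd_const. apply C2bdd_minus. apply C2bdd_const. apply C2bdd_qdl. }
      unfold Cdiv. apply C2bdd_mult; [|apply C2bdd_const]. apply C2bdd_minus; apply C2bdd_Cexp; auto.
      now apply C2bdd_opp. }
    assert (S0 : Csin (PI * (1 - qdl q)) <> 0).
    { rewrite Csin_PI_sub. destruct (Csin_PI_bounds (qdl q)) as [S1 _]. now apply qdl_near.
      apply Cmod_gt_0. assert (S2 := proj1 (Cmod_gt_0 _) E). lra. }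
    apply Cdiff_ext with (fun y => qdl y * / Csin (PI * (1 - qdl y))).
    (* Within this radius [qdl] changes by at most half its modulus, so it stays non-zero and [sinq]
       takes its second branch. *)
    + destruct (Cdiff_lip qdl q (Cdiff_near _ q C2bdd_qdl Hq)) as (L & r & HL & Hr & B).
      assert (S2 := proj1 (Cmod_gt_0 _) E).
      exists (Rmin r (Cmod (qdl q) / (2 * L))). split. apply Rmin_pos; auto. apply Rdiv_lt_0_compat; lra.
      intros y Hy. assert (Hy1 := Rlt_le_trans _ _ _ Hy (Rmin_l _ _)). assert (Hy2 := Rlt_le_trans _ _ _ Hy (Rmin_r _ _)).
      unfold sinq. destruct (Ceq_dec (qdl y) 0) as [E2|E2]; [exfalso|reflexivity].
      specialize (B y Hy1). rewrite E2 in B. replace (0 - qdl q) with (- qdl q) in B by ring. rewrite Cmod_opp in B.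
      assert (L * norm (minus y q) <= L * (Cmod (qdl q) / (2 * L)))%R by (apply Rmult_le_compat_l; lra).
      replace (L * (Cmod (qdl q) / (2 * L)))%R with (Cmod (qdl q) / 2)%R in H by (field; lra). lra.
    + apply Cdiff_mult. apply Cdiff_near; auto. apply C2bdd_qdl. apply (Cdiff_inv (fun y => Csin (PI * (1 - qdl y)))); auto.
      apply Cdiff_near; auto.
Qed.

Lemma Cdiff_hM q : near q -> Cdiff mishev_ext q.
Proof.
  intros Hq. unfold mishev_ext. apply Cdiff_mult. apply Cdiff_mult. now apply Cdiff_sinq.
  - apply Cdiff_near; auto. unfold rprod.
    assert (Hd := C2bdd_qdl). assert (Hg := C2bdd_qg').
    assert (Ha := C2bdd_coord qa clinear_qa). assert (Hb := C2bdd_coord qb clinear_qb).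
    assert (Hc := C2bdd_coord qc clinear_qc). assert (Hd' := C2bdd_coord qd clinear_qd).
    assert (He := C2bdd_coord qe clinear_qe). assert (Hf := C2bdd_coord qf clinear_qf).
    apply C2bdd_mult; [apply C2bdd_mult; [apply C2bdd_mult|]|apply C2bdd_mult; [apply C2bdd_mult; [apply C2bdd_mult|]|]];
    apply rGamma_C2bdd; auto; now apply C2bdd_plus.
  - apply Cdiff_near; auto. apply C2bdd_opp. apply C2_hS.
Qed.

Lemma saalschutzian_qg' (q : C7N) : saalschutzian q <-> qg q = qg' q.
Proof.
  destruct q as [[[[[[a b] c] d] e] f] g]. unfold saalschutzian, qg', qa, qb, qc, qd, qe, qf, qg; simpl fst; simpl snd.
  split; intros H.
  - replace g with ((e + f + g - a - b - c - d) + a + b + c + d - e - f) by ring. rewrite H. ring.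
  - rewrite H. ring.
Qed.

Lemma hM_is_mishevL : is_mishevL p (mishev_ext p).
Proof.
  exists mishev_ext. split; [|split; [|reflexivity]].
  - apply (nbhd_locally (V := C7N)). destruct (nbhd_near p near_p) as (r & Hr & H).
    exists r; split; auto. intros q Hq Hs.
    apply (Cdiff_ex_filterdiff (V := C7N) saalschutzian mishev_ext q Hs). apply Cdiff_hM. apply H. exact Hq.
  - apply (nbhd_locally (V := C7N)). destruct (nbhd_near p near_p) as (r & Hr & H).
    exists r; split; auto. intros q Hq Hs Hg. symmetry. apply mishev_formula_near.
    apply H; exact Hq. now apply saalschutzian_qg'.
    intros E. assert (E2 : qe q = 1) by (unfold qdl in E; replace (qe q) with (1 - (1 - qe q)) by ring; rewrite E; ring).
    destruct q as [[[[[[a b] c] d] e] f] g]. destruct Hg as [Hi _]. apply Hi.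
    exists 1%Z. exact E2.
Qed.

End Near.

(** * Uniqueness of the continued value *)

Lemma minus_plus_cancel {V : NormedModule C_AbsRing} (x u : V) : minus (plus x u) x = u.
Proof.
  unfold minus. rewrite (plus_comm x u), <- plus_assoc.
  transitivity (plus u zero). apply f_equal, (plus_opp_r x). apply plus_zero_r.
Qed.

(** Gives an arbitrary continuation the same kind of estimate at [p] that [Cdiff_lip] gives
    [mishev_ext], so that the two can be compared. *)
Lemma differentiable_within_lip (D : C7N -> Prop) (h : C7N -> C) (p : C7N) :
  D p -> ex_filterdiff (V := C_NormedModule) h (within D (locally p)) ->
  exists L r, (0 < r)%R /\ forall y : C7N, (norm (minus y p) < r)%R -> D y ->
    (Cmod (h y - h p) <= L * norm (minus y p))%R.
Proof.
  intros HD (l & [_ _ (M & HM & Hl)] & H).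
  assert (L : is_filter_lim (within D (locally p)) p).
  { intros P HP. unfold within. generalize HP. apply filter_imp. auto. }
  specialize (H p L (mkposreal 1 Rlt_0_1)). unfold within in H.
  destruct (locally_nbhd (V := C7N) _ _ H) as (r & Hr & B).
  exists (1 + M)%R, r. split; auto. intros y Hy Dy. specialize (B y Hy Dy). cbv beta in B. simpl pos in B.
  specialize (Hl (minus y p)).
  match type of B with (norm ?x <= _)%R => change (norm x) with (Cmod (h y - h p - l (minus y p))) in B end.
  change (norm (l (minus y p))) with (Cmod (l (minus y p))) in Hl.
  replace (h y - h p) with ((h y - h p - l (minus y p)) + l (minus y p)) by ring.
  eapply Rle_trans; [apply Cmod_triangle|]. lra.
Qed.

(** Any continuation [h] agrees with [mishev_ext] at generic points of the hyperplane. On a line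
    through [p] inside the hyperplane these include all points with small parameter [t > 0], and
    both functions are Lipschitz at [p], so their values there differ by [O(t)] for every such
    [t]. *)
Lemma mishevL_eq (p : C7N) (mu : R) :
  (0 < mu <= 1)%R -> (mu <= Re (qa p))%R -> (mu <= Re (qb p))%R -> (mu <= Re (qc p))%R -> (mu <= Re (qd p))%R ->
  qe p = 1 -> (mu <= Re (qf p))%R -> (mu <= Re (qg' p))%R -> qg p = qg' p ->
  forall w, is_mishevL p w -> w = mishev_ext p.
Proof.
  intros Hmu Ha Hb Hc Hd He Hf Hg Hgg w (h & H1 & H2 & H3).
  assert (Sp : saalschutzian p) by now apply saalschutzian_qg'.
  assert (H1' := locally_nbhd (V := C7N) _ _ H1). destruct H1' as (r0 & Hr0 & H1').
  assert (N0 : norm (minus p p) = 0%R).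
  { transitivity (norm (zero : C7N)). apply f_equal, (minus_eq_zero p). apply (@norm_zero C_AbsRing C7N). }
  assert (H1p := H1' p ltac:(rewrite N0; exact Hr0) Sp).
  destruct (differentiable_within_lip saalschutzian h p Sp H1p) as (L1 & r1 & Hr1 & B1).
  assert (Np := near_p p mu Hmu).
  destruct (Cdiff_lip mishev_ext p (Cdiff_hM p mu Hmu Ha Hb Hc Hd He Hf Hg p Np)) as (L2 & r2 & HL2 & Hr2 & B2).
  destruct (locally_nbhd (V := C7N) _ _ H2) as (r3 & Hr3 & B3).
  destruct (nbhd_near p mu p Np) as (r4 & Hr4 & B4).
  (* Raising [e] and lowering [f] by the same amount keeps [e + f], hence the Saalschutzian
     relation, and makes [e = 1 + t] non-integral for [0 < t < 1]. *)
  pose (v := ((((((0:C, 0:C), 0:C), 0:C), 1:C), - (1):C), 0:C) : C7N).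
  pose (qt := fun t : R => plus p (scal (RtoC t : C_AbsRing) v) : C7N).
  set (n := norm v).
  assert (Hn : (0 <= n)%R) by apply norm_ge_0.
  assert (Hq : forall t, (0 <= t)%R -> (norm (minus (qt t) p) <= t * n)%R).
  { intros t Ht. replace (minus (qt t) p) with (scal (RtoC t : C_AbsRing) v).
    eapply Rle_trans; [apply (norm_scal (K := C_AbsRing) (V := C7N))|]. change (abs (RtoC t : C_AbsRing)) with (Cmod (RtoC t)).
    rewrite Cmod_R, Rabs_pos_eq; auto. apply Rle_refl.
    symmetry. apply (minus_plus_cancel (V := C7N)). }
  set (r := Rmin (Rmin r1 r2) (Rmin r3 r4)).
  assert (Hr : (0 < r)%R) by (repeat apply Rmin_pos; auto).
  assert (Hb1 : (r <= r1)%R) by (eapply Rle_trans; apply Rmin_l).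
  assert (Hb2 : (r <= r2)%R) by (eapply Rle_trans; [apply Rmin_l|apply Rmin_r]).
  assert (Hb3 : (r <= r3)%R) by (eapply Rle_trans; [apply Rmin_r|apply Rmin_l]).
  assert (Hb4 : (r <= r4)%R) by (eapply Rle_trans; apply Rmin_r).
  assert (K : forall t, (0 < t < 1)%R -> (t * n < r)%R -> (Cmod (h p - mishev_ext p) <= (Rabs L1 + L2) * (t * n))%R).
  { intros t Ht Htn. assert (Hqt := Hq t ltac:(lra)).
    assert (Hlt : (norm (minus (qt t) p) < r)%R) by lra.
    assert (Nq : near p mu (qt t)) by (apply B4; lra).
    assert (Cd : forall l : C7N -> C, clinear l 1 -> l (qt t) = l p + t * l v).
    { intros l (A1 & A2 & _). unfold qt. rewrite A1, A2. reflexivity. }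
    assert (Eg : qg (qt t) = qg' (qt t)).
    { unfold qg'. rewrite !Cd by first [apply clinear_qa|apply clinear_qb|apply clinear_qc|apply clinear_qd|apply clinear_qe|apply clinear_qf|apply clinear_qg].
      rewrite Hgg. unfold qg'. unfold v, qa, qb, qc, qd, qe, qf, qg; simpl fst; simpl snd. ring. }
    assert (Ee : qe (qt t) = 1 + t).
    { rewrite Cd by apply clinear_qe. rewrite He. unfold v, qe; simpl fst; simpl snd. ring. }
    assert (Sq : saalschutzian (qt t)) by now apply saalschutzian_qg'.
    assert (Gq : generic (qt t)).
    { assert (NB := near_bounds p mu Hmu Ha Hb Hc Hd He Hf Hg (qt t) Nq).
      assert (P := eta_range mu Hmu). 
      assert (Ni : ~ is_Cint (qe (qt t))).
      { rewrite Ee. intros [m Hm]. rewrite <- RtoC_plus in Hm. apply RtoC_inj in Hm.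
        assert (1 < m)%Z by (apply lt_IZR; lra). assert (m < 2)%Z by (apply lt_IZR; lra). lia. }
      assert (Np' : forall z, (eta mu <= Re z)%R -> ~ Gamma_pole z).
      { intros z Hz [m Hm]. rewrite Hm in Hz. rewrite Re_opp, Re_RtoC in Hz. generalize (pos_INR m). lra. }
      clearbody qt. destruct (qt t) as [[[[[[a b] c] d] e] f] g]. 
      unfold qdl in NB. rewrite <- Eg in NB. clear - NB Ni Np'. unfold qa, qb, qc, qd, qe, qf, qg in *; simpl fst in *; simpl snd in *.
      destruct NB as (C1 & C2 & C3 & C4 & C5 & C6 & C7 & C8 & C9 & C10 & C11 & C12 & C13 & C14).
      assert (E : forall x, x + (1 - e) = 1 + x - e) by (intros; ring). rewrite !E in *.
      unfold generic. repeat split; auto. }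
    assert (Eh : h (qt t) = mishev_ext (qt t)).
    { rewrite (B3 (qt t) ltac:(lra) Sq Gq). apply (mishev_formula_near p mu); auto.
      unfold qdl. rewrite Ee. replace (1 - (1 + t)) with (RtoC (- t)) by (rewrite RtoC_opp; ring). apply RtoC_neq. lra. }
    assert (T1 := B1 (qt t) ltac:(lra) Sq). assert (T2 := B2 (qt t) ltac:(lra)).
    replace (h p - mishev_ext p) with (- (h (qt t) - h p) + (mishev_ext (qt t) - mishev_ext p)) by (rewrite Eh; ring).
    eapply Rle_trans; [apply Cmod_triangle|]. rewrite Cmod_opp.
    assert (PN := norm_ge_0 (minus (qt t) p)).
    assert (L1 * norm (minus (qt t) p) <= Rabs L1 * (t * n))%R.
    { apply Rle_trans with (Rabs L1 * norm (minus (qt t) p))%R. apply Rmult_le_compat_r; auto. apply Rle_abs.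
      apply Rmult_le_compat_l; auto. apply Rabs_pos. }
    assert (L2 * norm (minus (qt t) p) <= L2 * (t * n))%R by (apply Rmult_le_compat_l; lra).
    lra. }
  rewrite <- H3. destruct (Ceq_dec (h p) (mishev_ext p)) as [E|E]; auto. exfalso.
  assert (PC : (0 < Cmod (h p - mishev_ext p))%R).
  { apply Cmod_gt_0. now apply Cminus_eq_contra. }
  set (c := Cmod (h p - mishev_ext p)) in *.
  set (A := ((Rabs L1 + Rabs L2 + 1) * (n + 1))%R).
  assert (P1 := Rabs_pos L1). assert (P2 := Rabs_pos L2).
  assert (HA : (0 < A)%R) by (unfold A; apply Rmult_lt_0_compat; lra).
  (* Small enough to stay in the common neighbourhood and to push the estimate [K] down to [c / 2],
     which contradicts [0 < c]. *)
  set (t := Rmin (1 / 2) (Rmin (r / (2 * (n + 1))) (c / (2 * A)))).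
  assert (Ht0 : (0 < t)%R).
  { unfold t. repeat apply Rmin_pos. lra. apply Rdiv_lt_0_compat; lra. apply Rdiv_lt_0_compat; lra. }
  assert (Ht1 : (t <= 1 / 2)%R) by apply Rmin_l.
  assert (Ht2 : (t <= r / (2 * (n + 1)))%R) by (eapply Rle_trans; [apply Rmin_r|apply Rmin_l]).
  assert (Ht3 : (t <= c / (2 * A))%R) by (eapply Rle_trans; [apply Rmin_r|apply Rmin_r]).
  assert (X1 : (t * (n + 1) <= r / 2)%R).
  { apply Rle_trans with (r / (2 * (n + 1)) * (n + 1))%R. apply Rmult_le_compat_r; lra. right. field. lra. }
  assert (X2 : (t * A <= c / 2)%R).
  { apply Rle_trans with (c / (2 * A) * A)%R. apply Rmult_le_compat_r; lra. right. field. lra. }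
  assert (X3 : (t * n <= t * (n + 1))%R) by (apply Rmult_le_compat_l; lra).
  assert (X4 : (0 <= t * n)%R) by (apply Rmult_le_pos; lra).
  assert (X5 : ((Rabs L1 + L2) * (t * n) <= t * A)%R).
  { unfold A. replace (t * ((Rabs L1 + Rabs L2 + 1) * (n + 1)))%R with ((Rabs L1 + Rabs L2 + 1) * (t * (n + 1)))%R by ring.
    assert (L2 <= Rabs L2)%R by apply Rle_abs.
    apply Rmult_le_compat; lra. }
  assert (X6 := K t ltac:(lra) ltac:(lra)). lra.
Qed.

Lemma mishevL_value (p : C7N) (mu : R) :
  (0 < mu <= 1)%R -> (mu <= Re (qa p))%R -> (mu <= Re (qb p))%R -> (mu <= Re (qc p))%R -> (mu <= Re (qd p))%R ->
  qe p = 1 -> (mu <= Re (qf p))%R -> (mu <= Re (qg' p))%R -> qg p = qg' p ->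
  mishevL (qa p) (qb p) (qc p) (qd p) (qe p) (qf p) (qg p) = mishev_ext p.
Proof.
  intros Hmu Ha Hb Hc Hd He Hf Hg Hgg. unfold mishevL.
  assert (E : ((qa p, qb p, qc p, qd p, qe p, qf p, qg p) : C7) = p).
  { destruct p as [[[[[[a b] c] d] e] f] g]. reflexivity. }
  rewrite E. apply Cthe_unique.
  - intros w. apply (mishevL_eq p mu); auto.
  - apply (hM_is_mishevL p mu); auto.
Qed.

(** * The complementary integrals near the origin *)

Section EllipticReal.
Local Open Scope R_scope.

(** The radicand [1 - (1 - x ^ 2) * sin t ^ 2] for the complementary modulus, rewritten so that
    positivity for [x > 0] is visible. *)
Definition Dl (x t : R) : R := cos t ^ 2 + x ^ 2 * sin t ^ 2.
Definition kf (x : R) : R := RInt (fun t => / sqrt (Dl x t)) 0 (PI / 2).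
Definition ef (x : R) : R := RInt (fun t => sqrt (Dl x t)) 0 (PI / 2).

Lemma cos2_sin2 t : cos t ^ 2 = 1 - sin t ^ 2.
Proof. generalize (sin2_cos2 t). unfold Rsqr. simpl. lra. Qed.

Lemma ellK'_kf x : 0 <= x <= 1 -> ellK' x = kf x.
Proof.
  intros Hx. unfold ellK', ellK, kf. apply RInt_ext. intros t _.
  rewrite pow2_sqrt by nra. unfold Dl. rewrite cos2_sin2. f_equal. f_equal. ring.
Qed.

Lemma ellE'_ef x : 0 <= x <= 1 -> ellE' x = ef x.
Proof.
  intros Hx. unfold ellE', ellE, ef. apply RInt_ext. intros t _.
  rewrite pow2_sqrt by nra. unfold Dl. rewrite cos2_sin2. f_equal. ring.
Qed.

Lemma Dl_pos x t : 0 < x -> 0 < Dl x t.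
Proof.
  intros Hx. unfold Dl. assert (E := cos2_sin2 t). assert (0 < x ^ 2) by nra.
  assert (0 <= sin t ^ 2) by apply pow2_ge_0. assert (0 <= cos t ^ 2) by apply pow2_ge_0.
  destruct (Req_dec (sin t) 0) as [Z|Z]. rewrite Z in *. lra.
  assert (0 < sin t ^ 2) by nra. nra.
Qed.

Lemma Dl_sqrt_pos x t : 0 < x -> 0 < sqrt (Dl x t).
Proof. intros Hx. apply sqrt_lt_R0, Dl_pos; auto. Qed.

Lemma Dl_sqrt_sqr x t : 0 < x -> sqrt (Dl x t) * sqrt (Dl x t) = Dl x t.
Proof. intros Hx. apply sqrt_sqrt. left; now apply Dl_pos. Qed.

Lemma sqrt_le_of_sqr a b : 0 <= b -> a <= b * b -> sqrt a <= b.
Proof. intros Hb H. rewrite <- (sqrt_square b) by auto. now apply sqrt_le_1_alt. Qed.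

Lemma le_sqrt_of_sqr a b : 0 <= a -> a * a <= b -> a <= sqrt b.
Proof. intros Ha H. rewrite <- (sqrt_square a) by auto. now apply sqrt_le_1_alt. Qed.

Lemma Dl_lower x t : 0 < x <= 1 -> x <= sqrt (Dl x t).
Proof.
  intros Hx. apply le_sqrt_of_sqr. lra. unfold Dl. rewrite cos2_sin2. assert (0 <= sin t ^ 2 <= 1).
  { split. apply pow2_ge_0. assert (B := SIN_bound t). nra. }
  assert (0 <= (1 - sin t ^ 2) * (1 - x ^ 2)) by (apply Rmult_le_pos; nra). lra.
Qed.

Lemma Dl_upper x t : 0 < x <= 1 -> sqrt (Dl x t) <= 1.
Proof.
  intros Hx. rewrite <- sqrt_1. apply sqrt_le_1_alt. unfold Dl.
  rewrite cos2_sin2. assert (0 <= sin t ^ 2) by apply pow2_ge_0.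
  assert (0 <= sin t ^ 2 * (1 - x ^ 2)) by (apply Rmult_le_pos; nra). lra.
Qed.

Lemma ex_derive_sqrt_Dl_t x t : 0 < x -> ex_derive (fun t => sqrt (Dl x t)) t.
Proof. intros Hx. assert (P := Dl_pos x t Hx). unfold Dl in *. auto_derive. simpl in *. lra. Qed.

Lemma ex_RInt_ef x : 0 < x -> ex_RInt (fun t => sqrt (Dl x t)) 0 (PI / 2).
Proof.
  intros Hx. apply (ex_RInt_continuous (V := R_CompleteNormedModule)). intros t _.
  apply (ex_derive_continuous (V := R_NormedModule)). now apply ex_derive_sqrt_Dl_t.
Qed.

Lemma ex_RInt_kf x : 0 < x -> ex_RInt (fun t => / sqrt (Dl x t)) 0 (PI / 2).
Proof.
  intros Hx. apply (ex_RInt_continuous (V := R_CompleteNormedModule)). intros t _.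
  apply (ex_derive_continuous (V := R_NormedModule)). apply ex_derive_inv. now apply ex_derive_sqrt_Dl_t.
  generalize (Dl_sqrt_pos x t Hx); lra.
Qed.

Lemma is_RInt_ef x : 0 < x -> is_RInt (fun t => sqrt (Dl x t)) 0 (PI / 2) (ef x).
Proof. intros Hx. apply (RInt_correct (V := R_CompleteNormedModule)). now apply ex_RInt_ef. Qed.

Lemma is_RInt_kf x : 0 < x -> is_RInt (fun t => / sqrt (Dl x t)) 0 (PI / 2) (kf x).
Proof. intros Hx. apply (RInt_correct (V := R_CompleteNormedModule)). now apply ex_RInt_kf. Qed.

(** * Derivatives of the complementary integrals *)

Lemma continuity_2d_Dl x t : continuity_2d_pt Dl x t.
Proof.
  unfold Dl. apply continuity_2d_pt_plus.
  - apply (continuity_1d_2d_pt_comp (fun y => cos y ^ 2) (fun u v => v)).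
    apply derivable_continuous_pt. reg. apply continuity_2d_pt_id2.
  - apply continuity_2d_pt_mult.
    apply (continuity_1d_2d_pt_comp (fun y => y ^ 2) (fun u v => u)).
    apply derivable_continuous_pt. reg. apply continuity_2d_pt_id1.
    apply (continuity_1d_2d_pt_comp (fun y => sin y ^ 2) (fun u v => v)).
    apply derivable_continuous_pt. reg. apply continuity_2d_pt_id2.
Qed.

Lemma continuity_2d_sqrt_Dl x t : 0 < x -> continuity_2d_pt (fun u v => sqrt (Dl u v)) x t.
Proof.
  intros Hx. apply (continuity_1d_2d_pt_comp sqrt Dl). apply continuity_pt_sqrt. left. now apply Dl_pos.
  apply continuity_2d_Dl.
Qed.

Lemma continuity_2d_sin2 x t : continuity_2d_pt (fun u v => sin v ^ 2) x t.
Proof.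
  apply (continuity_1d_2d_pt_comp (fun y => sin y ^ 2) (fun u v => v)).
  apply derivable_continuous_pt. reg. apply continuity_2d_pt_id2.
Qed.

Lemma is_derive_sqrt_Dl_x x t : 0 < x ->
  is_derive (fun u => sqrt (Dl u t)) x (x * sin t ^ 2 / sqrt (Dl x t)).
Proof.
  intros Hx. assert (P := Dl_pos x t Hx). assert (Q := Dl_sqrt_pos x t Hx).
  unfold Dl in *. auto_derive. simpl in *. lra.
  replace (cos t * (cos t * 1) + x * (x * 1) * (sin t * (sin t * 1))) with (cos t ^ 2 + x ^ 2 * sin t ^ 2) by ring.
  field. lra.
Qed.

Lemma is_derive_inv_sqrt_Dl_x x t : 0 < x ->
  is_derive (fun u => / sqrt (Dl u t)) x (- (x * sin t ^ 2) / sqrt (Dl x t) ^ 3).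
Proof.
  intros Hx. assert (Q := Dl_sqrt_pos x t Hx).
  evar_last. apply is_derive_inv. now apply is_derive_sqrt_Dl_x. lra. cbv beta. field. lra.
Qed.

Lemma locally_pos_2d x t (P : R -> R -> Prop) : 0 < x -> (forall u v, 0 < u -> P u v) ->
  locally_2d P x t.
Proof.
  intros Hx H. exists (mkposreal x Hx). intros u v Hu _. simpl in Hu. apply H.
  unfold Rabs in Hu. destruct (Rcase_abs (u - x)); lra.
Qed.

Lemma locally_pos x (P : R -> Prop) : 0 < x -> (forall u, 0 < u -> P u) -> locally x P.
Proof.
  intros Hx H. exists (mkposreal x Hx). intros u Hu. unfold ball in Hu; simpl in Hu. unfold AbsRing_ball, abs, minus, plus, opp in Hu; simpl in Hu.
  apply H. unfold Rabs in Hu. destruct (Rcase_abs (u + - x)); lra.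
Qed.

Lemma is_derive_ef_param x : 0 < x ->
  is_derive ef x (RInt (fun t => x * sin t ^ 2 / sqrt (Dl x t)) 0 (PI / 2)).
Proof.
  intros Hx.
  replace (RInt (fun t => x * sin t ^ 2 / sqrt (Dl x t)) 0 (PI / 2)) with
    (RInt (fun t => Derive (fun u => sqrt (Dl u t)) x) 0 (PI / 2)).
  2:{ apply RInt_ext. intros t _. apply is_derive_unique. now apply is_derive_sqrt_Dl_x. }
  apply (is_derive_RInt_param (fun u t => sqrt (Dl u t))).
  - apply locally_pos; auto. intros u Hu t _. eexists. now apply is_derive_sqrt_Dl_x.
  - intros t _. apply (continuity_2d_pt_ext_loc (fun u v => u * sin v ^ 2 * / sqrt (Dl u v))).
    + apply locally_pos_2d; auto. intros u v Hu. symmetry. apply is_derive_unique. now apply is_derive_sqrt_Dl_x.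
    + apply continuity_2d_pt_mult. apply continuity_2d_pt_mult. apply continuity_2d_pt_id1. apply continuity_2d_sin2.
      apply continuity_2d_pt_inv. now apply continuity_2d_sqrt_Dl. generalize (Dl_sqrt_pos x t Hx); lra.
  - apply locally_pos; auto. intros u Hu. now apply ex_RInt_ef.
Qed.

Lemma is_derive_kf_param x : 0 < x ->
  is_derive kf x (RInt (fun t => - (x * sin t ^ 2) / sqrt (Dl x t) ^ 3) 0 (PI / 2)).
Proof.
  intros Hx.
  replace (RInt (fun t => - (x * sin t ^ 2) / sqrt (Dl x t) ^ 3) 0 (PI / 2)) with
    (RInt (fun t => Derive (fun u => / sqrt (Dl u t)) x) 0 (PI / 2)).
  2:{ apply RInt_ext. intros t _. apply is_derive_unique. now apply is_derive_inv_sqrt_Dl_x. }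
  apply (is_derive_RInt_param (fun u t => / sqrt (Dl u t))).
  - apply locally_pos; auto. intros u Hu t _. eexists. now apply is_derive_inv_sqrt_Dl_x.
  - intros t _. apply (continuity_2d_pt_ext_loc (fun u v => - (u * sin v ^ 2) * / (sqrt (Dl u v) * (sqrt (Dl u v) * sqrt (Dl u v))))).
    + apply locally_pos_2d; auto. intros u v Hu. symmetry. 
      replace (- (u * sin v ^ 2) * / (sqrt (Dl u v) * (sqrt (Dl u v) * sqrt (Dl u v)))) with (- (u * sin v ^ 2) / sqrt (Dl u v) ^ 3).
      apply is_derive_unique. now apply is_derive_inv_sqrt_Dl_x.
      unfold Rdiv. f_equal. f_equal. ring.
    + assert (S := continuity_2d_sqrt_Dl x t Hx).
      apply continuity_2d_pt_mult. apply continuity_2d_pt_opp. apply continuity_2d_pt_mult. apply continuity_2d_pt_id1. apply continuity_2d_sin2.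
      apply (continuity_2d_pt_inv (fun u v => sqrt (Dl u v) * (sqrt (Dl u v) * sqrt (Dl u v)))).
      apply continuity_2d_pt_mult; auto. apply continuity_2d_pt_mult; auto.
      assert (Q := Dl_sqrt_pos x t Hx). assert (0 < sqrt (Dl x t) * sqrt (Dl x t)) by nra. nra.
  - apply locally_pos; auto. intros u Hu. now apply ex_RInt_kf.
Qed.

(** Since [(1 - x ^ 2) * sin t ^ 2 = 1 - Dl x t], the differentiated integrand is a combination of
    [/ sqrt (Dl x t)] and [sqrt (Dl x t)]. *)
Lemma is_derive_ef x : 0 < x < 1 -> is_derive ef x (x * (kf x - ef x) / (1 - x ^ 2)).
Proof.
  intros Hx. replace (x * (kf x - ef x) / (1 - x ^ 2)) with (RInt (fun t => x * sin t ^ 2 / sqrt (Dl x t)) 0 (PI / 2)).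
  apply is_derive_ef_param; lra.
  apply (is_RInt_unique (V := R_CompleteNormedModule)).
  apply (is_RInt_ext (V := R_NormedModule)) with (fun t => scal (x / (1 - x ^ 2)) (minus (/ sqrt (Dl x t)) (sqrt (Dl x t)))).
  - intros t _. unfold scal, minus, plus, opp; simpl. unfold mult; simpl.
    assert (Q := Dl_sqrt_pos x t ltac:(lra)). assert (Q2 := Dl_sqrt_sqr x t ltac:(lra)).
    set (r := sqrt (Dl x t)) in *. unfold Dl in Q2. rewrite cos2_sin2 in Q2.
    assert (0 < 1 - x ^ 2) by nra.
    apply Rmult_eq_reg_r with (r * (1 - x ^ 2)). 2:apply Rgt_not_eq; now apply Rmult_lt_0_compat.
    transitivity (x * (1 - r * r)). field. simpl in *; lra. rewrite Q2. field. lra.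
  - replace (x * (kf x - ef x) / (1 - x ^ 2)) with (scal (x / (1 - x ^ 2)) (minus (kf x) (ef x))).
    2:{ unfold scal, minus, plus, opp; simpl. unfold mult; simpl. field. nra. }
    apply (is_RInt_scal (V := R_NormedModule)). apply (is_RInt_minus (V := R_NormedModule)).
    apply is_RInt_kf; lra. apply is_RInt_ef; lra.
Qed.

(** The integrand of [x ^ 2 K' - E' - x (1 - x ^ 2) dK'/dx] is an exact derivative. *)
Lemma is_RInt_exact x : 0 < x < 1 ->
  is_RInt (fun t => (cos t ^ 4 - x ^ 2 * sin t ^ 4) / sqrt (Dl x t) ^ 3) 0 (PI / 2) 0.
Proof.
  intros Hx.
  replace 0 with (minus (sin (PI / 2) * cos (PI / 2) / sqrt (Dl x (PI / 2))) (sin 0 * cos 0 / sqrt (Dl x 0))) at 2.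
  2:{ rewrite cos_PI2, sin_0. unfold minus, plus, opp, Rdiv; simpl. ring. }
  apply (is_RInt_derive (V := R_CompleteNormedModule) (fun t => sin t * cos t / sqrt (Dl x t))).
  - intros t _. assert (P := Dl_pos x t ltac:(lra)). assert (Q := Dl_sqrt_pos x t ltac:(lra)). assert (Q2 := Dl_sqrt_sqr x t ltac:(lra)).
    unfold Dl in *. auto_derive.
    split. simpl in *; lra. split; auto. simpl in *; lra.
    replace (cos t * (cos t * 1) + x * (x * 1) * (sin t * (sin t * 1))) with (cos t ^ 2 + x ^ 2 * sin t ^ 2) by ring.
    set (r := sqrt (cos t ^ 2 + x ^ 2 * sin t ^ 2)) in *.
    apply Rmult_eq_reg_r with (r ^ 3). 2:{ apply pow_nonzero. lra. }
    unfold Rdiv. rewrite (Rmult_assoc _ (/ r ^ 3)), Rinv_l, Rmult_1_r by (apply pow_nonzero; lra).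
    transitivity ((cos t ^ 2 - sin t ^ 2) * (r * r) + (1 - x ^ 2) * sin t ^ 2 * cos t ^ 2).
    field. lra. rewrite Q2. ring.
  - intros t _. apply (ex_derive_continuous (V := R_NormedModule)). assert (P := Dl_pos x t ltac:(lra)). assert (Q := Dl_sqrt_pos x t ltac:(lra)).
    apply ex_derive_div. auto_derive; auto. apply ex_derive_pow. apply ex_derive_sqrt_Dl_t; lra. apply pow_nonzero; lra.
Qed.

Lemma is_derive_kf x : 0 < x < 1 -> is_derive kf x ((x ^ 2 * kf x - ef x) / (x * (1 - x ^ 2))).
Proof.
  intros Hx. replace ((x ^ 2 * kf x - ef x) / (x * (1 - x ^ 2))) with
   (RInt (fun t => - (x * sin t ^ 2) / sqrt (Dl x t) ^ 3) 0 (PI / 2)).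
  apply is_derive_kf_param; lra.
  assert (Hx2 : 0 < 1 - x ^ 2) by nra.
  apply (is_RInt_unique (V := R_CompleteNormedModule)).
  (* The power [-3] of the root is reduced by adding [1 - x ^ 2] times the exact derivative of
     [is_RInt_exact], whose integral is zero. *)
  apply (is_RInt_ext (V := R_NormedModule)) with (fun t => scal (/ (x * (1 - x ^ 2)))
    (plus (minus (scal (x ^ 2) (/ sqrt (Dl x t))) (sqrt (Dl x t))) (scal (1 - x ^ 2) ((cos t ^ 4 - x ^ 2 * sin t ^ 4) / sqrt (Dl x t) ^ 3)))).
  - intros t _. unfold scal, minus, plus, opp; simpl. unfold mult; simpl.
    assert (Q := Dl_sqrt_pos x t ltac:(lra)). assert (Q2 := Dl_sqrt_sqr x t ltac:(lra)).
    set (r := sqrt (Dl x t)) in *. unfold Dl in Q2. assert (E := cos2_sin2 t).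
    set (c := cos t) in *. set (s := sin t) in *. 
    apply Rmult_eq_reg_r with (r ^ 3 * (x * (1 - x ^ 2))). 2:{ apply Rgt_not_eq. apply Rmult_lt_0_compat. apply pow_lt; auto. nra. }
    transitivity (x ^ 2 * (r * r) - (r * r) * (r * r) + (1 - x ^ 2) * (c ^ 4 - x ^ 2 * s ^ 4)).
    field. simpl in *. repeat split; lra.
    transitivity (- (x * s ^ 2) * (x * (1 - x ^ 2))). rewrite Q2. replace (c ^ 4) with (c ^ 2 * c ^ 2) by ring. rewrite E. ring.
    field. lra.
  - replace ((x ^ 2 * kf x - ef x) / (x * (1 - x ^ 2))) with (scal (/ (x * (1 - x ^ 2))) (plus (minus (scal (x ^ 2) (kf x)) (ef x)) (scal (1 - x ^ 2) 0))).
    2:{ unfold scal, minus, plus, opp; simpl. unfold mult; simpl. field. simpl in *. split; lra. }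
    apply (is_RInt_scal (V := R_NormedModule)). apply (is_RInt_plus (V := R_NormedModule)).
    apply (is_RInt_minus (V := R_NormedModule)). apply (is_RInt_scal (V := R_NormedModule)).
    apply is_RInt_kf; lra. apply is_RInt_ef; lra.
    apply (is_RInt_scal (V := R_NormedModule)). now apply is_RInt_exact.
Qed.

(** * Bounds and behaviour at the origin *)

Lemma PI2_pos : 0 < PI / 2.
Proof. generalize PI_RGT_0; lra. Qed.

Lemma is_RInt_cst (c : R) : is_RInt (fun _ => c) 0 (PI / 2) (PI / 2 * c).
Proof.
  replace (PI / 2 * c) with (scal (PI / 2 - 0) c). apply (is_RInt_const (V := R_NormedModule)).
  unfold scal; simpl. unfold mult; simpl. ring.
Qed.

Lemma ef_bounds x : 0 < x <= 1 -> PI / 2 * x <= ef x <= PI / 2.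
Proof.
  intros Hx. assert (P := PI2_pos). split.
  - apply (is_RInt_le (fun _ => x) (fun t => sqrt (Dl x t)) 0 (PI / 2)). lra. apply is_RInt_cst. apply is_RInt_ef; lra.
    intros. apply Dl_lower; auto.
  - rewrite <- (Rmult_1_r (PI / 2)). apply (is_RInt_le (fun t => sqrt (Dl x t)) (fun _ => 1) 0 (PI / 2)). lra. apply is_RInt_ef; lra. apply is_RInt_cst. 
    intros. apply Dl_upper; auto.
Qed.

Lemma kf_bounds x : 0 < x <= 1 -> PI / 2 <= kf x <= PI / 2 * / x.
Proof.
  intros Hx. assert (P := PI2_pos). split.
  - rewrite <- (Rmult_1_r (PI / 2)) at 1. apply (is_RInt_le (fun _ => 1) (fun t => / sqrt (Dl x t)) 0 (PI / 2)). lra. apply is_RInt_cst. apply is_RInt_kf; lra.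
    intros. rewrite <- Rinv_1. apply Rinv_le_contravar. apply Dl_sqrt_pos; lra. apply Dl_upper; auto.
  - apply (is_RInt_le (fun t => / sqrt (Dl x t)) (fun _ => / x) 0 (PI / 2)). lra. apply is_RInt_kf; lra. apply is_RInt_cst. 
    intros. apply Rinv_le_contravar. lra. apply Dl_lower; auto.
Qed.

Lemma cos_sin_range t : 0 < t < PI / 2 -> 0 < cos t <= 1 /\ 0 < sin t <= 1.
Proof.
  intros Ht. split; split. apply cos_gt_0; lra. apply COS_bound. apply sin_gt_0; lra. apply SIN_bound.
Qed.

(** The root lies between [cos t] and [cos t + x * sin t], whose integrals are [1] and [1 + x]. *)
Lemma ef_near_0 x : 0 < x <= 1 -> 1 <= ef x <= 1 + x.
Proof.
  intros Hx. assert (P := PI2_pos). split.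
  - apply (is_RInt_le cos (fun t => sqrt (Dl x t)) 0 (PI / 2)). lra. 2:apply is_RInt_ef; lra.
    replace 1 with (minus (sin (PI / 2)) (sin 0)) by (rewrite sin_PI2, sin_0; unfold minus, plus, opp; simpl; ring).
    apply (is_RInt_derive (V := R_CompleteNormedModule)). intros. auto_derive; auto; ring.
    intros. apply (ex_derive_continuous (V := R_NormedModule)). auto_derive; auto.
    intros t Ht. destruct (cos_sin_range t Ht) as [[C0 C1] [S0 S1]].
    apply le_sqrt_of_sqr. lra. unfold Dl. assert (0 <= x ^ 2 * sin t ^ 2) by (apply Rmult_le_pos; apply pow2_ge_0).
    lra.
  - apply (is_RInt_le (fun t => sqrt (Dl x t)) (fun t => cos t + x * sin t) 0 (PI / 2)). lra. apply is_RInt_ef; lra.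
    replace (1 + x) with (minus (sin (PI / 2) - x * cos (PI / 2)) (sin 0 - x * cos 0)) by (rewrite sin_PI2, sin_0, cos_PI2, cos_0; unfold minus, plus, opp; simpl; ring).
    apply (is_RInt_derive (V := R_CompleteNormedModule) (fun t => sin t - x * cos t)). intros. auto_derive; auto; ring.
    intros. apply (ex_derive_continuous (V := R_NormedModule)). auto_derive; auto.
    intros t Ht. destruct (cos_sin_range t Ht) as [[C0 C1] [S0 S1]].
    assert (0 <= x * sin t) by (apply Rmult_le_pos; lra). assert (0 <= (x * sin t) * cos t) by (apply Rmult_le_pos; lra).
    apply sqrt_le_of_sqr. lra. unfold Dl. lra.
Qed.

(** The integrand of [kf] is split by [1 = sin t + (1 - sin t)]. The first part carries the
    logarithmic singularity and has the elementary primitive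
    [- ln (k * cos t + sqrt (Dl x t)) / k]. *)
Lemma kf_log_part x : 0 < x < 1 ->
  is_RInt (fun t => sin t / sqrt (Dl x t)) 0 (PI / 2) ((ln (1 + sqrt (1 - x ^ 2)) - ln x) / sqrt (1 - x ^ 2)).
Proof.
  intros Hx. set (k := sqrt (1 - x ^ 2)).
  assert (Hk : 0 < k) by (apply sqrt_lt_R0; nra).
  assert (Hk2 : k * k = 1 - x ^ 2) by (apply sqrt_sqrt; nra).
  clearbody k.
  set (G := fun t => - / k * ln (k * cos t + sqrt (Dl x t))).
  replace ((ln (1 + k) - ln x) / k) with (minus (G (PI / 2)) (G 0)).
  2:{ unfold G, Dl. rewrite cos_PI2, sin_PI2, cos_0, sin_0.
      replace (0 ^ 2 + x ^ 2 * 1 ^ 2) with (x ^ 2) by ring. rewrite sqrt_pow2 by lra.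
      replace (1 ^ 2 + x ^ 2 * 0 ^ 2) with 1 by ring. rewrite sqrt_1.
      replace (k * 0 + x) with x by ring. replace (k * 1 + 1) with (1 + k) by ring.
      unfold minus, plus, opp; simpl. field. lra. }
  assert (PI0 := PI2_pos).
  assert (HH : forall t, 0 <= t <= PI / 2 -> 0 < k * cos t + sqrt (Dl x t)).
  { intros t Ht. assert (0 <= cos t) by (apply cos_ge_0; lra). assert (Q := Dl_sqrt_pos x t ltac:(lra)).
    assert (0 <= k * cos t) by (apply Rmult_le_pos; lra). lra. }
  apply (is_RInt_derive (V := R_CompleteNormedModule) G).
  - intros t Ht. rewrite Rmin_left, Rmax_right in Ht by lra. specialize (HH t Ht).
    assert (P := Dl_pos x t ltac:(lra)). assert (Q := Dl_sqrt_pos x t ltac:(lra)).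
    unfold G, Dl in *.
    auto_derive; replace (cos t * (cos t * 1) + x * (x * 1) * (sin t * (sin t * 1))) with (cos t ^ 2 + x ^ 2 * sin t ^ 2) by ring.
    repeat split; auto.
    set (r := sqrt (cos t ^ 2 + x ^ 2 * sin t ^ 2)) in *.
    apply Rmult_eq_reg_r with (k * r * (k * cos t + r)). 2:{ apply Rgt_not_eq. apply Rmult_lt_0_compat; auto. now apply Rmult_lt_0_compat. }
    transitivity (sin t * (k * r + (1 - x ^ 2) * cos t)). field. lra.
    rewrite <- Hk2. field. lra.
  - intros t _. apply (ex_derive_continuous (V := R_NormedModule)). assert (Q := Dl_sqrt_pos x t ltac:(lra)).
    apply ex_derive_div. auto_derive; auto. apply ex_derive_sqrt_Dl_t; lra. lra.
Qed.

(** At [x = 0] the integrand becomes [(1 - sin t) / cos t = cos t / (1 + sin t)], with integral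
    [ln 2]; for [x > 0] it is smaller by at most [x] at each point. *)
Lemma kf_rest_part x l : 0 < x < 1 ->
  is_RInt (fun t => (1 - sin t) / sqrt (Dl x t)) 0 (PI / 2) l -> ln 2 - x * (PI / 2) <= l <= ln 2.
Proof.
  intros Hx Hl. assert (PI0 := PI2_pos).
  assert (HL : is_RInt (fun t => cos t / (1 + sin t)) 0 (PI / 2) (ln 2)).
  { replace (ln 2) with (minus (ln (1 + sin (PI / 2))) (ln (1 + sin 0))).
    2:{ rewrite sin_PI2, sin_0, Rplus_0_r, ln_1. replace (1 + 1) with 2 by ring. unfold minus, plus, opp; simpl; ring. }
    assert (S : forall t, Rmin 0 (PI / 2) <= t <= Rmax 0 (PI / 2) -> 0 <= sin t).
    { intros t Ht. rewrite Rmin_left, Rmax_right in Ht by lra. apply sin_ge_0; lra. }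
    apply (is_RInt_derive (V := R_CompleteNormedModule) (fun t => ln (1 + sin t))).
    intros t Ht. specialize (S t Ht). auto_derive. lra. field. lra.
    intros t Ht. specialize (S t Ht). apply (ex_derive_continuous (V := R_NormedModule)). auto_derive. lra. }
  split.
  - replace (ln 2 - x * (PI / 2)) with (minus (ln 2) (PI / 2 * x)) by (unfold minus, plus, opp; simpl; ring).
    apply (is_RInt_le (fun t => minus (cos t / (1 + sin t)) x) (fun t => (1 - sin t) / sqrt (Dl x t)) 0 (PI / 2)); auto. lra.
    apply (is_RInt_minus (V := R_NormedModule)); auto. apply is_RInt_cst.
    intros t Ht. destruct (cos_sin_range t Ht) as [[C0 C1] [S0 S1]]. assert (E := cos2_sin2 t).
    assert (Q := Dl_sqrt_pos x t ltac:(lra)).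
    assert (B : sqrt (Dl x t) <= cos t + x). { apply sqrt_le_of_sqr. lra. unfold Dl. assert (x ^ 2 * sin t ^ 2 <= x ^ 2) by nra. nra. }
    unfold minus, plus, opp; simpl.
    apply Rle_trans with ((1 - sin t) / (cos t + x)).
    2:{ apply Rmult_le_compat_l. lra. apply Rinv_le_contravar; auto. }
    apply Rmult_le_reg_r with ((1 + sin t) * (cos t + x)). apply Rmult_lt_0_compat; lra.
    replace ((1 - sin t) / (cos t + x) * ((1 + sin t) * (cos t + x))) with (cos t ^ 2) by (rewrite E; field; lra).
    replace ((cos t / (1 + sin t) + - x) * ((1 + sin t) * (cos t + x))) with (cos t ^ 2 + cos t * x - x * (1 + sin t) * (cos t + x)) by (field; lra).
    assert (cos t * x <= x * (cos t + x)) by nra. assert (x * (cos t + x) <= x * (1 + sin t) * (cos t + x)).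
    { apply Rmult_le_compat_r; nra. } lra.
  - apply (is_RInt_le (fun t => (1 - sin t) / sqrt (Dl x t)) (fun t => cos t / (1 + sin t)) 0 (PI / 2)); auto. lra.
    intros t Ht. destruct (cos_sin_range t Ht) as [[C0 C1] [S0 S1]]. assert (E := cos2_sin2 t).
    assert (Q := Dl_sqrt_pos x t ltac:(lra)).
    assert (B : cos t <= sqrt (Dl x t)).
    { apply le_sqrt_of_sqr. lra. unfold Dl. assert (0 <= x ^ 2 * sin t ^ 2) by (apply Rmult_le_pos; apply pow2_ge_0). lra. }
    replace (cos t / (1 + sin t)) with ((1 - sin t) / cos t).
    apply Rmult_le_compat_l. lra. apply Rinv_le_contravar; auto.
    apply Rmult_eq_reg_r with (cos t * (1 + sin t)). 2:apply Rgt_not_eq; apply Rmult_lt_0_compat; lra.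
    transitivity (1 - sin t ^ 2). field; lra. rewrite <- E. field; lra.
Qed.

Lemma ln_le_sub_1 y : 0 < y -> ln y <= y - 1.
Proof. intros Hy. generalize (exp_ineq1_le (ln y)). rewrite exp_ln by auto. lra. Qed.

(** One [ln 2] comes from [ln (1 + k)] as [k] tends to 1, the other from [kf_rest_part]. Replacing
    [/ k] by 1 costs [O(x)] even against [- ln x <= / x], because [/ k - 1] is [O(x^2)]. *)
Lemma kf_near_0 x : 0 < x <= 1 / 2 -> Rabs (kf x + ln x - 2 * ln 2) <= 6 * x.
Proof.
  intros Hx. set (k := sqrt (1 - x ^ 2)).
  assert (Hk2 : k * k = 1 - x ^ 2) by (apply sqrt_sqrt; nra).
  assert (Hk : 1 / 2 <= k). { apply le_sqrt_of_sqr; nra. }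
  assert (Hk1 : k <= 1) by (apply sqrt_le_of_sqr; nra).
  assert (H1 := kf_log_part x ltac:(lra)). fold k in H1.
  assert (H2 := is_RInt_minus (V := R_NormedModule) _ _ _ _ _ _ (is_RInt_kf x ltac:(lra)) H1).
  assert (H3 : is_RInt (fun t => (1 - sin t) / sqrt (Dl x t)) 0 (PI / 2) (minus (kf x) ((ln (1 + k) - ln x) / k))).
  { apply (is_RInt_ext (V := R_NormedModule)) with (2 := H2). intros t _. unfold minus, plus, opp; simpl. unfold Rdiv. ring. }
  apply kf_rest_part in H3; [|lra]. unfold minus, plus, opp in H3; simpl in H3.
  assert (P4 := PI_4). assert (L2 : 0 < ln 2 <= 1). { split. rewrite <- ln_1. apply ln_increasing; lra. generalize (ln_le_sub_1 2); lra. }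
  assert (Lx : 0 <= - ln x <= / x - 1).
  { split. rewrite <- ln_Rinv by lra. rewrite <- ln_1. apply Rcomplements.ln_le. lra. rewrite <- Rinv_1. apply Rinv_le_contravar; lra.
    rewrite <- ln_Rinv by lra. apply ln_le_sub_1. apply Rinv_0_lt_compat; lra. }
  assert (IK : 1 <= / k <= 1 + 2 * (x * x)).
  { split. rewrite <- Rinv_1. apply Rinv_le_contravar; lra.
    apply Rmult_le_reg_r with k. lra. rewrite Rinv_l by lra.
    assert (1 - k <= x * x) by nra. nra. }
  assert (LK : ln 2 - x * x <= ln (1 + k) <= ln 2).
  { split. 2:apply Rcomplements.ln_le; lra.
    assert (ln (2 / (1 + k)) <= x * x).
    { eapply Rle_trans. apply ln_le_sub_1. apply Rdiv_lt_0_compat; lra.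
      apply Rmult_le_reg_r with (1 + k). lra. replace ((2 / (1 + k) - 1) * (1 + k)) with (1 - k) by (field; lra). nra. }
    rewrite ln_div in H by lra. lra. }
  set (j := / k) in *. unfold Rdiv in H3. fold j in H3. set (a := ln (1 + k)) in *. set (m := - ln x) in *.
  replace (ln x) with (- m) in * by (unfold m; ring).
  assert (X1 : 0 <= m * (j - 1) <= 2 * x).
  { split. apply Rmult_le_pos; lra. apply Rle_trans with (/ x * (2 * (x * x))). apply Rmult_le_compat; lra. right. field. lra. }
  assert (X2 : ln 2 - x <= a * j <= ln 2 + x).
  { assert (Hxx : x * x <= x / 2) by nra. split.
    - assert (0 <= a) by lra || (assert (0 < a) by (unfold a; rewrite <- ln_1; apply ln_increasing; lra); lra).
      assert (a * 1 <= a * j) by (apply Rmult_le_compat_l; lra). lra.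
    - assert (a * j <= ln 2 * j) by (apply Rmult_le_compat_r; lra). assert (ln 2 * j <= ln 2 * (1 + 2 * (x * x))) by (apply Rmult_le_compat_l; lra). 
      assert (ln 2 * (2 * (x * x)) <= 1 * (2 * (x * x))) by (apply Rmult_le_compat_r; nra). lra. }
  apply Rabs_le. assert (x * (PI * / 2) <= 2 * x) by nra.
  split; nra.
Qed.

End EllipticReal.

(** * The logarithmic series and its differential equation *)

Section LogarithmicSeries.
Local Open Scope R_scope.

(** The square of [(1/2)_n / n!], that is, the coefficient of [x ^ (2 n)] in [(2 / PI) K(x)]. *)
Fixpoint bs (n : nat) : R :=
  match n with O => 1 | S m => bs m * ((2 * INR m + 1) / (2 * INR m + 2)) ^ 2 end.

Lemma bs_succ n : bs (S n) = bs n * ((2 * INR n + 1) / (2 * INR n + 2)) ^ 2.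
Proof. reflexivity. Qed.

(** Equal to [sum_(k >= n) (1 / (k + 1/2) - 1 / (k + 1))]; the integral form makes
    sign, monotonicity and decay evident. *)
Definition lam (n : nat) : R := 2 * RInt (fun t => t ^ (2 * n) / (1 + t)) 0 1.

Lemma bs_pos n : 0 < bs n.
Proof.
  induction n. simpl; lra. rewrite bs_succ. assert (P := pos_INR n). apply Rmult_lt_0_compat; auto.
  apply pow_lt. apply Rdiv_lt_0_compat; lra.
Qed.

Lemma bs_S n : bs (S n) * (2 * INR n + 2) ^ 2 = bs n * (2 * INR n + 1) ^ 2.
Proof. rewrite bs_succ. assert (P := pos_INR n). field. lra. Qed.

Lemma bs_decr n : bs (S n) <= bs n.
Proof.
  rewrite bs_succ. assert (P := pos_INR n). assert (Q := bs_pos n).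
  assert (0 <= (2 * INR n + 1) / (2 * INR n + 2) <= 1).
  { split. apply Rmult_le_pos. lra. left; apply Rinv_0_lt_compat; lra.
    apply Rmult_le_reg_r with (2 * INR n + 2). lra. unfold Rdiv. rewrite Rmult_assoc, Rinv_l by lra. lra. }
  assert (((2 * INR n + 1) / (2 * INR n + 2)) ^ 2 <= 1) by nra. nra.
Qed.

Lemma bs_le_1 n : bs n <= 1.
Proof. induction n. simpl; lra. eapply Rle_trans; [apply bs_decr|auto]. Qed.

Lemma is_RInt_lam n : is_RInt (fun t => t ^ (2 * n) / (1 + t)) 0 1 (lam n / 2).
Proof.
  unfold lam. assert (E : forall r : R, 2 * r / 2 = r) by (intros; field). rewrite E.
  apply (RInt_correct (V := R_CompleteNormedModule)).
  apply (ex_RInt_continuous (V := R_CompleteNormedModule)). intros t Ht. rewrite Rmin_left, Rmax_right in Ht by lra.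
  apply (ex_derive_continuous (V := R_NormedModule)). auto_derive. lra.
Qed.

Lemma is_RInt_pow_01 n : is_RInt (fun t => t ^ n) 0 1 (/ INR (S n)).
Proof.
  replace (/ INR (S n)) with (minus (1 ^ S n / INR (S n)) (0 ^ S n / INR (S n))).
  2:{ rewrite pow1, pow_i by lia. unfold minus, plus, opp; simpl. unfold Rdiv. ring. }
  apply (is_RInt_derive (V := R_CompleteNormedModule) (fun t => t ^ S n / INR (S n))).
  - intros t _. assert (INR (S n) <> 0) by (apply not_0_INR; lia). auto_derive; auto. simpl pred. field. auto.
  - intros t _. apply (ex_derive_continuous (V := R_NormedModule)). auto_derive. auto.
Qed.

Lemma lam_0 : lam 0 = 2 * ln 2.
Proof.
  unfold lam. f_equal. apply (is_RInt_unique (V := R_CompleteNormedModule)).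
  replace (ln 2) with (minus (ln (1 + 1)) (ln (1 + 0))).
  2:{ rewrite Rplus_0_r, ln_1. replace (1 + 1) with 2 by ring. unfold minus, plus, opp; simpl; ring. }
  apply (is_RInt_derive (V := R_CompleteNormedModule) (fun t => ln (1 + t))); intros t Ht; rewrite Rmin_left, Rmax_right in Ht by lra.
  auto_derive. lra. simpl. field. lra.
  apply (ex_derive_continuous (V := R_NormedModule)). auto_derive. lra.
Qed.

(** The integrand of the difference simplifies by [(1 - t^2) / (1 + t) = 1 - t], leaving two
    monomials. *)
Lemma lam_S n : lam n - lam (S n) = / (INR n + / 2) - / (INR n + 1).
Proof.
  assert (H := is_RInt_minus (V := R_NormedModule) _ _ _ _ _ _ (is_RInt_lam n) (is_RInt_lam (S n))).
  assert (H2 : is_RInt (fun t => t ^ (2 * n) / (1 + t) - t ^ (2 * S n) / (1 + t)) 0 1 (/ INR (S (2 * n)) - / INR (S (S (2 * n))))).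
  { apply (is_RInt_ext (V := R_NormedModule)) with (fun t => minus (t ^ (2 * n)) (t ^ (S (2 * n)))).
    - intros t Ht. rewrite Rmin_left, Rmax_right in Ht by lra. unfold minus, plus, opp; simpl opp.
      replace (2 * S n)%nat with (S (S (2 * n))) by lia. simpl pow. set (y := t ^ (2 * n)) in *. simpl. field. lra.
    - apply (is_RInt_minus (V := R_NormedModule)); apply is_RInt_pow_01. }
  assert (E := eq_trans (eq_sym (is_RInt_unique (V := R_CompleteNormedModule) _ _ _ _ H)) (is_RInt_unique (V := R_CompleteNormedModule) _ _ _ _ H2)).
  unfold minus, plus, opp in E; simpl opp in E. rewrite !S_INR, mult_INR in E. simpl (INR 2) in E.
  assert (P := pos_INR n).
  replace (lam n - lam (S n)) with (2 * (lam n / 2 + - (lam (S n) / 2))) by field. 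
  etransitivity; [apply f_equal; exact E|]. field. lra.
Qed.

Lemma lam_bounds n : 0 <= lam n <= 2 / (2 * INR n + 1).
Proof.
  assert (H := is_RInt_lam n). split.
  - assert (0 <= lam n / 2); [|lra].
    apply (is_RInt_ge_0 (fun t => t ^ (2 * n) / (1 + t)) 0 1); auto. lra.
    intros t Ht. apply Rmult_le_pos. apply pow_le; lra. left; apply Rinv_0_lt_compat; lra.
  - assert (lam n / 2 <= / INR (S (2 * n))).
    { apply (is_RInt_le (fun t => t ^ (2 * n) / (1 + t)) (fun t => t ^ (2 * n)) 0 1); auto. lra. apply is_RInt_pow_01.
      intros t Ht. assert (0 <= t ^ (2 * n)) by (apply pow_le; lra). rewrite <- (Rmult_1_r (t ^ (2 * n))) at 2.
      apply Rmult_le_compat_l; auto. rewrite <- Rinv_1. apply Rinv_le_contravar; lra. }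
    rewrite S_INR, mult_INR in H0. simpl (INR 2) in H0. unfold Rdiv. replace (2 * INR n) with ((1 + 1) * INR n) by ring. lra.
Qed.

Lemma lam_decr n : lam (S n) <= lam n.
Proof.
  assert (H := lam_S n). assert (P := pos_INR n).
  assert (/ (INR n + 1) <= / (INR n + / 2)) by (apply Rinv_le_contravar; lra). lra.
Qed.

Lemma lam_le_2 n : lam n <= 2.
Proof.
  destruct (lam_bounds n) as [_ H]. eapply Rle_trans; [apply H|]. assert (P := pos_INR n).
  apply Rmult_le_reg_r with (2 * INR n + 1). lra. unfold Rdiv. rewrite Rmult_assoc, Rinv_l by lra. lra.
Qed.

Lemma CV_radius_bounded_ge_1 (a : nat -> R) M u : (forall n, Rabs (a n) <= M) -> Rabs u < 1 ->
  Rbar_lt (Rabs u) (CV_radius a).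
Proof.
  intros H Hu. apply Rbar_lt_le_trans with 1. exact Hu.
  apply (proj1 (CV_radius_bounded a)). exists M. intros n. rewrite pow1, Rmult_1_r. auto.
Qed.

Definition cs (n : nat) : R := bs n * lam n.

Lemma bs_CV u : Rabs u < 1 -> Rbar_lt (Rabs u) (CV_radius bs).
Proof.
  apply (CV_radius_bounded_ge_1 bs 1). intros n. rewrite Rabs_pos_eq. apply bs_le_1. left; apply bs_pos.
Qed.

Lemma cs_CV u : Rabs u < 1 -> Rbar_lt (Rabs u) (CV_radius cs).
Proof.
  apply (CV_radius_bounded_ge_1 cs 2). intros n. unfold cs. assert (P := bs_pos n). assert (Q := bs_le_1 n). 
  destruct (lam_bounds n) as [L _]. assert (L2 := lam_le_2 n).
  rewrite Rabs_pos_eq by nra. nra.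
Qed.

(** Coefficients of [4 u (1 - u) A'(u)], where [A = sum a_n u^n]. *)
Definition opP (a : nat -> R) (n : nat) : R :=
  match n with O => 0 | S m => 4 * (INR (S m) * a (S m) - INR m * a m) end.

Lemma PS_derive_CV a u : Rbar_lt (Rabs u) (CV_radius a) -> Rbar_lt (Rabs u) (CV_radius (PS_derive a)).
Proof. now rewrite CV_radius_derive. Qed.

Lemma opP_ext a n : opP a n = 4 * PS_minus (PS_incr_1 (PS_derive a)) (PS_incr_1 (PS_incr_1 (PS_derive a))) n.
Proof.
  unfold opP, PS_minus, PS_plus, PS_opp, PS_incr_1, PS_derive. destruct n as [|[|n]];
  unfold plus, opp, zero; simpl; try ring.
Qed.

Lemma PSeries_opP a u : Rbar_lt (Rabs u) (CV_radius a) ->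
  PSeries (opP a) u = 4 * u * (1 - u) * PSeries (PS_derive a) u /\ Rbar_lt (Rabs u) (CV_radius (opP a)).
Proof.
  intros H. assert (H1 := PS_derive_CV a u H).
  assert (H2 : Rbar_lt (Rabs u) (CV_radius (PS_incr_1 (PS_derive a)))) by now rewrite CV_radius_incr_1.
  assert (H3 : Rbar_lt (Rabs u) (CV_radius (PS_incr_1 (PS_incr_1 (PS_derive a))))) by now rewrite !CV_radius_incr_1.
  assert (H4 : Rbar_lt (Rabs u) (CV_radius (PS_minus (PS_incr_1 (PS_derive a)) (PS_incr_1 (PS_incr_1 (PS_derive a)))))).
  { eapply Rbar_lt_le_trans; [|exact (CV_radius_plus (PS_incr_1 (PS_derive a)) (PS_opp (PS_incr_1 (PS_incr_1 (PS_derive a)))))].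
    apply Rbar_min_case; [exact H2|]. now rewrite CV_radius_opp. }
  split.
  - rewrite (PSeries_ext _ _ u (opP_ext a)).
    change (fun n => 4 * PS_minus (PS_incr_1 (PS_derive a)) (PS_incr_1 (PS_incr_1 (PS_derive a))) n) with
      (PS_scal 4 (PS_minus (PS_incr_1 (PS_derive a)) (PS_incr_1 (PS_incr_1 (PS_derive a))))).
    rewrite PSeries_scal, PSeries_minus by (apply CV_radius_inside; auto).
    rewrite !PSeries_incr_1. ring.
  - rewrite (CV_radius_ext _ _ (opP_ext a)).
    change (fun n => 4 * PS_minus (PS_incr_1 (PS_derive a)) (PS_incr_1 (PS_incr_1 (PS_derive a))) n) with
      (PS_scal 4 (PS_minus (PS_incr_1 (PS_derive a)) (PS_incr_1 (PS_incr_1 (PS_derive a))))).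
    eapply Rbar_lt_le_trans; [exact H4|]. rewrite CV_radius_scal by lra. apply Rbar_le_refl.
Qed.

(** The hypergeometric equation [(4 u (1 - u) A')' = A] of the complete integral, in terms of
    coefficients. *)
Lemma PS_derive_opP_bs n : PS_derive (opP bs) n = bs n.
Proof.
  unfold PS_derive, opP. assert (E := bs_S n). rewrite S_INR.
  replace ((INR n + 1) * (4 * ((INR n + 1) * bs (S n) - INR n * bs n))) with
   (bs (S n) * (2 * INR n + 2) ^ 2 - 4 * INR n * (INR n + 1) * bs n) by ring.
  rewrite E. ring.
Qed.

(** The terms beyond [cs n] are those which the same operator produces from the factor [ln x] in
    [ln x * Bx x]; they cancel in [is_derive_ZL]. *)
Lemma PS_derive_opP_cs n :
  PS_derive (opP cs) n = cs n - 2 * bs n + 4 * (PS_derive bs n - PS_incr_1 (PS_derive bs) n).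
Proof.
  assert (EI : PS_incr_1 (PS_derive bs) n = INR n * bs n).
  { destruct n. unfold PS_incr_1, zero; simpl. ring. reflexivity. }
  rewrite EI. unfold PS_derive, opP, cs. assert (E := bs_S n). assert (L := lam_S n). assert (P := pos_INR n). rewrite S_INR.
  replace (lam (S n)) with (lam n - (/ (INR n + / 2) - / (INR n + 1))) by lra.
  set (y := INR n) in *. set (b1 := bs (S n)) in *. set (b := bs n) in *.
  apply Rmult_eq_reg_r with (y + 1). 2:lra.
  replace (b1) with (b * (2 * y + 1) ^ 2 / (2 * y + 2) ^ 2). 2:{ rewrite <- E. field. lra. }
  field. split; lra.
Qed.

Definition Bx (x : R) : R := PSeries bs (x ^ 2).
Definition Lx (x : R) : R := PSeries cs (x ^ 2).
Definition kser (x : R) : R := Lx x - ln x * Bx x.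

Lemma is_derive_PSeries_sqr a x : Rbar_lt (Rabs (x ^ 2)) (CV_radius a) ->
  is_derive (fun x => PSeries a (x ^ 2)) x (2 * x * PSeries (PS_derive a) (x ^ 2)).
Proof.
  intros H. apply (is_derive_comp (PSeries a) (fun x => x ^ 2)). now apply is_derive_PSeries.
  auto_derive; auto; ring.
Qed.

Lemma sqr_lt_1 x : 0 <= x < 1 -> Rabs (x ^ 2) < 1.
Proof. intros Hx. rewrite Rabs_pos_eq; nra. Qed.

(** [ZB], and likewise [ZL], is [x (1 - x^2) y'] for [y = Bx] and [y = kser]. It turns the
    second-order equation into the system [y' = Z / (x (1 - x^2))], [Z' = x y], which [kf] satisfies
    together with [Zk]. *)
Definition ZB (x : R) : R := PSeries (opP bs) (x ^ 2) / 2.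
Definition ZL (x : R) : R := PSeries (opP cs) (x ^ 2) / 2 - (1 - x ^ 2) * Bx x - ln x * ZB x.

Lemma ZB_eq x : 0 <= x < 1 -> ZB x = 2 * x ^ 2 * (1 - x ^ 2) * PSeries (PS_derive bs) (x ^ 2).
Proof.
  intros Hx. unfold ZB. rewrite (proj1 (PSeries_opP bs (x ^ 2) (bs_CV _ (sqr_lt_1 x Hx)))). field.
Qed.

Lemma is_derive_Bx x : 0 < x < 1 -> is_derive Bx x (ZB x / (x * (1 - x ^ 2))).
Proof.
  intros Hx. replace (ZB x / (x * (1 - x ^ 2))) with (2 * x * PSeries (PS_derive bs) (x ^ 2)).
  apply is_derive_PSeries_sqr. apply bs_CV, sqr_lt_1; lra.
  rewrite ZB_eq by lra. assert (0 < 1 - x ^ 2) by nra. field. simpl in *; split; lra.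
Qed.

Lemma is_derive_ZB x : 0 < x < 1 -> is_derive ZB x (x * Bx x).
Proof.
  intros Hx. assert (B := bs_CV _ (sqr_lt_1 x ltac:(lra))). destruct (PSeries_opP bs _ B) as [_ C].
  evar_last. unfold ZB, Rdiv. apply is_derive_ext with (fun x => / 2 * PSeries (opP bs) (x ^ 2)). intros; apply Rmult_comm.
  apply is_derive_scal. apply is_derive_PSeries_sqr. exact C.
  cbv beta. rewrite (PSeries_ext _ _ _ PS_derive_opP_bs). unfold Bx. field.
Qed.

Lemma is_derive_kser x : 0 < x < 1 -> is_derive kser x (ZL x / (x * (1 - x ^ 2))).
Proof.
  intros Hx. assert (B := cs_CV _ (sqr_lt_1 x ltac:(lra))). destruct (PSeries_opP cs _ B) as [E _].
  assert (0 < 1 - x ^ 2) by nra.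
  evar_last. apply (is_derive_minus Lx (fun x => ln x * Bx x)).
  apply is_derive_PSeries_sqr. exact B.
  apply (is_derive_mult ln Bx). apply is_derive_ln; lra. now apply is_derive_Bx. intros; apply Rmult_comm.
  unfold minus, plus, opp, mult; simpl. unfold ZL. replace (x * (x * 1)) with (x ^ 2) by ring. rewrite E.
  field. simpl in *; split; lra.
Qed.

Lemma is_derive_ZL x : 0 < x < 1 -> is_derive ZL x (x * kser x).
Proof.
  intros Hx. assert (B := cs_CV _ (sqr_lt_1 x ltac:(lra))). destruct (PSeries_opP cs _ B) as [_ C].
  assert (Bb := bs_CV _ (sqr_lt_1 x ltac:(lra))).
  assert (0 < 1 - x ^ 2) by nra.
  assert (Dm : is_derive (fun x => 1 - x ^ 2) x (- (2 * x))) by (auto_derive; auto; ring).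
  evar_last. unfold ZL.
  apply (is_derive_minus (fun x => PSeries (opP cs) (x ^ 2) / 2 - (1 - x ^ 2) * Bx x) (fun x => ln x * ZB x)).
  apply (is_derive_minus (fun x => PSeries (opP cs) (x ^ 2) / 2) (fun x => (1 - x ^ 2) * Bx x)).
  apply is_derive_ext with (fun x => / 2 * PSeries (opP cs) (x ^ 2)). intros; apply Rmult_comm.
  apply is_derive_scal. apply is_derive_PSeries_sqr. exact C.
  apply (is_derive_mult (fun x => 1 - x ^ 2) Bx). exact Dm. now apply is_derive_Bx. intros; apply Rmult_comm.
  apply (is_derive_mult ln ZB). apply is_derive_ln; lra. now apply is_derive_ZB. intros; apply Rmult_comm.
  unfold minus, plus, opp, mult; simpl. replace (x * (x * 1)) with (x ^ 2) by ring.
  rewrite (PSeries_ext _ _ _ PS_derive_opP_cs).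
  assert (D1 := PS_derive_CV _ _ Bb).
  assert (D2 : Rbar_lt (Rabs (x ^ 2)) (CV_radius (PS_incr_1 (PS_derive bs)))) by now rewrite CV_radius_incr_1.
  assert (ES : PSeries (fun n => cs n - 2 * bs n + 4 * (PS_derive bs n - PS_incr_1 (PS_derive bs) n)) (x ^ 2) =
     Lx x - 2 * Bx x + 4 * (1 - x ^ 2) * PSeries (PS_derive bs) (x ^ 2)).
  { transitivity (PSeries (PS_plus (PS_minus cs (PS_scal 2 bs)) (PS_scal 4 (PS_minus (PS_derive bs) (PS_incr_1 (PS_derive bs))))) (x ^ 2)).
    reflexivity.
    assert (X1 := CV_radius_inside _ _ B). assert (X2 := CV_radius_inside _ _ Bb).
    assert (X3 := CV_radius_inside _ _ D1). assert (X4 := CV_radius_inside _ _ D2).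
    rewrite PSeries_plus, !PSeries_minus, !PSeries_scal, PSeries_minus, PSeries_incr_1; auto.
    unfold Lx, Bx. ring.
    all: try (apply ex_pseries_scal; [apply Rmult_comm|]); auto; try apply ex_pseries_minus; auto.
    apply ex_pseries_scal; [apply Rmult_comm|]; auto. }
  rewrite ES, ZB_eq by lra. unfold kser. field. simpl in *; split; lra.
Qed.

End LogarithmicSeries.

(** * Identification of K' with its logarithmic series *)

Section Wronskian.
Local Open Scope R_scope.

Definition lim0 (f : R -> R) (l : R) : Prop := filterlim f (at_right 0) (locally l).

Lemma lim0_spec f l : lim0 f l <-> forall eps, 0 < eps -> exists d, 0 < d /\ forall x, 0 < x < d -> Rabs (f x - l) < eps.
Proof.
  unfold lim0. rewrite filterlim_locally. split.
  - intros H eps He. destruct (H (mkposreal eps He)) as [d Hd]. exists d. split. apply cond_pos.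
    intros x Hx. apply (Hd x). 2:lra. unfold ball; simpl. unfold AbsRing_ball, abs, minus, plus, opp; simpl. rewrite Rabs_pos_eq; lra.
  - intros H eps. destruct (H eps (cond_pos eps)) as (d & Hd & B). exists (mkposreal d Hd). intros x Hx Hx0.
    apply B. unfold ball in Hx; simpl in Hx. unfold AbsRing_ball, abs, minus, plus, opp in Hx; simpl in Hx. rewrite Rabs_pos_eq in Hx; lra.
Qed.

Lemma lim0_plus f g a b : lim0 f a -> lim0 g b -> lim0 (fun x => f x + g x) (a + b).
Proof.
  intros Hf Hg. apply (filterlim_comp_2 (G := locally a) (H := locally b) f g Rplus); auto.
  apply (filterlim_plus (V := R_NormedModule)).
Qed.

Lemma lim0_mult f g a b : lim0 f a -> lim0 g b -> lim0 (fun x => f x * g x) (a * b).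
Proof.
  intros Hf Hg. apply (filterlim_comp_2 (G := locally a) (H := locally b) f g Rmult); auto.
  apply (filterlim_mult (K := R_AbsRing)).
Qed.

Lemma lim0_const c : lim0 (fun _ => c) c.
Proof. apply filterlim_const. Qed.

Lemma lim0_opp f a : lim0 f a -> lim0 (fun x => - f x) (- a).
Proof.
  intros H. apply (proj2 (lim0_spec _ _)). intros eps He. rewrite lim0_spec in H. destruct (H eps He) as (d & Hd & B). exists d; split; auto.
  intros x Hx. replace (- f x - - a) with (- (f x - a)) by ring. rewrite Rabs_Ropp. auto.
Qed.

Lemma lim0_minus f g a b : lim0 f a -> lim0 g b -> lim0 (fun x => f x - g x) (a - b).
Proof. intros. apply lim0_plus; auto. now apply lim0_opp. Qed.

Lemma lim0_ext f g a : (forall x, 0 < x < 1 -> f x = g x) -> lim0 f a -> lim0 g a.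
Proof.
  intros E H. apply (proj2 (lim0_spec _ _)). intros eps He. rewrite lim0_spec in H. destruct (H eps He) as (d & Hd & B).
  exists (Rmin d 1). split. apply Rmin_pos; lra. intros x Hx. assert (Rmin d 1 <= d) by apply Rmin_l. assert (Rmin d 1 <= 1) by apply Rmin_r.
  rewrite <- E by lra. apply B; lra.
Qed.

Lemma lim0_bound f l M : (forall x, 0 < x <= 1 / 2 -> Rabs (f x - l) <= M * x) -> lim0 f l.
Proof.
  intros H. apply (proj2 (lim0_spec _ _)). intros eps He. exists (Rmin (1 / 2) (eps / (Rabs M + 1))).
  assert (P := Rabs_pos M).
  split. apply Rmin_pos. lra. apply Rdiv_lt_0_compat; lra.
  intros x Hx. assert (H1 := Rmin_l (1 / 2) (eps / (Rabs M + 1))). assert (H2 := Rmin_r (1 / 2) (eps / (Rabs M + 1))).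
  eapply Rle_lt_trans. apply H; lra.
  apply Rle_lt_trans with (Rabs M * x). apply Rmult_le_compat_r. lra. apply Rle_abs.
  apply Rlt_le_trans with ((Rabs M + 1) * (eps / (Rabs M + 1))). 2:right; field; lra.
  apply Rle_lt_trans with ((Rabs M + 1) * x). nra. apply Rmult_lt_compat_l; lra.
Qed.

Lemma lim0_unique_const c l : lim0 (fun _ => c) l -> c = l.
Proof.
  intros H. apply (filterlim_locally_unique (V := R_NormedModule) (F := at_right 0) (fun _ : R => c)); [|exact H].
  apply filterlim_const.
Qed.

Lemma lim0_PSeries a : Rbar_lt (Rabs 0) (CV_radius a) -> lim0 (fun x => PSeries a (x ^ 2)) (a 0%nat).
Proof.
  intros H. rewrite <- (PSeries_0 a).
  assert (L : lim0 (fun x => x ^ 2) 0).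
  { apply (lim0_bound _ _ 1). intros x Hx. rewrite Rminus_0_r, Rabs_pos_eq; nra. }
  apply (filterlim_comp _ _ _ (fun x => x ^ 2) (PSeries a) (at_right 0) (locally 0)). exact L.
  apply continuity_pt_filterlim. now apply PSeries_continuity.
Qed.

Lemma Rabs_0_lt_1 : Rabs 0 < 1.
Proof. rewrite Rabs_R0. lra. Qed.

Lemma neg_ln_bound x : 0 < x <= 1 -> 0 <= - ln x <= / x.
Proof.
  intros Hx. rewrite <- ln_Rinv by lra. split.
  rewrite <- ln_1. apply Rcomplements.ln_le. lra. rewrite <- Rinv_1. apply Rinv_le_contravar; lra.
  assert (0 < / x) by (apply Rinv_0_lt_compat; lra). generalize (ln_le_sub_1 (/ x)). lra.
Qed.

Lemma lim0_sqr_ln : lim0 (fun x => x ^ 2 * ln x) 0.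
Proof.
  apply (lim0_bound _ _ 1). intros x Hx. destruct (neg_ln_bound x) as [A B]; [lra|].
  rewrite Rminus_0_r, <- Rabs_Ropp, Rabs_pos_eq by nra.
  apply Rle_trans with (x ^ 2 * / x). assert (x ^ 2 * - ln x <= x ^ 2 * / x) by (apply Rmult_le_compat_l; nra). lra.
  right. field. lra.
Qed.

Definition Zk (x : R) : R := x ^ 2 * kf x - ef x.

Lemma is_derive_Zk x : 0 < x < 1 -> is_derive Zk x (x * kf x).
Proof.
  intros Hx. assert (0 < 1 - x ^ 2) by nra.
  assert (D2 : is_derive (fun x => x ^ 2) x (2 * x)) by (auto_derive; auto; ring).
  evar_last. apply (is_derive_minus (fun x => x ^ 2 * kf x) ef).
  apply (is_derive_mult (fun x => x ^ 2) kf). exact D2. now apply is_derive_kf. intros; apply Rmult_comm.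
  now apply is_derive_ef.
  unfold minus, plus, opp, mult; simpl. field. simpl in *; split; lra.
Qed.

(** The Wronskian of the regular solution [Bx] and the difference [kser - kf], with the weight
    [x (1 - x^2)] absorbed in the second components; with this weight it is constant. *)
Definition Wr (x : R) : R := Bx x * (ZL x - Zk x) - ZB x * (kser x - kf x).

Lemma is_derive_Wr x : 0 < x < 1 -> is_derive Wr x 0.
Proof.
  intros Hx. assert (0 < 1 - x ^ 2) by nra.
  evar_last. apply (is_derive_minus (fun x => Bx x * (ZL x - Zk x)) (fun x => ZB x * (kser x - kf x))).
  apply (is_derive_mult Bx (fun x => ZL x - Zk x)). now apply is_derive_Bx.
  apply (is_derive_minus ZL Zk). now apply is_derive_ZL. now apply is_derive_Zk. intros; apply Rmult_comm.
  apply (is_derive_mult ZB (fun x => kser x - kf x)). now apply is_derive_ZB.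
  apply (is_derive_minus kser kf). now apply is_derive_kser. now apply is_derive_kf. intros; apply Rmult_comm.
  unfold minus, plus, opp, mult; simpl. unfold Zk. field. simpl in *; split; lra.
Qed.

Lemma lim0_ext_bs : lim0 Bx 1.
Proof. apply (lim0_PSeries bs). apply bs_CV, Rabs_0_lt_1. Qed.

(** The series [Bx] starts with 1, so [Bx - 1] supplies a factor [x ^ 2] that absorbs the
    logarithm. *)
Lemma lim0_ln_Bx : lim0 (fun x => ln x * (Bx x - 1)) 0.
Proof.
  apply lim0_ext with (fun x => (x ^ 2 * ln x) * PSeries (PS_decr_1 bs) (x ^ 2)).
  - intros x Hx. unfold Bx. rewrite (PSeries_decr_1 bs). simpl (bs 0). ring.
    apply CV_radius_inside, bs_CV, sqr_lt_1; lra.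
  - replace 0 with (0 * PS_decr_1 bs 0) at 1 by ring. apply lim0_mult. apply lim0_sqr_ln.
    apply lim0_PSeries. rewrite CV_radius_decr_1. apply bs_CV, Rabs_0_lt_1.
Qed.

Lemma lim0_PS_derive_bs : lim0 (fun x => PSeries (PS_derive bs) (x ^ 2)) (PS_derive bs 0).
Proof. apply lim0_PSeries. apply PS_derive_CV, bs_CV, Rabs_0_lt_1. Qed.

Lemma lim0_sqr : lim0 (fun x => x ^ 2) 0.
Proof. apply (lim0_bound _ _ 1). intros x Hx. rewrite Rminus_0_r, Rabs_pos_eq; nra. Qed.

Lemma lim0_ZB : lim0 ZB 0.
Proof.
  apply lim0_ext with (fun x => 2 * x ^ 2 * (1 - x ^ 2) * PSeries (PS_derive bs) (x ^ 2)).
  intros x Hx. symmetry. apply ZB_eq; lra.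
  replace 0 with (2 * 0 * (1 - 0) * PS_derive bs 0) at 1 by ring.
  repeat apply lim0_mult; try apply lim0_const; try apply lim0_sqr. apply lim0_minus. apply lim0_const. apply lim0_sqr. apply lim0_PS_derive_bs.
Qed.

Lemma lim0_ln_ZB : lim0 (fun x => ln x * ZB x) 0.
Proof.
  apply lim0_ext with (fun x => 2 * (x ^ 2 * ln x) * (1 - x ^ 2) * PSeries (PS_derive bs) (x ^ 2)).
  intros x Hx. rewrite ZB_eq by lra. ring.
  replace 0 with (2 * 0 * (1 - 0) * PS_derive bs 0) at 1 by ring.
  apply lim0_mult. apply lim0_mult. apply lim0_mult. apply lim0_const. apply lim0_sqr_ln. apply lim0_minus. apply lim0_const. apply lim0_sqr. apply lim0_PS_derive_bs.
Qed.

(** The limit is that of [x] times the derivative of [- ln x], the singular part of [kser]; [Zk] has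
    the same limit because [ef] tends to 1. *)
Lemma lim0_ZL : lim0 ZL (-1).
Proof.
  unfold ZL. replace (-1) with (0 * / 2 - (1 - 0) * 1 - 0) by field.
  apply lim0_minus. apply lim0_minus.
  - unfold Rdiv. apply lim0_mult. apply (lim0_PSeries (opP cs)). apply PSeries_opP, cs_CV, Rabs_0_lt_1. apply lim0_const.
  - apply lim0_mult. apply lim0_minus. apply lim0_const. apply lim0_sqr. apply lim0_ext_bs.
  - apply lim0_ln_ZB.
Qed.

Lemma lim0_Zk : lim0 Zk (-1).
Proof.
  apply (lim0_bound _ _ 3). intros x Hx. unfold Zk. assert (P := PI_4).
  destruct (kf_bounds x) as [A B]; [lra|]. destruct (ef_near_0 x) as [C D]; [lra|].
  assert (0 <= x ^ 2 * kf x). { apply Rmult_le_pos. nra. generalize PI2_pos; lra. }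
  assert (x ^ 2 * kf x <= x ^ 2 * (PI / 2 * / x)) by (apply Rmult_le_compat_l; nra).
  replace (x ^ 2 * (PI / 2 * / x)) with (PI / 2 * x) in H0 by (field; lra).
  apply Rabs_le. split; nra.
Qed.

(** The constant term [lam 0 = 2 ln 2] of the series is the constant of [kf_near_0], and the
    logarithms cancel. *)
Lemma lim0_kser_kf : lim0 (fun x => kser x - kf x) 0.
Proof.
  apply lim0_ext with (fun x => Lx x - ln x * (Bx x - 1) - (kf x + ln x)).
  intros x Hx. unfold kser. ring.
  replace 0 with (cs 0 - 0 - 2 * ln 2) at 1 by (unfold cs; rewrite lam_0; simpl; ring).
  apply lim0_minus. apply lim0_minus. apply (lim0_PSeries cs). apply cs_CV, Rabs_0_lt_1. apply lim0_ln_Bx.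
  apply (lim0_bound _ _ 6). apply kf_near_0.
Qed.

Lemma constant_of_derive_0 (f : R -> R) l : (forall x, 0 < x < 1 -> is_derive f x 0) -> lim0 f l ->
  forall x, 0 < x < 1 -> f x = l.
Proof.
  intros H L x Hx. apply lim0_unique_const.
  apply (proj2 (lim0_spec _ _)). intros eps He. rewrite lim0_spec in L. destruct (L eps He) as (d & Hd & B).
  exists (Rmin d x). split. apply Rmin_pos; lra. intros y Hy.
  assert (Rmin d x <= d) by apply Rmin_l. assert (Rmin d x <= x) by apply Rmin_r.
  replace (f x) with (f y). apply B; lra.
  apply (eq_is_derive (V := R_NormedModule) f y x). intros t Ht. apply H. lra. lra.
Qed.

Lemma Bx_ge_1 x : 0 < x < 1 -> 1 <= Bx x.
Proof.
  intros Hx. unfold Bx.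
  assert (H := PSeries_correct bs (x ^ 2) (CV_radius_inside _ _ (bs_CV _ (sqr_lt_1 x ltac:(lra))))).
  assert (L : is_lim_seq (sum_n (fun k => scal (pow_n (x ^ 2) k) (bs k))) (PSeries bs (x ^ 2))) by exact H.
  assert (I := is_lim_seq_incr_compare _ _ L).
  assert (E : sum_n (fun k => scal (pow_n (x ^ 2) k) (bs k)) 0 = 1) by (rewrite sum_O; unfold scal; simpl; unfold mult, one; simpl; ring).
  eapply Rle_trans; [right; symmetry; exact E|]. apply I. clear E. intros n. rewrite sum_Sn.
  assert (0 <= (x ^ 2) ^ (S n)) by (apply pow_le; nra). assert (Q := bs_pos (S n)).
  assert (T : scal (pow_n (x ^ 2) (S n)) (bs (S n)) = (x ^ 2) ^ (S n) * bs (S n)) by (rewrite pow_n_pow; reflexivity).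
  rewrite T. assert (0 <= (x ^ 2) ^ (S n) * bs (S n)) by (apply Rmult_le_pos; lra).
  match goal with |- ?u <= plus ?u ?v => change (u <= u + v) end. lra.
Qed.

(** The limits at 0 force [Wr] to vanish, so the quotient of [kser - kf] by [Bx], which is at least
    1, has zero derivative; its limit 0 at the origin settles the constant. *)
Lemma kf_kser x : 0 < x < 1 -> kf x = kser x.
Proof.
  assert (W0 : forall x, 0 < x < 1 -> Wr x = 0).
  { apply constant_of_derive_0. apply is_derive_Wr. unfold Wr.
    replace 0 with (1 * (-1 - -1) - 0 * 0) at 1 by ring.
    apply lim0_minus; apply lim0_mult. apply lim0_ext_bs. apply lim0_minus. apply lim0_ZL. apply lim0_Zk.
    apply lim0_ZB. apply lim0_kser_kf. }
  intros Hx.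
  assert (D : forall x, 0 < x < 1 -> is_derive (fun x => (kser x - kf x) / Bx x) x 0).
  { clear x Hx. intros x Hx. assert (B1 := Bx_ge_1 x Hx). assert (0 < 1 - x ^ 2) by nra.
    evar_last. apply (is_derive_div (fun x => kser x - kf x) Bx).
    apply (is_derive_minus kser kf). now apply is_derive_kser. now apply is_derive_kf. now apply is_derive_Bx. lra.
    assert (E := W0 x Hx). unfold Wr, Zk in E. unfold minus, plus, opp; simpl.
    transitivity ((Bx x * (ZL x - (x ^ 2 * kf x - ef x)) - ZB x * (kser x - kf x)) / (x * (1 - x ^ 2) * Bx x ^ 2)).
    field. simpl in *; repeat split; lra. rewrite E. field. simpl in *; repeat split; lra. }
  assert (B1 := Bx_ge_1 x Hx).
  assert (E := constant_of_derive_0 _ 0 D).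
  assert (L : lim0 (fun x => (kser x - kf x) / Bx x) 0).
  { replace 0 with (0 * / 1) at 1 by field. unfold Rdiv. apply lim0_mult. apply lim0_kser_kf.
    apply (filterlim_comp _ _ _ Bx Rinv (at_right 0) (locally 1)). apply lim0_ext_bs.
    apply (filterlim_Rbar_inv 1). intros H; injection H; lra. }
  specialize (E L x Hx). cbv beta in E.
  assert (E2 : kser x - kf x = 0). { replace (kser x - kf x) with ((kser x - kf x) / Bx x * Bx x) by (field; lra). rewrite E. ring. } lra.
Qed.

Definition kterm (x : R) (n : nat) : R := bs n * x ^ (2 * n) * (lam n - ln x).

Lemma is_series_kterm x : 0 < x < 1 -> is_series (kterm x) (kf x).
Proof.
  intros Hx. rewrite kf_kser by auto.
  assert (H1 := PSeries_correct bs (x ^ 2) (CV_radius_inside _ _ (bs_CV _ (sqr_lt_1 x ltac:(lra))))).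
  assert (H2 := PSeries_correct cs (x ^ 2) (CV_radius_inside _ _ (cs_CV _ (sqr_lt_1 x ltac:(lra))))).
  assert (H3 := is_series_minus _ _ _ _ H2 (is_series_scal (V := R_NormedModule) (ln x) _ _ H1)).
  unfold kser. apply (is_series_ext (V := R_NormedModule)) with (2 := H3). intros n.
  assert (T : forall a : R, scal (pow_n (x ^ 2) n) a = (x ^ 2) ^ n * a) by (intros; rewrite pow_n_pow; reflexivity).
  rewrite !T. change ((x ^ 2) ^ n * cs n - ln x * ((x ^ 2) ^ n * bs n) = kterm x n).
  unfold kterm, cs. rewrite pow_mult. ring.
Qed.

Lemma kterm_pos x n : 0 < x < 1 -> 0 <= kterm x n.
Proof.
  intros Hx. unfold kterm. destruct (neg_ln_bound x) as [A _]; [lra|]. destruct (lam_bounds n) as [B _].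
  apply Rmult_le_pos. apply Rmult_le_pos. left; apply bs_pos. apply pow_le; lra. lra.
Qed.

Lemma bs_decr_le n k : bs (n + k) <= bs k.
Proof. induction n. simpl; lra. eapply Rle_trans; [apply bs_decr|auto]. Qed.

Lemma lam_decr_le n k : lam (n + k) <= lam k.
Proof. induction n. simpl; lra. eapply Rle_trans; [apply lam_decr|auto]. Qed.

Lemma kterm_shift x n k : 0 < x < 1 -> kterm x (n + k) <= x ^ (2 * n) * kterm x k.
Proof.
  intros Hx. unfold kterm. destruct (neg_ln_bound x) as [A _]; [lra|]. destruct (lam_bounds (n + k)) as [B _].
  replace (2 * (n + k))%nat with (2 * n + 2 * k)%nat by lia. rewrite pow_add.
  assert (0 <= x ^ (2 * n)) by (apply pow_le; lra). assert (0 <= x ^ (2 * k)) by (apply pow_le; lra).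
  replace (x ^ (2 * n) * (bs k * x ^ (2 * k) * (lam k - ln x))) with (bs k * (x ^ (2 * n) * x ^ (2 * k)) * (lam k - ln x)) by ring.
  assert (Q := bs_pos (n + k)). assert (Q2 := bs_decr_le n k). assert (Q3 := lam_decr_le n k).
  assert (0 <= x ^ (2 * n) * x ^ (2 * k)) by (apply Rmult_le_pos; auto).
  apply Rmult_le_compat; try lra. apply Rmult_le_pos; lra. apply Rmult_le_compat_r; lra.
Qed.

(** As [bs] and [lam] decrease, the tail is dominated termwise by [x ^ (2 * S N)] times the whole
    series. This power of [x] makes the integrated tail of order [1 / N], which justifies termwise
    integration without a dominated convergence argument. *)
Lemma kf_tail x N : 0 < x < 1 -> 0 <= kf x - sum_n (kterm x) N <= x ^ (2 * S N) * kf x.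
Proof.
  intros Hx. assert (H := is_series_kterm x Hx). assert (Hex : ex_series (kterm x)) by (eexists; exact H).
  assert (E := Series_incr_n (kterm x) (S N) ltac:(lia) Hex). simpl pred in E.
  rewrite (is_series_unique _ _ H) in E. rewrite sum_n_Reals. rewrite E at 1 2.
  replace (sum_f_R0 (kterm x) N + Series (fun k => kterm x (S N + k)) - sum_f_R0 (kterm x) N) with (Series (fun k => kterm x (S N + k))) by ring.
  assert (Hs : ex_series (fun k => x ^ (2 * S N) * kterm x k)) by (apply (ex_series_scal_l (V := R_NormedModule)); auto).
  split.
  - replace 0 with (Series (fun k => 0 * kterm x k)) by (rewrite Series_scal_l; ring).
    apply Series_le. intros k. rewrite Rmult_0_l. split. lra. now apply kterm_pos.
    apply (ex_series_incr_n (V := R_NormedModule) (kterm x) (S N)); auto.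
  - rewrite <- (is_series_unique _ _ H), <- Series_scal_l. apply Series_le; auto.
    intros k. split. now apply kterm_pos. now apply kterm_shift.
Qed.

End Wronskian.

(** * Mellin moments *)

Definition is_CInt (f : R -> C) (a b : R) (I : C) : Prop := is_RInt (V := C_R_NormedModule) f a b I.

Lemma is_CInt_pair f a b I :
  is_CInt f a b I <-> is_RInt (fun x => Re (f x)) a b (Re I) /\ is_RInt (fun x => Im (f x)) a b (Im I).
Proof.
  split.
  - intros H. split.
    + apply (is_RInt_fct_extend_fst (U := R_NormedModule) (V := R_NormedModule)). exact H.
    + apply (is_RInt_fct_extend_snd (U := R_NormedModule) (V := R_NormedModule)). exact H.
  - intros [H1 H2]. destruct I as [u v].
    apply (is_RInt_fct_extend_pair (U := R_NormedModule) (V := R_NormedModule)); assumption.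
Qed.

Lemma is_CInt_unique f a b I J : is_CInt f a b I -> is_CInt f a b J -> I = J.
Proof.
  rewrite !is_CInt_pair. intros [A B] [A' B'].
  apply (is_RInt_unique (V := R_CompleteNormedModule)) in A, B, A', B'.
  destruct I, J; simpl in *. congruence.
Qed.

Lemma is_CInt_ext f g a b I : (forall x, (Rmin a b < x < Rmax a b)%R -> f x = g x) ->
  is_CInt f a b I -> is_CInt g a b I.
Proof. apply (is_RInt_ext (V := C_R_NormedModule)). Qed.

Lemma is_CInt_plus f g a b I J : is_CInt f a b I -> is_CInt g a b J -> is_CInt (fun x => f x + g x) a b (I + J).
Proof. apply (is_RInt_plus (V := C_R_NormedModule)). Qed.

Lemma is_CInt_scal (c : C) f a b I : is_CInt f a b I -> is_CInt (fun x => c * f x) a b (c * I).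
Proof.
  rewrite !is_CInt_pair. intros [A B]. split.
  - apply (is_RInt_ext (V := R_NormedModule)) with (fun x => minus (scal (Re c) (Re (f x))) (scal (Im c) (Im (f x)))).
    intros; reflexivity.
    apply (is_RInt_minus (V := R_NormedModule)); apply (is_RInt_scal (V := R_NormedModule)); assumption.
  - apply (is_RInt_ext (V := R_NormedModule)) with (fun x => plus (scal (Re c) (Im (f x))) (scal (Im c) (Re (f x)))).
    intros; reflexivity.
    apply (is_RInt_plus (V := R_NormedModule)); apply (is_RInt_scal (V := R_NormedModule)); assumption.
Qed.

Lemma is_CInt_minus f g a b I J : is_CInt f a b I -> is_CInt g a b J -> is_CInt (fun x => f x - g x) a b (I - J).
Proof. apply (is_RInt_minus (V := C_R_NormedModule)). Qed.

Definition Ccont (f : R -> C) (x : R) : Prop :=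
  continuous (fun x => Re (f x)) x /\ continuous (fun x => Im (f x)) x.

Definition Cder (f : R -> C) (x : R) (d : C) : Prop :=
  is_derive (fun x => Re (f x)) x (Re d) /\ is_derive (fun x => Im (f x)) x (Im d).

Lemma Cder_Ccont f x d : Cder f x d -> Ccont f x.
Proof.
  intros [A B]. split; apply (ex_derive_continuous (V := R_NormedModule)); eexists; eassumption.
Qed.

Lemma Cder_eq f x d d' : d = d' -> Cder f x d -> Cder f x d'.
Proof. now intros ->. Qed.

Lemma Cder_mult f g x a b : Cder f x a -> Cder g x b -> Cder (fun x => f x * g x) x (a * g x + f x * b).
Proof.
  intros [A1 A2] [B1 B2]. split; simpl.
  - evar_last. apply (is_derive_minus (fun x => Re (f x) * Re (g x))%R (fun x => Im (f x) * Im (g x))%R).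
    apply (is_derive_mult _ _ _ _ _ A1 B1 Rmult_comm). apply (is_derive_mult _ _ _ _ _ A2 B2 Rmult_comm).
    unfold minus, plus, opp, mult, Re, Im; simpl. ring.
  - evar_last. apply (is_derive_plus (fun x => Re (f x) * Im (g x))%R (fun x => Im (f x) * Re (g x))%R).
    apply (is_derive_mult _ _ _ _ _ A1 B2 Rmult_comm). apply (is_derive_mult _ _ _ _ _ A2 B1 Rmult_comm).
    unfold plus, mult, Re, Im; simpl. ring.
Qed.

Lemma Cder_plus f g x a b : Cder f x a -> Cder g x b -> Cder (fun x => f x + g x) x (a + b).
Proof.
  intros [A1 A2] [B1 B2]. split; simpl.
  apply (is_derive_plus _ _ _ _ _ A1 B1). apply (is_derive_plus _ _ _ _ _ A2 B2).
Qed.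

Lemma Cder_RtoC (f : R -> R) x a : is_derive f x a -> Cder (fun x => RtoC (f x)) x (RtoC a).
Proof. intros H. split; simpl. exact H. apply (is_derive_const (V := R_NormedModule)). Qed.

Lemma Cder_const c x : Cder (fun _ => c) x 0.
Proof. split; apply (is_derive_const (V := R_NormedModule)). Qed.

Lemma Ccont_mult f g x : Ccont f x -> Ccont g x -> Ccont (fun x => f x * g x) x.
Proof.
  intros [A1 A2] [B1 B2]. split; simpl.
  - apply (continuous_minus (V := R_NormedModule) (fun x => Re (f x) * Re (g x))%R (fun x => Im (f x) * Im (g x))%R);
    apply (continuous_mult (K := R_AbsRing)); assumption.
  - apply (continuous_plus (V := R_NormedModule) (fun x => Re (f x) * Im (g x))%R (fun x => Im (f x) * Re (g x))%R);
    apply (continuous_mult (K := R_AbsRing)); assumption.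
Qed.

Lemma Ccont_minus f g x : Ccont f x -> Ccont g x -> Ccont (fun x => f x - g x) x.
Proof.
  intros [A1 A2] [B1 B2]. split; simpl.
  apply (continuous_minus (V := R_NormedModule) _ _ _ A1 B1). apply (continuous_minus (V := R_NormedModule) _ _ _ A2 B2).
Qed.


Lemma Ccont_const c x : Ccont (fun _ => c) x.
Proof. split; apply continuous_const. Qed.

Lemma is_CInt_ex f a b : (0 < a < 1)%R -> (0 < b < 1)%R -> (forall x, (0 < x < 1)%R -> Ccont f x) -> exists I, is_CInt f a b I.
Proof.
  intros Ha Hb H.
  assert (R : forall x, (Rmin a b <= x <= Rmax a b)%R -> (0 < x < 1)%R).
  { intros x. unfold Rmin, Rmax. destruct (Rle_dec a b); lra. }
  destruct (ex_RInt_continuous (V := R_CompleteNormedModule) (fun x => Re (f x)) a b) as [u Hu].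
  { intros x Hx. apply H, R, Hx. }
  destruct (ex_RInt_continuous (V := R_CompleteNormedModule) (fun x => Im (f x)) a b) as [v Hv].
  { intros x Hx. apply H, R, Hx. }
  exists (u, v). apply is_CInt_pair. split; assumption.
Qed.

Lemma is_CInt_derive F f a b : (0 < a < 1)%R -> (0 < b < 1)%R ->
  (forall x, (0 < x < 1)%R -> Cder F x (f x)) -> (forall x, (0 < x < 1)%R -> Ccont f x) ->
  is_CInt f a b (F b - F a).
Proof.
  intros Ha Hb HF Hf.
  assert (R : forall x, (Rmin a b <= x <= Rmax a b)%R -> (0 < x < 1)%R).
  { intros x. unfold Rmin, Rmax. destruct (Rle_dec a b); lra. }
  apply is_CInt_pair. split.
  - apply (is_RInt_derive (V := R_CompleteNormedModule) (fun x => Re (F x))).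
    intros x Hx. apply HF, R, Hx. intros x Hx. apply Hf, R, Hx.
  - apply (is_RInt_derive (V := R_CompleteNormedModule) (fun x => Im (F x))).
    intros x Hx. apply HF, R, Hx. intros x Hx. apply Hf, R, Hx.
Qed.

Lemma is_CInt_Chasles f a b c I J : is_CInt f a b I -> is_CInt f b c J -> is_CInt f a c (I + J).
Proof. apply (is_RInt_Chasles (V := C_R_NormedModule)). Qed.

(** [x ^ r], meaningful for [0 < x] only. *)
Definition rp (r x : R) : R := exp (r * ln x).

Lemma rp_pos r x : (0 < rp r x)%R. Proof. apply exp_pos. Qed.

Lemma rp_plus r s x : rp (r + s) x = (rp r x * rp s x)%R.
Proof. unfold rp. rewrite <- exp_plus. f_equal. ring. Qed.

Lemma rp_le_1 r x : (0 <= r)%R -> (0 < x <= 1)%R -> (rp r x <= 1)%R.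
Proof.
  intros Hr Hx. unfold rp. rewrite <- exp_0. apply exp_le.
  assert (ln x <= 0)%R by (rewrite <- ln_1; apply Rcomplements.ln_le; lra). nra.
Qed.


Lemma rp_small r eps : (0 < r)%R -> (0 < eps)%R -> exists d, (0 < d <= 1 / 2)%R /\ forall x, (0 < x < d)%R -> (rp r x < eps)%R.
Proof.
  (* [exp (ln eps / r)] is the solution of [x ^ r = eps]. *)
  intros Hr He. exists (Rmin (1 / 2) (exp (ln eps / r))). split. split. apply Rmin_pos. lra. apply exp_pos. apply Rmin_l.
  intros x Hx. assert (H := Rmin_r (1 / 2) (exp (ln eps / r))). unfold rp. rewrite <- (exp_ln eps) by auto.
  apply exp_increasing. assert (L : (ln x < ln eps / r)%R).
  { rewrite <- (ln_exp (ln eps / r)). apply ln_increasing; lra. }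
  apply Rmult_lt_compat_l with (r := r) in L; auto. replace (r * (ln eps / r))%R with (ln eps) in L by (field; lra). exact L.
Qed.

Lemma rp_near_1 r eps : (0 < r)%R -> (0 < eps)%R -> exists d, (0 < d <= 1 / 2)%R /\ forall x, (1 - d < x < 1)%R -> (1 - eps < rp r x)%R.
Proof.
  (* On [x >= 1 / 2] one has [- ln x <= 2 * (1 - x)], so [x ^ r >= 1 + r ln x] loses less than
     [eps]. *)
  intros Hr He. exists (Rmin (1 / 2) (eps / (2 * r))). split. split. apply Rmin_pos. lra. apply Rdiv_lt_0_compat; lra. apply Rmin_l.
  intros x Hx. assert (H := Rmin_l (1 / 2) (eps / (2 * r))). assert (H2 := Rmin_r (1 / 2) (eps / (2 * r))).
  unfold rp. apply Rlt_le_trans with (1 + r * ln x)%R. 2:apply exp_ineq1_le.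
  assert (L : (- ln x <= 2 * (1 - x))%R).
  { rewrite <- ln_Rinv by lra. assert (P := exp_ineq1_le (ln (/ x))). rewrite exp_ln in P by (apply Rinv_0_lt_compat; lra).
    assert (/ x - 1 <= 2 * (1 - x))%R.
    { apply Rmult_le_reg_r with x. lra. replace ((/ x - 1) * x)%R with (1 - x)%R by (field; lra). nra. } lra. }
  assert (r * - ln x <= r * (2 * (1 - x)))%R by (apply Rmult_le_compat_l; lra).
  assert (r * (2 * (1 - x)) < r * (2 * (eps / (2 * r))))%R by (apply Rmult_lt_compat_l; lra).
  replace (r * (2 * (eps / (2 * r))))%R with eps in H1 by (field; lra). lra.
Qed.

Lemma neg_ln_rp r x : (0 < r)%R -> (0 < x <= 1)%R -> (0 <= - ln x <= / r * rp (- r) x)%R.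
Proof.
  intros Hr Hx. split.
  - assert (ln x <= 0)%R by (rewrite <- ln_1; apply Rcomplements.ln_le; lra). lra.
  - unfold rp. assert (P := exp_ineq1_le (- r * ln x)). apply Rmult_le_reg_l with r; auto.
    rewrite <- Rmult_assoc, Rinv_r by lra. lra.
Qed.

Lemma is_derive_rp r x : (0 < x)%R -> is_derive (rp r) x (r * rp r x / x)%R.
Proof. intros Hx. unfold rp. auto_derive; auto. field. lra. Qed.

(** * Improper integrals over the open unit interval *)

Lemma is_CInt_dominated f K r a b I : (0 <= K)%R -> (0 < r)%R -> (0 < a <= b)%R -> (b < 1)%R ->
  (forall x, (0 < x < 1)%R -> (Cmod (f x) <= K * (rp r x / x))%R) -> is_CInt f a b I ->
  (Cmod I <= K / r * (rp r b - rp r a))%R.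
Proof.
  intros HK Hr Ha Hb Hf HI. rewrite Cmod_norm.
  apply (norm_RInt_le (V := C_R_NormedModule) f (fun x => K * (rp r x / x))%R a b I); auto. lra.
  - intros x Hx. rewrite <- Cmod_norm. apply Hf. lra.
  - replace (K / r * (rp r b - rp r a))%R with (minus (K / r * rp r b) (K / r * rp r a))%R by (unfold minus, plus, opp; simpl; ring).
    apply (is_RInt_derive (V := R_CompleteNormedModule) (fun x => K / r * rp r x)%R).
    + intros x Hx. rewrite Rmin_left, Rmax_right in Hx by lra.
      evar_last. apply is_derive_scal. apply is_derive_rp; lra. field. lra.
    + intros x Hx. rewrite Rmin_left, Rmax_right in Hx by lra.
      apply (ex_derive_continuous (V := R_NormedModule)). unfold rp. auto_derive. lra.
Qed.

(** An epsilon form of [is_RInt_gen] at both open ends, convenient for linear combinations and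
    estimates. The bound [d <= 1 / 2] ensures [a < b]. *)
Definition improper (f : R -> C) (l : C) : Prop :=
  forall eps, (0 < eps)%R -> exists d, (0 < d <= 1 / 2)%R /\
    forall a b, (0 < a < d)%R -> (1 - d < b < 1)%R -> exists I, is_CInt f a b I /\ (Cmod (I - l) < eps)%R.

Lemma improper_is_RInt_gen f l : improper f l ->
  is_RInt_gen (V := C_R_NormedModule) f (at_right 0) (at_left 1) l.
Proof.
  intros H P [eps HP].
  destruct (H eps (cond_pos eps)) as (d & Hd & B).
  assert (Hd0 : (0 < d)%R) by lra.
  apply (Filter_prod _ _ _ (fun a => 0 < a < d)%R (fun b => 1 - d < b < 1)%R).
  - exists (mkposreal d Hd0). intros x Hx Hx0. unfold ball in Hx; simpl in Hx. unfold AbsRing_ball, abs, minus, plus, opp in Hx; simpl in Hx.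
    rewrite Rabs_pos_eq in Hx; lra.
  - exists (mkposreal d Hd0). intros x Hx Hx0. unfold ball in Hx; simpl in Hx. unfold AbsRing_ball, abs, minus, plus, opp in Hx; simpl in Hx.
    rewrite Rabs_left in Hx; lra.
  - intros a b Ha Hb. destruct (B a b Ha Hb) as (I & HI & E). exists I. split; auto.
    apply HP. apply (C_NormedModule_mixin_compat1 l I eps). exact E.
Qed.

Lemma improper_unique f l m : improper f l -> improper f m -> l = m.
Proof.
  intros Hl Hm. destruct (Ceq_dec l m) as [E|E]; auto. exfalso.
  assert (P : (0 < Cmod (l - m) / 2)%R).
  { apply Rdiv_lt_0_compat; [|lra]. apply Cmod_gt_0. now apply Cminus_eq_contra. }
  destruct (Hl _ P) as (d1 & Hd1 & B1). destruct (Hm _ P) as (d2 & Hd2 & B2).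
  set (d := Rmin d1 d2). assert (d <= d1)%R by apply Rmin_l. assert (d <= d2)%R by apply Rmin_r.
  assert (0 < d)%R by (apply Rmin_pos; lra).
  destruct (B1 (d / 2)%R (1 - d / 2)%R) as (I & HI & E1); try lra.
  destruct (B2 (d / 2)%R (1 - d / 2)%R) as (J & HJ & E2); try lra.
  rewrite (is_CInt_unique _ _ _ _ _ HJ HI) in E2.
  generalize (Cmod_triangle (- (I - l)) (I - m)). rewrite Cmod_opp.
  replace (- (I - l) + (I - m)) with (l - m) by ring. lra.
Qed.

Lemma improper_plus f g l m : improper f l -> improper g m -> improper (fun x => f x + g x) (l + m).
Proof.
  intros Hl Hm eps He. assert (P : (0 < eps / 2)%R) by lra.
  destruct (Hl _ P) as (d1 & Hd1 & B1). destruct (Hm _ P) as (d2 & Hd2 & B2).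
  assert (H1 := Rmin_l d1 d2). assert (H2 := Rmin_r d1 d2).
  exists (Rmin d1 d2). split. split. apply Rmin_pos; lra. lra.
  intros a b Ha Hb. destruct (B1 a b) as (I & HI & E1); try lra. destruct (B2 a b) as (J & HJ & E2); try lra.
  exists (I + J). split. now apply is_CInt_plus.
  replace (I + J - (l + m)) with ((I - l) + (J - m)) by ring. eapply Rle_lt_trans; [apply Cmod_triangle|]. lra.
Qed.

Lemma improper_scal c f l : improper f l -> improper (fun x => c * f x) (c * l).
Proof.
  intros Hl eps He. assert (PC := Cmod_ge_0 c). assert (P : (0 < eps / (Cmod c + 1))%R) by (apply Rdiv_lt_0_compat; lra).
  destruct (Hl _ P) as (d1 & Hd1 & B1). exists d1. split; auto.
  intros a b Ha Hb. destruct (B1 a b) as (I & HI & E1); try lra.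
  exists (c * I). split. now apply is_CInt_scal.
  replace (c * I - c * l) with (c * (I - l)) by ring. rewrite Cmod_mult.
  apply Rle_lt_trans with (Cmod c * (eps / (Cmod c + 1)))%R. apply Rmult_le_compat_l; lra.
  apply Rmult_lt_reg_r with (Cmod c + 1)%R. lra. replace (Cmod c * (eps / (Cmod c + 1)) * (Cmod c + 1))%R with (Cmod c * eps)%R by (field; lra). nra.
Qed.

Lemma improper_ext f g l : (forall x, (0 < x < 1)%R -> f x = g x) -> improper f l -> improper g l.
Proof.
  intros E H eps He. destruct (H eps He) as (d & Hd & B). exists d. split; auto.
  intros a b Ha Hb. destruct (B a b Ha Hb) as (I & HI & EI). exists I. split; auto.
  apply is_CInt_ext with f; auto. intros x. unfold Rmin, Rmax. destruct (Rle_dec a b); intros; apply E; lra.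
Qed.

Lemma improper_minus f g l m : improper f l -> improper g m -> improper (fun x => f x - g x) (l - m).
Proof.
  intros Hl Hm. replace (l - m) with (l + (- (1)) * m) by ring.
  apply improper_ext with (fun x => f x + (- (1)) * g x). intros; ring.
  apply improper_plus; auto. now apply improper_scal.
Qed.

Lemma improper_dominated f l K r : (0 <= K)%R -> (0 < r)%R ->
  (forall x, (0 < x < 1)%R -> (Cmod (f x) <= K * (rp r x / x))%R) -> improper f l -> (Cmod l <= K / r)%R.
Proof.
  intros HK Hr Hf H. apply Rnot_lt_le. intros Hlt.
  destruct (H (Cmod l - K / r)%R) as (d & Hd & B). lra.
  destruct (B (d / 2)%R (1 - d / 2)%R) as (I & HI & E); try lra.
  assert (T := is_CInt_dominated f K r (d / 2)%R (1 - d / 2)%R I HK Hr ltac:(lra) ltac:(lra) Hf HI).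
  assert (0 <= K / r)%R by (apply Rmult_le_pos; auto; left; apply Rinv_0_lt_compat; auto).
  assert (rp r (1 - d / 2) - rp r (d / 2) <= 1)%R by (generalize (rp_le_1 r (1 - d / 2) ltac:(lra) ltac:(lra)) (rp_pos r (d / 2)); lra).
  assert (K / r * (rp r (1 - d / 2) - rp r (d / 2)) <= K / r * 1)%R by (apply Rmult_le_compat_l; auto).
  generalize (Cmod_triangle I (- (I - l))). rewrite Cmod_opp. replace (I + - (I - l)) with l by ring. lra.
Qed.

Lemma improper_derive F f l K r : (0 <= K)%R -> (0 < r)%R ->
  (forall x, (0 < x < 1)%R -> Cder F x (f x)) -> (forall x, (0 < x < 1)%R -> Ccont f x) ->
  (forall x, (0 < x < 1)%R -> (Cmod (F x) <= K * rp r x)%R) ->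
  (forall x, (1 / 2 < x < 1)%R -> (Cmod (F x - l) <= K * (1 - x))%R) ->
  improper f l.
Proof.
  intros HK Hr HF Hf H0 H1 eps He.
  assert (P : (0 < eps / (2 * (K + 1)))%R) by (apply Rdiv_lt_0_compat; lra).
  destruct (rp_small r _ Hr P) as (d & Hd & B).
  exists (Rmin d (eps / (2 * (K + 1)))). assert (M1 := Rmin_l d (eps / (2 * (K + 1)))). assert (M2 := Rmin_r d (eps / (2 * (K + 1)))).
  split. split. apply Rmin_pos; lra. lra.
  intros a b Ha Hb. exists (F b - F a). split. apply is_CInt_derive; auto; lra.
  replace (F b - F a - l) with ((F b - l) + - F a) by ring. eapply Rle_lt_trans; [apply Cmod_triangle|]. rewrite Cmod_opp.
  specialize (H0 a ltac:(lra)). specialize (H1 b ltac:(lra)). specialize (B a ltac:(lra)).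
  assert (K * rp r a <= K * (eps / (2 * (K + 1))))%R by (apply Rmult_le_compat_l; lra).
  assert (K * (1 - b) <= K * (eps / (2 * (K + 1))))%R by (apply Rmult_le_compat_l; lra).
  assert (K * (eps / (2 * (K + 1))) < (K + 1) * (eps / (2 * (K + 1))))%R by (apply Rmult_lt_compat_r; lra).
  replace ((K + 1) * (eps / (2 * (K + 1))))%R with (eps / 2)%R in H3 by (field; lra). lra.
Qed.

(** Cauchy criterion: by Chasles, moving the endpoints costs two integrals over short end intervals,
    each at most [K / r] times an increment of [rp r], and [rp r] is close to 0 at one end and close
    to 1 at the other. *)
Lemma improper_ex f K r : (0 <= K)%R -> (0 < r)%R -> (forall x, (0 < x < 1)%R -> Ccont f x) ->
  (forall x, (0 < x < 1)%R -> (Cmod (f x) <= K * (rp r x / x))%R) -> exists l, improper f l.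
Proof.
  intros HK Hr Hc Hf.
  set (F := filter_prod (at_right 0) (at_left 1)).
  set (J := fun ab : R * R => RInt (V := C_R_CompleteNormedModule) f (fst ab) (snd ab) : C).
  assert (HJ : forall a b, (0 < a < 1)%R -> (0 < b < 1)%R -> is_CInt f a b (J (a, b))).
  { intros a b Ha Hb. destruct (is_CInt_ex f a b Ha Hb Hc) as [I HI].
    unfold is_CInt. apply (RInt_correct (V := C_R_CompleteNormedModule)). exists I. exact HI. }
  assert (HB : forall a b, (0 < a <= b)%R -> (b < 1)%R -> (Cmod (J (a, b)) <= K / r * (rp r b - rp r a))%R).
  { intros a b Ha Hb. apply (is_CInt_dominated f K r a b); auto. apply HJ; lra. }
  assert (Kr : (0 <= K / r)%R) by (apply Rmult_le_pos; auto; left; apply Rinv_0_lt_compat; auto).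
  assert (HB2 : forall a b, (0 < a < 1)%R -> (0 < b < 1)%R -> (Cmod (J (a, b)) <= K / r * Rabs (rp r b - rp r a))%R).
  { intros a b Ha Hb. destruct (Rle_lt_dec a b) as [L|L].
    - eapply Rle_trans; [apply HB; lra|]. apply Rmult_le_compat_l; auto. apply Rle_abs.
    - assert (E : J (a, b) = - J (b, a)).
      { apply (is_CInt_unique f a b). apply HJ; auto. apply (is_RInt_swap (V := C_R_NormedModule)). apply HJ; auto. }
      rewrite E, Cmod_opp, Rabs_minus_sym. eapply Rle_trans; [apply HB; lra|]. apply Rmult_le_compat_l; auto. apply Rle_abs. }
  assert (Cau : forall eps, (0 < eps)%R -> exists d, (0 < d <= 1 / 2)%R /\ forall a b a' b', (0 < a < d)%R -> (1 - d < b < 1)%R ->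
     (0 < a' < d)%R -> (1 - d < b' < 1)%R -> (Cmod (J (a', b') - J (a, b)) < eps)%R).
  { intros eps He. assert (P : (0 < eps / (2 * (K / r + 1)))%R) by (apply Rdiv_lt_0_compat; lra).
    destruct (rp_small r _ Hr P) as (d1 & Hd1 & B1). destruct (rp_near_1 r _ Hr P) as (d2 & Hd2 & B2).
    assert (M1 := Rmin_l d1 d2). assert (M2 := Rmin_r d1 d2).
    exists (Rmin d1 d2). split. split. apply Rmin_pos; lra. lra.
    intros a b a' b' Ha Hb Ha' Hb'.
    assert (E : J (a', b') = J (a', a) + J (a, b) + J (b, b')).
    { apply (is_CInt_unique f a' b'). apply HJ; lra.
      apply is_CInt_Chasles with b; [apply is_CInt_Chasles with a|]; apply HJ; lra. }
    replace (J (a', b') - J (a, b)) with (J (a', a) + J (b, b')) by (rewrite E; ring).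
    eapply Rle_lt_trans; [apply Cmod_triangle|].
    assert (T1 := HB2 a' a ltac:(lra) ltac:(lra)). assert (T2 := HB2 b b' ltac:(lra) ltac:(lra)).
    assert (Q1 : (Rabs (rp r a - rp r a') < eps / (2 * (K / r + 1)))%R).
    { generalize (B1 a ltac:(lra)) (B1 a' ltac:(lra)) (rp_pos r a) (rp_pos r a'). intros. apply Rabs_def1; lra. }
    assert (Q2 : (Rabs (rp r b' - rp r b) < eps / (2 * (K / r + 1)))%R).
    { generalize (B2 b ltac:(lra)) (B2 b' ltac:(lra)) (rp_le_1 r b ltac:(lra) ltac:(lra)) (rp_le_1 r b' ltac:(lra) ltac:(lra)). intros. apply Rabs_def1; lra. }
    set (e := (eps / (2 * (K / r + 1)))%R) in *.
    assert (K / r * Rabs (rp r a - rp r a') <= K / r * e)%R by (apply Rmult_le_compat_l; lra).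
    assert (K / r * Rabs (rp r b' - rp r b) <= K / r * e)%R by (apply Rmult_le_compat_l; lra).
    assert (E2 : ((K / r + 1) * e = eps / 2)%R) by (unfold e; field; split; lra). nra. }
  assert (PF : ProperFilter F) by apply filter_prod_proper.
  assert (Fd : forall d, (0 < d)%R -> F (fun ab => (0 < fst ab < d)%R /\ (1 - d < snd ab < 1)%R)).
  { intros d Hd. apply (Filter_prod _ _ _ (fun a => 0 < a < d)%R (fun b => 1 - d < b < 1)%R).
    - exists (mkposreal d Hd). intros x Hx Hx0. unfold ball in Hx; simpl in Hx. unfold AbsRing_ball, abs, minus, plus, opp in Hx; simpl in Hx.
      rewrite Rabs_pos_eq in Hx; lra.
    - exists (mkposreal d Hd). intros x Hx Hx0. unfold ball in Hx; simpl in Hx. unfold AbsRing_ball, abs, minus, plus, opp in Hx; simpl in Hx.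
      rewrite Rabs_left in Hx; lra.
    - intros; split; assumption. }
  destruct (proj1 (filterlim_locally_cauchy (U := C_R_CompleteNormedModule) (F := F) J)) as [l Hl].
  { intros eps. destruct (Cau eps (cond_pos eps)) as (d & Hd & B).
    exists (fun ab => (0 < fst ab < d)%R /\ (1 - d < snd ab < 1)%R). split. apply Fd; lra.
    intros [a b] [a' b'] [Ha Hb] [Ha' Hb']. simpl in Ha, Hb, Ha', Hb'.
    apply (C_NormedModule_mixin_compat1 (J (a, b)) (J (a', b')) eps). apply B; auto. }
  exists l. assert (FF : Filter F) by apply PF. assert (Hl' := proj1 (filterlim_C_iff F J l) Hl).
  intros eps He. destruct (Cau (eps / 2)%R ltac:(lra)) as (d & Hd & B). exists d. split; auto.
  intros a b Ha Hb. exists (J (a, b)). split. apply HJ; lra.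
  assert (X := Hl' (eps / 2)%R ltac:(lra)).
  destruct (filter_ex _ (filter_and _ _ X (Fd d ltac:(lra)))) as [[a' b'] [X1 [X2 X3]]]. simpl in X2, X3.
  specialize (B a' b' a b X2 X3 Ha Hb).
  replace (J (a, b) - l) with ((J (a, b) - J (a', b')) + (J (a', b') - l)) by ring.
  eapply Rle_lt_trans; [apply Cmod_triangle|]. lra.
Qed.

(** * Moments of E' and their recursions *)

Definition wz (z : C) (x : R) : C := Rpow_C x (2 * z - 1).

Lemma Cmod_Rpow_C (x : R) (z : C) : Cmod (Rpow_C x z) = rp (Re z) x.
Proof.
  unfold Rpow_C, rp. rewrite Cmod_Cexp. f_equal. unfold Re, Cmult, RtoC; simpl. ring.
Qed.

Lemma rp_m1 x : (0 < x)%R -> rp (- 1) x = (/ x)%R.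
Proof.
  intros Hx. unfold rp. replace (-1 * ln x)%R with (ln (/ x)) by (rewrite ln_Rinv; auto; ring).
  apply exp_ln. now apply Rinv_0_lt_compat.
Qed.

Lemma Cmod_wz z x : (0 < x)%R -> Cmod (wz z x) = (rp (2 * Re z) x / x)%R.
Proof.
  intros Hx. unfold wz. rewrite Cmod_Rpow_C. unfold Rdiv. rewrite <- rp_m1 by auto. rewrite <- rp_plus.
  f_equal. unfold Re, Cminus, Cplus, Copp, Cmult, RtoC; simpl. ring.
Qed.

Lemma Cder_Rpow_C z x : (0 < x)%R -> Cder (fun x => Rpow_C x z) x (z * Rpow_C x z / x).
Proof.
  intros Hx. apply Cder_eq with (z * (/ x)%R * Rpow_C x z).
  { rewrite RtoC_inv by lra. unfold Cdiv. ring. }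
  destruct z as [u v]. unfold Cder, Rpow_C, Cexp, Cmult, RtoC, Re, Im; simpl.
  unfold Rminus. split; auto_derive; auto; field; lra.
Qed.

Lemma wz_succ z x : (0 < x)%R -> wz (z + 1) x = wz z x * (x * x)%R.
Proof.
  intros Hx. unfold wz, Rpow_C. replace ((2 * (z + 1) - 1) * ln x) with ((2 * z - 1) * ln x + RtoC (2 * ln x)).
  2:{ rewrite RtoC_mult. ring. }
  rewrite Cexp_plus. f_equal. unfold Cexp, RtoC; simpl. rewrite cos_0, sin_0.
  replace (2 * ln x)%R with (ln x + ln x)%R by ring. rewrite exp_plus, exp_ln by auto. f_equal; ring.
Qed.

(** [Af] and [Bf] are combinations of the two integrals that tend to 0 at both ends of the interval,
    so the exact derivatives built from them have no boundary terms. *)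
Definition Af (x : R) : R := (x * (1 - x ^ 2) * ef x)%R.
Definition Bf (x : R) : R := (x * (ef x - x ^ 2 * kf x))%R.

Lemma is_derive_Af x : (0 < x < 1)%R ->
  is_derive Af x ((1 - 3 * x ^ 2) * ef x + x ^ 2 * (kf x - ef x))%R.
Proof.
  intros Hx. assert (0 < 1 - x ^ 2)%R by nra.
  assert (D : is_derive (fun x => x * (1 - x ^ 2))%R x (1 - 3 * x ^ 2)%R) by (auto_derive; auto; ring).
  evar_last. apply (is_derive_mult (fun x => x * (1 - x ^ 2))%R ef). exact D. now apply is_derive_ef. intros; apply Rmult_comm.
  unfold plus, mult; simpl. field. simpl in *; lra.
Qed.

Lemma is_derive_Bf x : (0 < x < 1)%R -> is_derive Bf x (ef x - 2 * x ^ 2 * kf x)%R.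
Proof.
  intros Hx. assert (0 < 1 - x ^ 2)%R by nra.
  assert (D : is_derive (fun x => x)%R x 1%R) by (auto_derive; auto; ring).
  evar_last. apply (is_derive_mult (fun x => x) (fun x => ef x - x ^ 2 * kf x)%R). exact D.
  apply is_derive_ext with (fun x => minus (- 0)%R (Zk x)).
  { intros t. unfold minus, plus, opp, Zk; simpl. ring. }
  apply (is_derive_minus (fun _ => - 0)%R Zk). apply (is_derive_const (V := R_NormedModule)). now apply is_derive_Zk.
  intros; apply Rmult_comm.
  unfold minus, plus, opp, mult, zero; simpl. ring.
Qed.

Lemma Af_bound x : (0 < x < 1)%R -> (0 <= Af x <= PI / 2 * (1 - x ^ 2) * x)%R.
Proof.
  intros Hx. assert (0 < 1 - x ^ 2)%R by nra. destruct (ef_bounds x) as [A B]; [lra|]. assert (P := PI2_pos).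
  assert (0 < ef x)%R by nra. unfold Af.
  assert (0 <= x * (1 - x ^ 2))%R by (apply Rmult_le_pos; lra). split. apply Rmult_le_pos; lra.
  replace (PI / 2 * (1 - x ^ 2) * x)%R with (x * (1 - x ^ 2) * (PI / 2))%R by ring. apply Rmult_le_compat_l; auto.
Qed.

Lemma Bf_bound x : (0 < x < 1)%R -> (0 <= Bf x <= PI / 2 * (1 - x ^ 2) * x)%R.
Proof.
  intros Hx. assert (0 < 1 - x ^ 2)%R by nra. destruct (ef_bounds x) as [A B]; [lra|]. assert (P := PI2_pos).
  destruct (kf_bounds x) as [C D]; [lra|]. unfold Bf.
  assert (x ^ 2 * kf x <= x ^ 2 * (PI / 2 * / x))%R by (apply Rmult_le_compat_l; nra).
  replace (x ^ 2 * (PI / 2 * / x))%R with (PI / 2 * x)%R in H0 by (field; lra).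
  assert (x ^ 2 * (PI / 2) <= x ^ 2 * kf x)%R by (apply Rmult_le_compat_l; nra).
  split. apply Rmult_le_pos; lra.
  replace (PI / 2 * (1 - x ^ 2) * x)%R with (x * (PI / 2 - x ^ 2 * (PI / 2)))%R by ring. apply Rmult_le_compat_l; lra.
Qed.

(** The coefficient [2 * z + 1] makes [kf] cancel: its contributions to the derivative are
    [- (2 z - 1)], [2 z + 1] and [- 2] times [x ^ 2 * kf x]. What is left relates moments of [ef] at
    [z] and [z + 1]. *)
Definition Qz (z : C) (x : R) : C := wz z x * ((2 * z + 1) * Af x + Bf x).
(** The [z]-derivative of [Qz z x]; differentiating the identity for [Qz] in [z]
    gives the one for the logarithmic moments. *)
Definition Sz (z : C) (x : R) : C := RtoC (2 * ln x) * Qz z x + wz z x * RtoC (2 * Af x).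

Lemma Cder_wz z x : (0 < x)%R -> Cder (wz z) x ((2 * z - 1) * wz z x / x).
Proof. intros Hx. apply (Cder_Rpow_C (2 * z - 1) x Hx). Qed.

Lemma Cder_Qz z x : (0 < x < 1)%R ->
  Cder (Qz z) x (4 * z * (z + 1) * (wz z x * ef x) - (2 * z + 1) * (2 * z + 3) * (wz (z + 1) x * ef x)).
Proof.
  intros Hx. eapply Cder_eq; [|apply Cder_mult; [apply Cder_wz; lra|apply Cder_plus;
    [apply Cder_mult; [apply Cder_const|apply Cder_RtoC; now apply is_derive_Af]|apply Cder_RtoC; now apply is_derive_Bf]]].
  rewrite wz_succ by lra. unfold Af, Bf.
  rewrite ?RtoC_plus, ?RtoC_minus, ?RtoC_mult, ?RtoC_minus, ?RtoC_mult, ?RtoC_pow.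
  assert (RtoC x <> 0) by (apply RtoC_neq; lra). field. auto.
Qed.

(** Minus the [z]-derivative of [wz z x * ef x]; the factor 2 comes from the exponent [2 z - 1]. Its
    integral stands for [- W']. *)
Definition Nln (z : C) (x : R) : C := wz z x * ef x * RtoC (- 2 * ln x).

Lemma Cder_Sz z x : (0 < x < 1)%R ->
  Cder (Sz z) x ((8 * z + 4) * (wz z x * ef x) - (8 * z + 8) * (wz (z + 1) x * ef x)
    - (4 * z * (z + 1) * Nln z x - (2 * z + 1) * (2 * z + 3) * Nln (z + 1) x)).
Proof.
  intros Hx. eapply Cder_eq; [|apply Cder_plus; [apply Cder_mult; [apply Cder_RtoC|apply Cder_Qz; lra]|
     apply Cder_mult; [apply Cder_wz; lra|apply Cder_RtoC; apply is_derive_scal; now apply is_derive_Af]]].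
  2:{ instantiate (1 := (2 / x)%R). auto_derive. lra. field. lra. }
  unfold Nln, Qz. rewrite wz_succ by lra. unfold Af, Bf.
  rewrite RtoC_div by lra.
  rewrite ?RtoC_plus, ?RtoC_minus, ?RtoC_mult, ?RtoC_plus, ?RtoC_minus, ?RtoC_mult, ?RtoC_minus, ?RtoC_mult, ?RtoC_pow, ?RtoC_opp.
  assert (RtoC x <> 0) by (apply RtoC_neq; lra). field. auto.
Qed.

Lemma Ccont_wz_ef z x : (0 < x < 1)%R -> Ccont (fun x => wz z x * ef x) x.
Proof.
  intros Hx. apply Ccont_mult. eapply Cder_Ccont. apply Cder_wz; lra.
  eapply Cder_Ccont. apply Cder_RtoC. now apply is_derive_ef.
Qed.

Lemma Ccont_Nln z x : (0 < x < 1)%R -> Ccont (Nln z) x.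
Proof.
  intros Hx. apply Ccont_mult. now apply Ccont_wz_ef. eapply Cder_Ccont. apply Cder_RtoC.
  instantiate (1 := (-2 / x)%R). auto_derive. lra. field. lra.
Qed.

Lemma wz_ef_bound z x : (0 < x < 1)%R -> (Cmod (wz z x * ef x) <= 2 * (rp (2 * Re z) x / x))%R.
Proof.
  intros Hx. rewrite Cmod_mult, Cmod_wz, Cmod_R by lra. destruct (ef_bounds x) as [A B]; [lra|].
  assert (P := PI2_pos). assert (P4 := PI_4). rewrite Rabs_pos_eq by nra.
  assert (0 < rp (2 * Re z) x / x)%R by (apply Rdiv_lt_0_compat; [apply rp_pos|lra]). nra.
Qed.

(** Half of the exponent [2 * Re z] pays for the logarithm, through
    [- ln x <= / Re z * rp (- Re z) x]. *)
Lemma Nln_bound z x : (0 < Re z)%R -> (0 < x < 1)%R -> (Cmod (Nln z x) <= 4 / Re z * (rp (Re z) x / x))%R.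
Proof.
  intros Hz Hx. unfold Nln. rewrite Cmod_mult, Cmod_R.
  destruct (neg_ln_rp (Re z) x Hz ltac:(lra)) as [L1 L2].
  replace (- 2 * ln x)%R with (2 * - ln x)%R by ring. rewrite Rabs_pos_eq by lra.
  assert (B := wz_ef_bound z x Hx).
  apply Rle_trans with ((2 * (rp (2 * Re z) x / x)) * (2 * (/ Re z * rp (- Re z) x)))%R.
  apply Rmult_le_compat; try lra. apply Cmod_ge_0.
  right. replace (rp (2 * Re z) x) with (rp (Re z) x * rp (Re z) x)%R by (rewrite <- rp_plus; f_equal; ring).
  assert (E : (rp (Re z) x * rp (- Re z) x = 1)%R).
  { rewrite <- rp_plus. unfold rp. replace ((Re z + - Re z) * ln x)%R with 0%R by ring. apply exp_0. }
  transitivity (4 / Re z * (rp (Re z) x / x) * (rp (Re z) x * rp (- Re z) x))%R. field. lra. rewrite E. ring.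
Qed.

Lemma improper_Cthe f : (exists l, improper f l) -> improper f (Cthe (improper f)).
Proof.
  intros [l Hl]. rewrite (Cthe_unique (improper f) l); auto. intros y Hy. now apply (improper_unique f).
Qed.

Definition mellin_E (z : C) : C := Cthe (improper (fun x => wz z x * ef x)).
Definition mellin_E_log (z : C) : C := Cthe (improper (Nln z)).

Lemma Mel_spec z : (0 < Re z)%R -> improper (fun x => wz z x * ef x) (mellin_E z).
Proof.
  intros Hz. apply improper_Cthe. apply improper_ex with 2%R (2 * Re z)%R; try lra.
  intros; now apply Ccont_wz_ef. intros; now apply wz_ef_bound.
Qed.

Lemma Nel_spec z : (0 < Re z)%R -> improper (Nln z) (mellin_E_log z).
Proof.
  intros Hz. assert (0 <= 4 / Re z)%R by (apply Rmult_le_pos; [lra|left; apply Rinv_0_lt_compat; auto]).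
  apply improper_Cthe. apply improper_ex with (4 / Re z)%R (Re z); auto.
  intros; now apply Ccont_Nln. intros; now apply Nln_bound.
Qed.

Lemma Nel_bound z : (0 < Re z)%R -> (Cmod (mellin_E_log z) <= 4 / Re z / Re z)%R.
Proof.
  intros Hz. assert (0 <= 4 / Re z)%R by (apply Rmult_le_pos; [lra|left; apply Rinv_0_lt_compat; auto]).
  apply (improper_dominated (Nln z)); auto. intros; now apply Nln_bound. now apply Nel_spec.
Qed.

Lemma Qz_bound z x : (0 < x < 1)%R -> (Cmod (Qz z x) <= 2 * (Cmod (2 * z + 1) + 1) * (1 - x ^ 2) * rp (2 * Re z) x)%R.
Proof.
  intros Hx. unfold Qz. rewrite Cmod_mult, Cmod_wz by lra.
  destruct (Af_bound x Hx) as [A1 A2]. destruct (Bf_bound x Hx) as [B1 B2]. assert (P4 := PI_4). assert (P := PI2_pos).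
  assert (0 < 1 - x ^ 2)%R by nra.
  set (y := ((1 - x ^ 2) * x)%R) in *. assert (Hy : (0 < y)%R) by (unfold y; apply Rmult_lt_0_compat; lra).
  assert (PI / 2 * (1 - x ^ 2) * x <= 2 * y)%R by (unfold y; nra).
  assert (T : (Cmod ((2 * z + 1) * Af x + Bf x) <= 2 * (Cmod (2 * z + 1) + 1) * y)%R).
  { eapply Rle_trans; [apply Cmod_triangle|]. rewrite Cmod_mult, !Cmod_R, !Rabs_pos_eq by lra.
    generalize (Cmod_ge_0 (2 * z + 1)). intros. nra. }
  assert (R0 := rp_pos (2 * Re z) x).
  apply Rle_trans with (rp (2 * Re z) x / x * (2 * (Cmod (2 * z + 1) + 1) * y))%R.
  apply Rmult_le_compat_l; auto. left. apply Rdiv_lt_0_compat; lra.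
  right. unfold y. field. lra.
Qed.

Lemma improper_Qz z : (0 < Re z)%R ->
  improper (fun x => 4 * z * (z + 1) * (wz z x * ef x) - (2 * z + 1) * (2 * z + 3) * (wz (z + 1) x * ef x)) 0.
Proof.
  intros Hz. set (c := (2 * (Cmod (2 * z + 1) + 1))%R). assert (Hc : (0 < c)%R) by (unfold c; generalize (Cmod_ge_0 (2 * z + 1)); lra).
  apply improper_derive with (Qz z) (2 * c)%R (2 * Re z)%R; try lra.
  - intros; now apply Cder_Qz.
  - intros x Hx.
    assert (M : forall a w, Ccont (fun x => a * (wz w x * ef x)) x) by (intros; exact (Ccont_mult _ _ _ (Ccont_const _ _) (Ccont_wz_ef w x Hx))).
    exact (Ccont_minus _ _ _ (M (4 * z * (z + 1)) z) (M ((2 * z + 1) * (2 * z + 3)) (z + 1))).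
  - intros x Hx. eapply Rle_trans; [now apply Qz_bound|]. fold c. assert (R0 := rp_pos (2 * Re z) x).
    apply Rmult_le_compat_r. lra. nra.
  - intros x Hx. replace (Qz z x - 0) with (Qz z x) by ring. eapply Rle_trans; [apply Qz_bound; lra|]. fold c.
    assert (R0 := rp_pos (2 * Re z) x). assert (R1 := rp_le_1 (2 * Re z) x ltac:(lra) ltac:(lra)).
    assert (0 <= c * (1 - x ^ 2))%R by (apply Rmult_le_pos; nra).
    apply Rle_trans with (c * (1 - x ^ 2) * 1)%R. apply Rmult_le_compat_l; auto. nra.
Qed.

Lemma Sz_bound z x : (0 < Re z)%R -> (0 < x < 1)%R ->
  (Cmod (Sz z x) <= (2 / Re z * (2 * (Cmod (2 * z + 1) + 1)) + 4) * (1 - x ^ 2) * rp (Re z) x)%R.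
Proof.
  intros Hz Hx. unfold Sz. eapply Rle_trans; [apply Cmod_triangle|]. rewrite !Cmod_mult, !Cmod_R, Cmod_wz by lra.
  destruct (Af_bound x Hx) as [A1 A2]. destruct (neg_ln_rp (Re z) x Hz ltac:(lra)) as [L1 L2].
  rewrite (Rabs_left1 (2 * ln x)), (Rabs_pos_eq (2 * Af x)) by lra.
  assert (Q := Qz_bound z x Hx). set (c := (2 * (Cmod (2 * z + 1) + 1))%R) in *.
  assert (Hc : (0 < c)%R) by (unfold c; generalize (Cmod_ge_0 (2 * z + 1)); lra).
  assert (0 < 1 - x ^ 2)%R by nra. assert (P4 := PI_4). assert (P := PI2_pos).
  set (r1 := rp (Re z) x) in *. assert (R0 : (0 < r1)%R) by apply rp_pos. assert (R1 : (r1 <= 1)%R) by (apply rp_le_1; lra).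
  assert (E2 : rp (2 * Re z) x = (r1 * r1)%R) by (unfold r1; rewrite <- rp_plus; f_equal; ring).
  assert (E : (r1 * rp (- Re z) x = 1)%R).
  { unfold r1. rewrite <- rp_plus. unfold rp. replace ((Re z + - Re z) * ln x)%R with 0%R by ring. apply exp_0. }
  rewrite E2 in *.
  assert (T1 : (- (2 * ln x) * Cmod (Qz z x) <= (2 * (/ Re z * rp (- Re z) x)) * (c * (1 - x ^ 2) * (r1 * r1)))%R).
  { apply Rmult_le_compat; try lra. apply Cmod_ge_0. }
  replace (2 * (/ Re z * rp (- Re z) x) * (c * (1 - x ^ 2) * (r1 * r1)))%R with
    (2 / Re z * c * (1 - x ^ 2) * r1 * (r1 * rp (- Re z) x))%R in T1 by (field; lra).
  rewrite E in T1.
  assert (T2 : (r1 * r1 / x * (2 * Af x) <= r1 * r1 / x * (2 * (PI / 2 * (1 - x ^ 2) * x)))%R).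
  { apply Rmult_le_compat_l. left. apply Rdiv_lt_0_compat; nra. lra. }
  replace (r1 * r1 / x * (2 * (PI / 2 * (1 - x ^ 2) * x)))%R with (r1 * r1 * ((1 - x ^ 2) * PI))%R in T2 by (field; lra).
  assert (T3 : (r1 * r1 * ((1 - x ^ 2) * PI) <= r1 * ((1 - x ^ 2) * 4))%R).
  { apply Rmult_le_compat. nra. apply Rmult_le_pos; lra. nra. apply Rmult_le_compat_l; lra. }
  lra.
Qed.

Lemma improper_Sz z : (0 < Re z)%R ->
  improper (fun x => (8 * z + 4) * (wz z x * ef x) - (8 * z + 8) * (wz (z + 1) x * ef x)
    - (4 * z * (z + 1) * Nln z x - (2 * z + 1) * (2 * z + 3) * Nln (z + 1) x)) 0.
Proof.
  intros Hz. set (c := (2 / Re z * (2 * (Cmod (2 * z + 1) + 1)) + 4)%R).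
  assert (Hc : (0 < c)%R).
  { unfold c. assert (0 < 2 / Re z)%R by (apply Rdiv_lt_0_compat; lra). generalize (Cmod_ge_0 (2 * z + 1)). intros. nra. }
  apply improper_derive with (Sz z) (2 * c)%R (Re z); try lra.
  - intros; now apply Cder_Sz.
  - intros x Hx.
    assert (M : forall a w, Ccont (fun x => a * (wz w x * ef x)) x) by (intros; exact (Ccont_mult _ _ _ (Ccont_const _ _) (Ccont_wz_ef w x Hx))).
    assert (N : forall a w, Ccont (fun x => a * Nln w x) x) by (intros; exact (Ccont_mult _ _ _ (Ccont_const _ _) (Ccont_Nln w x Hx))).
    exact (Ccont_minus _ _ _ (Ccont_minus _ _ _ (M (8 * z + 4) z) (M (8 * z + 8) (z + 1)))
      (Ccont_minus _ _ _ (N (4 * z * (z + 1)) z) (N ((2 * z + 1) * (2 * z + 3)) (z + 1)))).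
  - intros x Hx. eapply Rle_trans; [now apply Sz_bound|]. fold c. assert (R0 := rp_pos (Re z) x).
    apply Rmult_le_compat_r. lra. nra.
  - intros x Hx. replace (Sz z x - 0) with (Sz z x) by ring. eapply Rle_trans; [apply Sz_bound; lra|]. fold c.
    assert (R0 := rp_pos (Re z) x). assert (R1 := rp_le_1 (Re z) x ltac:(lra) ltac:(lra)).
    assert (0 <= c * (1 - x ^ 2))%R by (apply Rmult_le_pos; nra).
    apply Rle_trans with (c * (1 - x ^ 2) * 1)%R. apply Rmult_le_compat_l; auto. nra.
Qed.

Lemma Re_succ z : (0 < Re z)%R -> (0 < Re (z + 1))%R.
Proof. rewrite Re_plus, Re_RtoC. lra. Qed.

Lemma Mel_rec z : (0 < Re z)%R -> 4 * z * (z + 1) * mellin_E z = (2 * z + 1) * (2 * z + 3) * mellin_E (z + 1).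
Proof.
  intros Hz. assert (H := improper_Qz z Hz).
  assert (H2 := improper_minus _ _ _ _ (improper_scal (4 * z * (z + 1)) _ _ (Mel_spec z Hz))
    (improper_scal ((2 * z + 1) * (2 * z + 3)) _ _ (Mel_spec (z + 1) (Re_succ z Hz)))).
  assert (E := improper_unique _ _ _ H2 H). apply Ceq_minus. exact E.
Qed.

Lemma Nel_rec z : (0 < Re z)%R ->
  4 * z * (z + 1) * mellin_E_log z - (2 * z + 1) * (2 * z + 3) * mellin_E_log (z + 1) = (8 * z + 4) * mellin_E z - (8 * z + 8) * mellin_E (z + 1).
Proof.
  intros Hz. assert (H := improper_Sz z Hz). assert (Hz1 := Re_succ z Hz).
  assert (H2 := improper_minus _ _ _ _ (improper_minus _ _ _ _ (improper_scal (8 * z + 4) _ _ (Mel_spec z Hz))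
     (improper_scal (8 * z + 8) _ _ (Mel_spec (z + 1) Hz1)))
    (improper_minus _ _ _ _ (improper_scal (4 * z * (z + 1)) _ _ (Nel_spec z Hz))
     (improper_scal ((2 * z + 1) * (2 * z + 3)) _ _ (Nel_spec (z + 1) Hz1)))).
  assert (E := improper_unique _ _ _ H2 H). symmetry. apply Ceq_minus. exact E.
Qed.

Lemma improper_wz z : (0 < Re z)%R -> improper (wz z) (/ (2 * z)).
Proof.
  intros Hz. assert (z0 : z <> 0) by (intros E; rewrite E in Hz; simpl in Hz; lra).
  assert (z20 : 2 * z <> 0) by (apply Cmult_neq_0; auto; apply RtoC_neq; lra).
  set (c := Cmod (/ (2 * z))). assert (Hc : (0 <= c)%R) by apply Cmod_ge_0.
  (* The first summand bounds the primitive near 0. For [x > 1 / 2] the bound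
     [|ln x| <= 2 * (1 - x)], itself below 1, gives the second one. *)
  set (K := (c + 2 * exp (Cmod (2 * z) * 1))%R).
  assert (HE := exp_pos (Cmod (2 * z) * 1)).
  assert (EF : forall x, (0 < x)%R -> Rpow_C x (2 * z) = wz z x * x).
  { intros x Hx. unfold wz, Rpow_C. replace (2 * z * ln x) with ((2 * z - 1) * ln x + RtoC (ln x)) by ring.
    rewrite Cexp_plus. f_equal. unfold Cexp, RtoC; simpl. rewrite cos_0, sin_0, exp_ln by auto. f_equal; ring. }
  apply improper_derive with (fun x => / (2 * z) * Rpow_C x (2 * z)) K (2 * Re z)%R; try lra.
  - unfold K; lra.
  - intros x Hx. eapply Cder_eq; [|apply Cder_mult; [apply Cder_const|apply Cder_Rpow_C; lra]].
    rewrite EF by lra. assert (RtoC x <> 0) by (apply RtoC_neq; lra). field. auto.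
  - intros x Hx. eapply Cder_Ccont. apply Cder_wz; lra.
  - intros x Hx. rewrite Cmod_mult, Cmod_Rpow_C. fold c.
    replace (Re (2 * z)) with (2 * Re z)%R by (unfold Re, Cmult, RtoC; simpl; ring).
    apply Rmult_le_compat_r. left; apply rp_pos. unfold K; lra.
  - intros x Hx. replace (/ (2 * z) * Rpow_C x (2 * z) - / (2 * z)) with (/ (2 * z) * (Rpow_C x (2 * z) - 1)) by (field; auto).
    rewrite Cmod_mult. fold c. unfold Rpow_C.
    assert (L : (Rabs (ln x) <= 2 * (1 - x))%R).
    { assert (ln x <= 0)%R by (rewrite <- ln_1; apply Rcomplements.ln_le; lra). rewrite Rabs_left1 by auto.
      rewrite <- ln_Rinv by lra. assert (P := exp_ineq1_le (ln (/ x))). rewrite exp_ln in P by (apply Rinv_0_lt_compat; lra).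
      assert (/ x - 1 <= 2 * (1 - x))%R.
      { apply Rmult_le_reg_r with x. lra. replace ((/ x - 1) * x)%R with (1 - x)%R by (field; lra). nra. } lra. }
    assert (T := Cexp_sub_1_le (2 * z * ln x)). rewrite (Cmod_mult (2 * z)), Cmod_R in T.
    assert (Pz := Cmod_ge_0 (2 * z)). assert (Pl := Rabs_pos (ln x)).
    assert (T2 : (exp (Cmod (2 * z) * Rabs (ln x)) <= exp (Cmod (2 * z) * 1))%R) by (apply exp_le; apply Rmult_le_compat_l; lra).
    assert (Ecz : (c * Cmod (2 * z) = 1)%R).
    { unfold c. rewrite Cmod_inv by auto. field. assert (Q := proj1 (Cmod_gt_0 _) z20). lra. }
    apply Rle_trans with (c * (Cmod (2 * z) * Rabs (ln x) * exp (Cmod (2 * z) * 1)))%R.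
    { apply Rmult_le_compat_l; auto. eapply Rle_trans; [apply T|]. apply Rmult_le_compat_l; auto. apply Rmult_le_pos; auto. }
    replace (c * (Cmod (2 * z) * Rabs (ln x) * exp (Cmod (2 * z) * 1)))%R with ((c * Cmod (2 * z)) * (Rabs (ln x) * exp (Cmod (2 * z) * 1)))%R by ring.
    rewrite Ecz, Rmult_1_l. unfold K.
    assert (Rabs (ln x) * exp (Cmod (2 * z) * 1) <= 2 * (1 - x) * exp (Cmod (2 * z) * 1))%R by (apply Rmult_le_compat_r; lra). 
    assert (0 <= c * (1 - x))%R by (apply Rmult_le_pos; lra). lra.
Qed.

(** For large [Re z] the weight concentrates at [x = 1], where [ef] is [PI / 2]. The deviation is at
    most [PI / 2 * (1 - x) <= - 2 * ln x], and the logarithm contributes the second power of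
    [/ Re z]. *)
Lemma Mel_asymptotic z : (0 < Re z)%R -> (Cmod (mellin_E z - (PI / 2)%R * / (2 * z)) <= 2 / Re z / Re z)%R.
Proof.
  intros Hz. assert (0 <= 2 / Re z)%R by (apply Rmult_le_pos; [lra|left; apply Rinv_0_lt_compat; auto]).
  apply (improper_dominated (fun x => wz z x * ef x - (PI / 2)%R * wz z x)); auto.
  2:{ apply improper_minus. now apply Mel_spec. apply improper_scal. now apply improper_wz. }
  intros x Hx. replace (wz z x * ef x - (PI / 2)%R * wz z x) with (wz z x * RtoC (ef x - PI / 2)) by (rewrite RtoC_minus; ring).
  rewrite Cmod_mult, Cmod_R, Cmod_wz by lra. destruct (ef_bounds x) as [A B]; [lra|]. assert (P := PI2_pos). assert (P4 := PI_4).
  rewrite Rabs_left1 by lra.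
  destruct (neg_ln_rp (Re z) x Hz ltac:(lra)) as [L1 L2].
  assert (L3 : (1 - x <= - ln x)%R) by (generalize (ln_le_sub_1 x); lra).
  assert (T : (- (ef x - PI / 2) <= 2 * (/ Re z * rp (- Re z) x))%R) by nra.
  apply Rle_trans with (rp (2 * Re z) x / x * (2 * (/ Re z * rp (- Re z) x)))%R.
  apply Rmult_le_compat_l; auto. left. apply Rdiv_lt_0_compat. apply rp_pos. lra.
  right. replace (rp (2 * Re z) x) with (rp (Re z) x * rp (Re z) x)%R by (rewrite <- rp_plus; f_equal; ring).
  assert (E : (rp (Re z) x * rp (- Re z) x = 1)%R).
  { rewrite <- rp_plus. unfold rp. replace ((Re z + - Re z) * ln x)%R with 0%R by ring. apply exp_0. }
  transitivity (2 / Re z * (rp (Re z) x / x) * (rp (Re z) x * rp (- Re z) x))%R. field. lra. rewrite E. ring.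
Qed.

(** * Closed form and logarithmic derivative of the moments *)

Lemma Re_plus_INR z n : Re (z + INR n) = (Re z + INR n)%R.
Proof. reflexivity. Qed.

Lemma Re_pos_plus_INR z n : (0 < Re z)%R -> (0 < Re (z + INR n))%R.
Proof. rewrite Re_plus_INR. generalize (pos_INR n). lra. Qed.

Lemma plus_INR_S z n : z + INR n + 1 = z + INR (S n).
Proof. rewrite S_INR, RtoC_plus. ring. Qed.

Lemma Re_half : Re (1 / 2) = (1 / 2)%R.
Proof. replace (1 / 2) with (RtoC (1 / 2)) by (rewrite RtoC_div by lra; reflexivity). reflexivity. Qed.

Lemma Re_3half : Re (3 / 2) = (3 / 2)%R.
Proof. replace (3 / 2) with (RtoC (3 / 2)) by (rewrite RtoC_div by lra; reflexivity). reflexivity. Qed.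

Lemma Mel_rec' z : (0 < Re z)%R -> z * (z + 1) * mellin_E z = (z + 1 / 2) * (z + 3 / 2) * mellin_E (z + 1).
Proof.
  intros Hz. assert (E := Mel_rec z Hz). apply (Cmult_reg_l 4). apply RtoC_neq; lra.
  replace (4 * (z * (z + 1) * mellin_E z)) with (4 * z * (z + 1) * mellin_E z) by ring. rewrite E. field.
Qed.

Lemma Mel_iter z n : (0 < Re z)%R ->
  poch z n * poch (z + 1) n * mellin_E z = poch (z + 1 / 2) n * poch (z + 3 / 2) n * mellin_E (z + INR n).
Proof.
  intros Hz. induction n.
  - simpl. replace (z + 0) with z by ring. ring.
  - simpl poch. assert (E := Mel_rec' (z + INR n) (Re_pos_plus_INR z n Hz)). rewrite plus_INR_S in E.
    transitivity (poch z n * poch (z + 1) n * mellin_E z * ((z + INR n) * (z + 1 + INR n))). ring.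
    rewrite IHn. transitivity (poch (z + 1 / 2) n * poch (z + 3 / 2) n * ((z + INR n) * (z + INR n + 1) * mellin_E (z + INR n))). ring.
    rewrite plus_INR_S, E. ring.
Qed.

Lemma inv_INR_lim : filterlim (fun n => RtoC (/ INR n)) eventually (locally (RtoC 0)).
Proof.
  apply filterlim_RtoC. replace (Finite 0) with (Rbar_inv p_infty) by reflexivity.
  apply is_lim_seq_inv. apply is_lim_seq_INR. easy.
Qed.

Lemma Cmod_lim_0 (u : nat -> C) (v : nat -> R) :
  (exists N, forall n, (N <= n)%nat -> (Cmod (u n) <= v n)%R) -> is_lim_seq v 0 -> filterlim u eventually (locally (RtoC 0)).
Proof.
  intros [N HN] Hv. apply (filterlim_C_iff eventually). intros eps He. apply is_lim_seq_spec in Hv.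
  destruct (Hv (mkposreal eps He)) as [N' HN']. exists (N + N')%nat. intros n Hn. replace (u n - 0) with (u n) by ring.
  eapply Rle_lt_trans. apply HN; lia. specialize (HN' n ltac:(lia)). simpl in HN'. rewrite Rminus_0_r in HN'.
  eapply Rle_lt_trans; [apply Rle_abs|exact HN'].
Qed.

Lemma lim_inv_INR (c : R) : is_lim_seq (fun n => c * / INR n)%R 0.
Proof.
  replace (Finite 0) with (Rbar_mult c 0) by (simpl; f_equal; ring). apply (is_lim_seq_scal_l (fun n => / INR n)%R c 0).
  replace (Finite 0) with (Rbar_inv p_infty) by reflexivity.
  apply is_lim_seq_inv. apply is_lim_seq_INR. easy.
Qed.

Lemma sqr_inv_bound c y n : (0 <= c)%R -> (1 <= n)%nat -> (INR n <= y)%R -> (INR n * (c / y / y) <= c * / INR n)%R.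
Proof.
  intros Hc Hn Hy. assert (P : (0 < INR n)%R) by (apply lt_0_INR; lia).
  assert (0 < / y)%R by (apply Rinv_0_lt_compat; lra). assert (/ y <= / INR n)%R by (apply Rinv_le_contravar; lra).
  replace (INR n * (c / y / y))%R with (c * (INR n * (/ y * / y)))%R by (field; lra). apply Rmult_le_compat_l; auto.
  apply Rle_trans with (INR n * (/ INR n * / INR n))%R. apply Rmult_le_compat_l. lra. apply Rmult_le_compat; lra.
  right. field. lra.
Qed.

(** The main term of [Mel_asymptotic] at [z + n] is [PI / (4 * (z + n))], and the error is
    [O(1 / n^2)]. *)
Lemma Mel_lim z : (0 < Re z)%R -> filterlim (fun n => INR n * mellin_E (z + INR n)) eventually (locally (RtoC (PI / 4))).
Proof.
  intros Hz. replace (RtoC (PI / 4)) with (0 + RtoC (PI / 4) * / (1 + z * 0)).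
  2:{ field. }
  apply filterlim_ext_loc with (fun n => INR n * (mellin_E (z + INR n) - (PI / 2)%R * / (2 * (z + INR n))) + RtoC (PI / 4) * / (1 + z * RtoC (/ INR n))).
  { exists 1%nat. intros n Hn. assert (P : (0 < INR n)%R) by (apply lt_0_INR; lia).
    assert (z + INR n <> 0) by (apply Re_pos_neq; lra). assert (N : RtoC (INR n) <> 0) by (apply RtoC_neq; lra).
    rewrite RtoC_inv by lra. replace (RtoC (PI / 4)) with (RtoC (PI / 2) / 2) by (rewrite <- RtoC_div by lra; f_equal; field).
    field. repeat split; auto. intros E. apply H. rewrite <- E. ring. }
  apply (filterlim_C_plus eventually).
  - apply Cmod_lim_0 with (fun n => 2 * / INR n)%R. 2:apply lim_inv_INR.
    exists 1%nat. intros n Hn. rewrite Cmod_mult, Cmod_R, Rabs_pos_eq by apply pos_INR.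
    assert (A := Mel_asymptotic (z + INR n) (Re_pos_plus_INR z n Hz)). rewrite Re_plus_INR in A.
    eapply Rle_trans. apply Rmult_le_compat_l. apply pos_INR. exact A. apply sqr_inv_bound; auto; lra.
  - apply (filterlim_C_mult eventually). apply filterlim_const. apply (filterlim_C_inv eventually).
    replace (1 + z * 0) with (RtoC 1) by ring. apply RtoC_neq; lra.
    apply (filterlim_C_plus eventually). apply filterlim_const.
    apply (filterlim_C_mult eventually). apply filterlim_const. apply inv_INR_lim.
Qed.

(** By [Mel_iter] the moment equals, for every [n >= 1], a quotient of four Gauss terms times
    [n * mellin_E (z + n + 1)]: the exponents [z + (z + 1)] and [(z + 1/2) + (z + 3/2)] differ by 1,
    which accounts for the factor [n]. That factor is written [(n + 1) / (1 + 1 / n)] to match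
    [Mel_lim]. *)
Lemma Mel_Gamma z : (0 < Re z)%R ->
  mellin_E z = RtoC (PI / 4) * (Gamma z * Gamma (z + 1) * / (Gamma (z + 1 / 2) * Gamma (z + 3 / 2))).
Proof.
  intros Hz.
  assert (H1 : (0 < Re (z + 1))%R) by now apply Re_succ.
  assert (H2 : (0 < Re (z + 1 / 2))%R) by (rewrite Re_plus, Re_half; lra).
  assert (H3 : (0 < Re (z + 3 / 2))%R) by (rewrite Re_plus, Re_3half; lra).
  assert (L := Mel_lim z Hz).
  apply (filterlim_C_unique eventually (fun _ : nat => mellin_E z)). apply filterlim_const.
  apply filterlim_ext_loc with (fun n => (INR (S n) * mellin_E (z + INR (S n))) * / (1 + RtoC (/ INR n)) * (gauss z n * gauss (z + 1) n * / (gauss (z + 1 / 2) n * gauss (z + 3 / 2) n))).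
  - exists 1%nat. intros n Hn. assert (P : (0 < INR n)%R) by (apply lt_0_INR; lia).
    assert (E := Mel_iter z (S n) Hz). unfold gauss, Rpow_C.
    assert (P1 := poch_neq_0 z (S n) Hz). assert (P2 := poch_neq_0 _ (S n) H1). assert (P3 := poch_neq_0 _ (S n) H2). assert (P4 := poch_neq_0 _ (S n) H3).
    assert (F : RtoC (INR (fact n)) <> 0) by apply RtoC_neq, INR_fact_neq_0.
    set (l := RtoC (ln (INR n))).
    assert (E1 : Cexp ((z + 3 / 2) * l) = Cexp ((z + 1 / 2) * l) * INR n).
    { replace ((z + 3 / 2) * l) with ((z + 1 / 2) * l + l) by field. rewrite Cexp_plus. f_equal.
      unfold l, Cexp, RtoC; simpl. rewrite exp_ln, cos_0, sin_0 by auto. f_equal; ring. }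
    assert (E2 : Cexp (z * l) * Cexp ((z + 1) * l) = Cexp ((z + 1 / 2) * l) * Cexp ((z + 1 / 2) * l)).
    { rewrite <- !Cexp_plus. f_equal. field. }
    assert (M1 := Cexp_neq_0 ((z + 1 / 2) * l)).
    rewrite E1. set (e := Cexp ((z + 1 / 2) * l)) in *. set (e1 := Cexp (z * l)) in *. set (e2 := Cexp ((z + 1) * l)) in *.
    set (q1 := poch z (S n)) in *. set (q2 := poch (z + 1) (S n)) in *. set (q3 := poch (z + 1 / 2) (S n)) in *. set (q4 := poch (z + 3 / 2) (S n)) in *.
    set (f := RtoC (INR (fact n))) in *. set (m := mellin_E (z + INR (S n))) in *.
    assert (NR : RtoC (INR n) <> 0) by (apply RtoC_neq; lra).
    assert (NS : RtoC (INR n) + 1 <> 0) by (rewrite <- RtoC_plus; apply RtoC_neq; lra).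
    rewrite S_INR, RtoC_plus, RtoC_inv by lra.
    transitivity (q3 * q4 * m * (e1 * e2) / (e * e * (q1 * q2))).
    { field. repeat split; auto. }
    rewrite E2. rewrite <- E. field. auto.
  - replace (RtoC (PI / 4) * (Gamma z * Gamma (z + 1) * / (Gamma (z + 1 / 2) * Gamma (z + 3 / 2)))) with
      (RtoC (PI / 4) * / (1 + 0) * (Gamma z * Gamma (z + 1) * / (Gamma (z + 1 / 2) * Gamma (z + 3 / 2)))).
    2:{ f_equal. field. }
    apply (filterlim_C_mult eventually). apply (filterlim_C_mult eventually).
    + intros Q HQ. destruct (L Q HQ) as [N HN]. exists N. intros n Hn. apply HN. lia.
    + apply (filterlim_C_inv eventually). rewrite Cplus_0_r. apply RtoC_neq; lra.
      apply (filterlim_C_plus eventually). apply filterlim_const. apply inv_INR_lim.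
    + apply (filterlim_C_mult eventually). apply (filterlim_C_mult eventually); now apply Gamma_lim.
      apply (filterlim_C_inv eventually). apply Cmult_neq_0; now apply Gamma_neq_0.
      apply (filterlim_C_mult eventually); now apply Gamma_lim.
Qed.

Lemma Mel_neq_0 z : (0 < Re z)%R -> mellin_E z <> 0.
Proof.
  intros Hz. rewrite Mel_Gamma by auto. assert (P := PI2_pos).
  assert (H1 : (0 < Re (z + 1))%R) by now apply Re_succ.
  assert (H2 : (0 < Re (z + 1 / 2))%R) by (rewrite Re_plus, Re_half; lra).
  assert (H3 : (0 < Re (z + 3 / 2))%R) by (rewrite Re_plus, Re_3half; lra).
  apply Cmult_neq_0. apply RtoC_neq. lra. apply Cmult_neq_0. apply Cmult_neq_0; now apply Gamma_neq_0.
  intros E. assert (D : Gamma (z + 1 / 2) * Gamma (z + 3 / 2) <> 0) by (apply Cmult_neq_0; now apply Gamma_neq_0).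
  assert (T := Cinv_r _ D). rewrite E, Cmult_0_r in T. apply RtoC_inj in T. lra.
Qed.

(** Minus the logarithmic derivative of the moment at [s + n]. *)
Definition Xn (s : C) (n : nat) : C := mellin_E_log (s + INR n) / mellin_E (s + INR n).

(** The logarithmic derivative of [W (z + 1) / W z = z (z + 1) / ((z + 1/2) (z + 3/2))], obtained
    algebraically from the recursions for the two kinds of moments. *)
Lemma Xn_diff s n : (0 < Re s)%R -> Xn s n - Xn s (S n) =
  / (s + INR n) + / (s + INR n + 1) - / (s + INR n + 1 / 2) - / (s + INR n + 3 / 2).
Proof.
  intros Hs. unfold Xn. rewrite <- plus_INR_S. set (z := s + INR n). assert (Hz : (0 < Re z)%R) by now apply Re_pos_plus_INR.
  assert (H1 : (0 < Re (z + 1))%R) by now apply Re_succ.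
  assert (M0 := Mel_neq_0 z Hz). assert (M1 := Mel_neq_0 _ H1).
  assert (A := Mel_rec' z Hz). assert (B := Nel_rec z Hz).
  assert (Z0 : z <> 0) by (intros E; rewrite E in Hz; simpl in Hz; lra).
  assert (Z1 : z + 1 <> 0) by (intros E; rewrite E in H1; simpl in H1; lra).
  assert (Z2 : z + 1 / 2 <> 0).
  { intros E. apply (f_equal Re) in E. rewrite Re_plus, Re_half in E. rewrite Re_RtoC in E. lra. }
  assert (Z3 : z + 3 / 2 <> 0).
  { intros E. apply (f_equal Re) in E. rewrite Re_plus, Re_3half in E. rewrite Re_RtoC in E. lra. }
  assert (Z2' : 2 * z + 1 <> 0). { intros E. apply Z2. replace (z + 1 / 2) with ((2 * z + 1) / 2) by field. rewrite E. field. }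
  assert (Z3' : 2 * z + 3 <> 0). { intros E. apply Z3. replace (z + 3 / 2) with ((2 * z + 3) / 2) by field. rewrite E. field. }
  assert (EN : mellin_E_log (z + 1) = (4 * z * (z + 1) * mellin_E_log z - ((8 * z + 4) * mellin_E z - (8 * z + 8) * mellin_E (z + 1))) / ((2 * z + 1) * (2 * z + 3))).
  { rewrite <- B. field. auto. }
  assert (EM : mellin_E (z + 1) = 4 * z * (z + 1) * mellin_E z / ((2 * z + 1) * (2 * z + 3))).
  { transitivity (4 * (z * (z + 1) * mellin_E z) / ((2 * z + 1) * (2 * z + 3))). rewrite A. field. auto. f_equal. ring. }
  rewrite EN, EM. field. repeat split; auto; rewrite (Cmult_comm z 2); auto.
Qed.

(** The logarithmic moment is [O(1 / n^2)] while the moment itself behaves like [PI / (4 n)]. *)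
Lemma Xn_lim s : (0 < Re s)%R -> filterlim (Xn s) eventually (locally (RtoC 0)).
Proof.
  intros Hs. replace (RtoC 0) with (0 * / RtoC (PI / 4)) by ring. assert (P := PI2_pos).
  apply filterlim_ext_loc with (fun n => (INR n * mellin_E_log (s + INR n)) * / (INR n * mellin_E (s + INR n))).
  { exists 1%nat. intros n Hn. unfold Xn. assert (RtoC (INR n) <> 0) by (apply RtoC_neq, not_0_INR; lia).
    assert (M0 := Mel_neq_0 _ (Re_pos_plus_INR s n Hs)). field. auto. }
  apply (filterlim_C_mult eventually).
  - apply Cmod_lim_0 with (fun n => 4 * / INR n)%R. 2:apply lim_inv_INR.
    exists 1%nat. intros n Hn. rewrite Cmod_mult, Cmod_R, Rabs_pos_eq by apply pos_INR.
    assert (A := Nel_bound (s + INR n) (Re_pos_plus_INR s n Hs)). rewrite Re_plus_INR in A.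
    eapply Rle_trans. apply Rmult_le_compat_l. apply pos_INR. exact A. apply sqr_inv_bound; auto; lra.
  - apply (filterlim_C_inv eventually). apply RtoC_neq; lra. now apply Mel_lim.
Qed.

(** Tends to 0 and has the terms [gfac] of the special point as its differences up to sign, so that
    it equals [- D_n] there. *)
Definition Yn (s : C) (n : nat) : C := Xn s n + RtoC (2 * lam n).

Lemma Yn_lim s : (0 < Re s)%R -> filterlim (Yn s) eventually (locally (RtoC 0)).
Proof.
  intros Hs. replace (RtoC 0) with (RtoC 0 + RtoC 0) by ring.
  apply (filterlim_C_plus eventually). now apply Xn_lim.
  apply Cmod_lim_0 with (fun n => 2 * / INR n)%R. 2:apply lim_inv_INR.
  exists 1%nat. intros n Hn. destruct (lam_bounds n) as [A B]. assert (P : (0 < INR n)%R) by (apply lt_0_INR; lia).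
  rewrite Cmod_R, Rabs_pos_eq by lra.
  assert (/ (2 * INR n + 1) <= / (2 * INR n))%R by (apply Rinv_le_contravar; lra).
  rewrite Rinv_mult in H. unfold Rdiv in B. lra.
Qed.

(** * Evaluation at the point of the theorem *)

Definition moment_point (s : C) : C7N := (s + 1, s, 1 / 2, 1 / 2, RtoC 1, s + 3 / 2, s + 1 / 2).

Lemma moment_point_qdl s : qdl (moment_point s) = 0.
Proof. unfold qdl, qe, moment_point; simpl. ring. Qed.

Lemma moment_point_qg' s : qg' (moment_point s) = s + 1 / 2.
Proof. unfold qg', qa, qb, qc, qd, qe, qf, moment_point; simpl fst; simpl snd. field. Qed.

(** At [d = 0] each pair is [1 / (w + k) - 1 / (x + k)]. Of these eight fractions the four involving
    [s] make up the difference of [Xn], and the other four twice the difference of [lam]. *)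
Lemma gfac_moment_point s k : (0 < Re s)%R -> gfac (moment_point s) k = - (Yn s k - Yn s (S k)).
Proof.
  intros Hs. unfold gfac, pair4, pairm. rewrite moment_point_qdl, moment_point_qg'.
  unfold qa, qb, qc, qd, qe, qf, moment_point; simpl fst; simpl snd.
  replace (- (Yn s k - Yn s (S k))) with (- ((Xn s k - Xn s (S k)) + 2 * RtoC (lam k - lam (S k)))).
  2:{ unfold Yn. rewrite RtoC_minus, !RtoC_mult. ring. }
  rewrite Xn_diff, lam_S by auto.
  assert (P := pos_INR k).
  rewrite RtoC_minus, !RtoC_inv, !RtoC_plus, RtoC_inv by lra.
  set (y := RtoC (INR k)).
  assert (Z0 : s + y <> 0) by (apply Re_pos_neq; auto).
  assert (Z1 : s + y + 1 <> 0).
  { intros E. apply (f_equal Re) in E. rewrite !Re_plus in E. unfold y in E. rewrite !Re_RtoC in E. lra. }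
  assert (Z2 : s + y + 1 / 2 <> 0).
  { intros E. apply (f_equal Re) in E. rewrite !Re_plus, Re_half in E. unfold y in E. rewrite !Re_RtoC in E. lra. }
  assert (Z3 : s + y + 3 / 2 <> 0).
  { intros E. apply (f_equal Re) in E. rewrite !Re_plus, Re_3half in E. unfold y in E. rewrite !Re_RtoC in E. lra. }
  assert (Z4 : y + 1 <> 0) by (unfold y; rewrite <- RtoC_plus; apply RtoC_neq; lra).
  assert (Z5 : y * 2 + 1 <> 0) by (unfold y; rewrite <- RtoC_mult, <- RtoC_plus; apply RtoC_neq; lra).
  assert (Z2' : s * 2 + y * 2 + 1 <> 0). { intros E. apply Z2. replace (s + y + 1 / 2) with ((s * 2 + y * 2 + 1) / 2) by field. rewrite E. field. }
  assert (Z3' : s * 2 + y * 2 + 3 <> 0). { intros E. apply Z3. replace (s + y + 3 / 2) with ((s * 2 + y * 2 + 3) / 2) by field. rewrite E. field. }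
  field_simplify_eq. 
  2:{ repeat split; auto; intros E; first [apply Z4; rewrite <- E; ring | apply Z5; rewrite <- E; ring | apply Z2'; rewrite <- E; ring | apply Z3'; rewrite <- E; ring | apply Z1; rewrite <- E; ring | apply Z0; rewrite <- E; ring]. }
  ring.
Qed.

Lemma is_series_C_re_im (u : nat -> C) (l : C) : is_series (V := C_NormedModule) u l ->
  is_series (fun n => Re (u n)) (Re l) /\ is_series (fun n => Im (u n)) (Im l).
Proof.
  intros H. unfold is_series in *.
  assert (E : forall n, sum_n (G := C_AbelianGroup) u n = (sum_n (fun n => Re (u n)) n, sum_n (fun n => Im (u n)) n)) by apply sum_n_pair.
  split.
  - apply (filterlim_ext (fun n => fst (sum_n (G := C_AbelianGroup) u n))). intros n. rewrite E. reflexivity.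
    apply (filterlim_comp _ _ _ (sum_n (G := C_AbelianGroup) u) (fun z : C => fst z) eventually (locally l)). exact H.
    apply (continuous_fst (U := R_UniformSpace) (V := R_UniformSpace)).
  - apply (filterlim_ext (fun n => snd (sum_n (G := C_AbelianGroup) u n))). intros n. rewrite E. reflexivity.
    apply (filterlim_comp _ _ _ (sum_n (G := C_AbelianGroup) u) (fun z : C => snd z) eventually (locally l)). exact H.
    apply (continuous_snd (U := R_UniformSpace) (V := R_UniformSpace)).
Qed.

Lemma Csum_unique (u : nat -> C) (l : C) : is_series (V := C_NormedModule) u l -> Csum u = l.
Proof.
  intros H. destruct (is_series_C_re_im u l H) as [A B]. unfold Csum.
  rewrite (is_series_unique _ _ A), (is_series_unique _ _ B). destruct l; reflexivity.
Qed.

Lemma prodquot_0 (g : nat -> C) (l : C) : is_series (V := C_NormedModule) g l -> prodquot 0 g = l.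
Proof.
  intros H. apply Csum_unique. apply is_series_C_ext with (2 := H). intros n.
  assert (E : Cprod (fun i => 1 + 0 * g i) n = 1).
  { induction n; simpl. reflexivity. rewrite IHn. ring. }
  rewrite E. ring.
Qed.

(** At [d = 0] the series [prodquot] is the plain sum of the [gfac], which telescopes because [Yn]
    tends to 0. *)
Lemma prodquot_moment_point s n : (0 < Re s)%R -> prodquot 0 (fun k => gfac (moment_point s) (n + k)) = - Yn s n.
Proof.
  intros Hs. apply prodquot_0.
  assert (E : forall m, sum_n (G := C_AbelianGroup) (fun k => gfac (moment_point s) (n + k)) m = Yn s (n + S m)%nat - Yn s n).
  { induction m.
    - rewrite sum_O, gfac_moment_point by auto. rewrite Nat.add_0_r. replace (n + 1)%nat with (S n) by lia.
      match goal with |- ?a = ?b => change (@eq C a b) end. ring.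
    - rewrite sum_Sn, IHm, gfac_moment_point by auto. replace (n + S (S m))%nat with (S (n + S m))%nat by lia.
      match goal with |- plus ?a ?b = ?c => change (@eq C (a + b) c) end. ring. }
  unfold is_series. change (@sum_n C_NormedModule) with (@sum_n C_AbelianGroup).
  apply (filterlim_ext (fun m => Yn s (n + S m)%nat - Yn s n)). intros m; now rewrite E.
  replace (- Yn s n) with (0 + - Yn s n) by ring. apply (filterlim_C_plus eventually). 2:apply filterlim_const.
  intros Q HQ. destruct (Yn_lim s Hs Q HQ) as [N HN]. exists N. intros m Hm. apply HN. lia.
Qed.

(** The smallest real part among the parameters: [1 / 2] from [c = d = 1 / 2], and [Re s] from
    [b]. *)
Definition moment_radius (s : C) : R := Rmin (1 / 2) (Re s).

Lemma moment_point_bounds s : (0 < Re s)%R ->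
  (0 < moment_radius s <= 1)%R /\ (moment_radius s <= Re (qa (moment_point s)))%R /\ (moment_radius s <= Re (qb (moment_point s)))%R /\ (moment_radius s <= Re (qc (moment_point s)))%R /\
  (moment_radius s <= Re (qd (moment_point s)))%R /\ qe (moment_point s) = 1 /\ (moment_radius s <= Re (qf (moment_point s)))%R /\ (moment_radius s <= Re (qg' (moment_point s)))%R /\ qg (moment_point s) = qg' (moment_point s).
Proof.
  intros Hs. rewrite moment_point_qg'. unfold qa, qb, qc, qd, qe, qf, qg, moment_point; simpl fst; simpl snd.
  rewrite !Re_plus, Re_half, Re_3half, Re_RtoC. unfold moment_radius.
  assert (A := Rmin_l (1 / 2) (Re s)). assert (B := Rmin_r (1 / 2) (Re s)).
  assert (0 < Rmin (1 / 2) (Re s))%R by (apply Rmin_pos; lra).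
  repeat split; lra.
Qed.

(** Both sides have term ratio [phi]: [bs] supplies the squares of [1 / 2 + n] and [1 + n], the
    moment recursion supplies the factors with [s]. Here the coefficients of the expanded integral
    become the terms of the first hypergeometric series. *)
Lemma bs_Mel s n : (0 < Re s)%R -> bs n * mellin_E (s + INR n) = mellin_E s * Cprod (phi (moment_point s)) n.
Proof.
  intros Hs. induction n.
  - simpl. replace (s + 0) with s by ring. ring.
  - simpl Cprod. rewrite Cmult_assoc, <- IHn.
    assert (A := Mel_rec' (s + INR n) (Re_pos_plus_INR s n Hs)). rewrite plus_INR_S in A.
    unfold phi. rewrite moment_point_qg'. unfold qa, qb, qc, qd, qe, qf, moment_point; simpl fst; simpl snd.
    assert (P := pos_INR n).
    rewrite bs_succ, RtoC_mult, RtoC_pow, RtoC_div, !RtoC_plus, !RtoC_mult by lra.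
    rewrite <- plus_INR_S in *. set (y := RtoC (INR n)) in *.
    assert (Z2 : s + y + 1 / 2 <> 0).
    { intros E. apply (f_equal Re) in E. rewrite !Re_plus, Re_half in E. unfold y in E. rewrite !Re_RtoC in E. lra. }
    assert (Z3 : s + y + 3 / 2 <> 0).
    { intros E. apply (f_equal Re) in E. rewrite !Re_plus, Re_3half in E. unfold y in E. rewrite !Re_RtoC in E. lra. }
    assert (Z4 : 1 + y <> 0) by (unfold y; rewrite <- RtoC_plus; apply RtoC_neq; lra).
    assert (EM : mellin_E (s + y + 1) = (s + y) * (s + y + 1) * mellin_E (s + y) * / ((s + y + 1 / 2) * (s + y + 3 / 2))).
    { rewrite A. set (p1 := s + y + 1 / 2) in *. set (p2 := s + y + 3 / 2) in *. field. auto. }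
    rewrite EM.
    transitivity (bs n * mellin_E (s + y) * ((s + 1 + y) * (s + y) * (1 / 2 + y) * (1 / 2 + y)) * (/ (1 + y) * / (s + y + 3 / 2) * / (s + y + 1 / 2) * / (1 + y))).
    2:{ replace (s + y + 3 / 2) with (s + 3 / 2 + y) by ring. replace (s + y + 1 / 2) with (s + 1 / 2 + y) by ring. ring. }
    replace (/ ((s + y + 1 / 2) * (s + y + 3 / 2))) with (/ (s + y + 1 / 2) * / (s + y + 3 / 2)).
    2:{ set (p1 := s + y + 1 / 2) in *. set (p2 := s + y + 3 / 2) in *. field. auto. }
    set (u := / (s + y + 1 / 2)). set (v := / (s + y + 3 / 2)).
    replace ((2 * y + 1) / (2 * y + 2)) with ((1 / 2 + y) * / (1 + y)).
    2:{ replace (2 * y + 2) with (2 * (1 + y)) by ring. field. auto. }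
    simpl. ring.
Qed.

Definition Tn (s : C) (n : nat) : C := bs n * (lam n * mellin_E (s + INR n) + / 2 * mellin_E_log (s + INR n)).

(** Dividing and multiplying by the moment turns [Tn] into [bs n * mellin_E (s + n) * Yn s n / 2],
    that is, [- mellin_E s / 2] times the term [P_n D_n] of [mishev_sum]. *)
Lemma is_series_Tn s : (0 < Re s)%R -> is_series (V := C_NormedModule) (Tn s) (/ 2 * mellin_E s * - mishev_sum (moment_point s)).
Proof.
  intros Hs. destruct (moment_point_bounds s Hs) as (Q1 & Q2 & Q3 & Q4 & Q5 & Q6 & Q7 & Q8 & Q9).
  destruct (C2_hS (moment_point s) (moment_radius s) Q1 Q2 Q3 Q4 Q5 Q6 Q7 Q8) as [_ H].
  specialize (H (moment_point s) (near_p (moment_point s) (moment_radius s) Q1)).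
  replace (/ 2 * mellin_E s * - mishev_sum (moment_point s)) with (- (/ 2 * mellin_E s) * mishev_sum (moment_point s)) by ring.
  apply is_series_C_ext with (2 := is_series_C_scal (- (/ 2 * mellin_E s)) _ _ H). intros n.
  rewrite moment_point_qdl, prodquot_moment_point by auto. unfold Tn, Yn, Xn.
  assert (M0 := Mel_neq_0 _ (Re_pos_plus_INR s n Hs)).
  transitivity (/ 2 * (mellin_E s * Cprod (phi (moment_point s)) n) * (mellin_E_log (s + INR n) / mellin_E (s + INR n) + RtoC (2 * lam n))). ring.
  rewrite <- bs_Mel by auto. rewrite RtoC_mult. field. auto.
Qed.

(** * Termwise integration and conclusion *)

Lemma wz_plus_INR s x n : (0 < x)%R -> wz (s + INR n) x = wz s x * RtoC (x ^ (2 * n)).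
Proof.
  intros Hx. induction n.
  - simpl. replace (s + 0) with s by ring. ring.
  - rewrite <- plus_INR_S, wz_succ, IHn by auto. replace (2 * S n)%nat with (S (S (2 * n))) by lia.
    simpl pow. rewrite !RtoC_mult. ring.
Qed.

Definition Fn (s : C) (N : nat) (x : R) : C := wz s x * ef x * RtoC (sum_n (kterm x) N).

Lemma improper_term s n : (0 < Re s)%R -> improper (fun x => wz s x * ef x * RtoC (kterm x n)) (Tn s n).
Proof.
  intros Hs. assert (Hz := Re_pos_plus_INR s n Hs). unfold Tn.
  apply improper_ext with (fun x => RtoC (bs n) * (RtoC (lam n) * (wz (s + INR n) x * ef x) + / 2 * Nln (s + INR n) x)).
  - intros x Hx. unfold Nln, kterm. rewrite wz_plus_INR by lra. rewrite !RtoC_mult, RtoC_minus. replace (RtoC (-2)) with (- (2)) by (rewrite <- RtoC_opp; reflexivity). field.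
  - apply improper_scal. apply improper_plus; apply improper_scal. now apply Mel_spec. now apply Nel_spec.
Qed.

Lemma improper_Fn s N : (0 < Re s)%R -> improper (Fn s N) (sum_n (G := C_AbelianGroup) (Tn s) N).
Proof.
  intros Hs. induction N.
  - rewrite sum_O. apply improper_ext with (2 := improper_term s 0 Hs). intros x Hx. unfold Fn. now rewrite sum_O.
  - rewrite sum_Sn. apply improper_ext with (2 := improper_plus _ _ _ _ IHN (improper_term s (S N) Hs)).
    intros x Hx. unfold Fn. rewrite sum_Sn. change (plus (sum_n (kterm x) N) (kterm x (S N))) with (sum_n (kterm x) N + kterm x (S N))%R.
    rewrite RtoC_plus. ring.
Qed.

Lemma rp_INR n x : (0 < x)%R -> rp (INR n) x = (x ^ n)%R.
Proof. intros Hx. unfold rp. rewrite <- (exp_ln (x ^ n)) by (apply pow_lt; auto). f_equal. now rewrite ln_pow. Qed.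

(** The bound [kf x <= 2 / x] lowers the exponent gained from [kf_tail] from [2 N + 2] to
    [2 N + 1]. *)
Lemma Fn_tail s N x : (0 < Re s)%R -> (0 < x < 1)%R ->
  (Cmod (wz s x * ef x * kf x - Fn s N x) <= 4 * (rp (2 * Re s + INR (S (2 * N))) x / x))%R.
Proof.
  intros Hs Hx. unfold Fn. replace (wz s x * ef x * kf x - wz s x * ef x * RtoC (sum_n (kterm x) N)) with
    (wz s x * ef x * RtoC (kf x - sum_n (kterm x) N)) by (rewrite RtoC_minus; ring).
  rewrite Cmod_mult, Cmod_R. destruct (kf_tail x N Hx) as [A B]. rewrite Rabs_pos_eq by auto.
  assert (W := wz_ef_bound s x Hx). destruct (kf_bounds x) as [C D]; [lra|]. assert (P4 := PI_4).
  assert (Pw : (0 <= x ^ (2 * S N))%R) by (apply pow_le; lra).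
  assert (Px : (0 < / x)%R) by (apply Rinv_0_lt_compat; lra).
  assert (T : (kf x - sum_n (kterm x) N <= x ^ (2 * S N) * (2 * / x))%R).
  { eapply Rle_trans; [exact B|]. apply Rmult_le_compat_l; auto. eapply Rle_trans; [exact D|]. apply Rmult_le_compat_r; lra. }
  apply Rle_trans with ((2 * (rp (2 * Re s) x / x)) * (x ^ (2 * S N) * (2 * / x)))%R.
  apply Rmult_le_compat; auto. apply Cmod_ge_0.
  rewrite rp_plus, rp_INR by lra. right. replace (2 * S N)%nat with (S (S (2 * N))) by lia. simpl pow. field. lra.
Qed.

(** The error has three parts, each below [eps / 3]: the integrated tail, at most [4 / N] for all
    endpoints; the improper integral of the [N]-th partial sum, whose [d] is picked after [N]; and
    the tail of the series of the [Tn]. *)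
Lemma improper_main s : (0 < Re s)%R -> improper (fun x => wz s x * ef x * kf x) (/ 2 * mellin_E s * - mishev_sum (moment_point s)).
Proof.
  intros Hs eps He. set (I := / 2 * mellin_E s * - mishev_sum (moment_point s)).
  assert (HS := is_series_Tn s Hs). fold I in HS. unfold is_series in HS.
  assert (HS' := proj1 (filterlim_C_iff eventually _ I) HS (eps / 3)%R ltac:(lra)).
  assert (HL : is_lim_seq (fun n => 4 * / INR n)%R 0) by apply lim_inv_INR.
  apply is_lim_seq_spec in HL. assert (He3 : (0 < eps / 3)%R) by lra. 
  destruct (HL (mkposreal _ He3)) as [N1 HN1]. destruct HS' as [N2 HN2].
  set (N := S (N1 + N2)). specialize (HN1 N ltac:(unfold N; lia)). specialize (HN2 N ltac:(unfold N; lia)). simpl pos in HN1.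
  assert (PN : (0 < INR N)%R) by (apply lt_0_INR; unfold N; lia).
  assert (PI4 : (0 < / INR N)%R) by (apply Rinv_0_lt_compat; auto).
  rewrite Rminus_0_r, Rabs_pos_eq in HN1 by lra.
  change (@sum_n C_NormedModule (Tn s) N) with (sum_n (G := C_AbelianGroup) (Tn s) N) in HN2.
  destruct (improper_Fn s N Hs (eps / 3)%R ltac:(lra)) as (d & Hd & B).
  exists d. split; auto. intros a b Ha Hb. destruct (B a b Ha Hb) as (IN & HIN & EIN).
  destruct (is_CInt_ex (fun x => wz s x * ef x * kf x) a b) as [J HJ]; try lra.
  { intros x Hx. apply Ccont_mult. now apply Ccont_wz_ef. eapply Cder_Ccont. apply Cder_RtoC. now apply is_derive_kf. }
  exists J. split; auto.
  set (r := (2 * Re s + INR (S (2 * N)))%R).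
  assert (Hr : (INR N <= r)%R). { unfold r. rewrite S_INR, mult_INR. simpl (INR 2). lra. }
  assert (HT := is_CInt_dominated _ 4 r a b (J - IN) ltac:(lra) ltac:(lra) ltac:(lra) ltac:(lra)
     (fun x Hx => Fn_tail s N x Hs Hx) (is_CInt_minus _ _ _ _ _ _ HJ HIN)).
  assert (X1 : (0 < 4 / r)%R) by (apply Rdiv_lt_0_compat; lra).
  assert (X2 : (rp r b - rp r a <= 1)%R) by (generalize (rp_le_1 r b ltac:(lra) ltac:(lra)) (rp_pos r a); lra).
  assert (X3 : (4 / r * (rp r b - rp r a) <= 4 / r * 1)%R) by (apply Rmult_le_compat_l; lra).
  assert (X4 : (4 / r <= 4 * / INR N)%R) by (apply Rmult_le_compat_l; [lra|apply Rinv_le_contravar; lra]).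
  replace (J - I) with ((J - IN) + (IN - sum_n (G := C_AbelianGroup) (Tn s) N) + (sum_n (G := C_AbelianGroup) (Tn s) N - I)) by ring.
  eapply Rle_lt_trans; [apply Cmod_triangle|]. eapply Rle_lt_trans; [apply Rplus_le_compat_r; apply Cmod_triangle|].
  lra.
Qed.

(** The factors [Gamma (s + 1/2)] and [Gamma (s + 3/2)] occur on both sides. Of [PI ^ 3 / 8], one
    [PI] is absorbed by [sinq 0 = / PI] and another by the square of [Gamma (1/2)]; the remaining
    [PI / 8] is [1 / 2] times the [PI / 4] of [Mel_Gamma]. *)
Lemma value_main s : (0 < Re s)%R ->
  / 2 * mellin_E s * - mishev_sum (moment_point s) = PI ^ 3 / 8 * s ^ 2 * Gamma s ^ 4
     * mishevL (s + 1) s (1 / 2) (1 / 2) 1 (s + 3 / 2) (s + 1 / 2).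
Proof.
  intros Hs. destruct (moment_point_bounds s Hs) as (Q1 & Q2 & Q3 & Q4 & Q5 & Q6 & Q7 & Q8 & Q9).
  assert (V := mishevL_value (moment_point s) (moment_radius s) Q1 Q2 Q3 Q4 Q5 Q6 Q7 Q8 Q9).
  change (mishevL (qa (moment_point s)) (qb (moment_point s)) (qc (moment_point s)) (qd (moment_point s)) (qe (moment_point s)) (qf (moment_point s)) (qg (moment_point s))) with
    (mishevL (s + 1) s (1 / 2) (1 / 2) 1 (s + 3 / 2) (s + 1 / 2)) in V.
  rewrite V. unfold mishev_ext, rprod. rewrite moment_point_qdl, moment_point_qg'.
  unfold qa, qb, qc, qd, qe, qf, moment_point; simpl fst; simpl snd. fold (moment_point s).
  unfold sinq. destruct (Ceq_dec 0 0) as [_|E]; [|now destruct E].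
  rewrite !Cplus_0_r.
  assert (H1 : (0 < Re (s + 1))%R) by now apply Re_succ.
  assert (H2 : (0 < Re (s + 1 / 2))%R) by (rewrite Re_plus, Re_half; lra).
  assert (H3 : (0 < Re (s + 3 / 2))%R) by (rewrite Re_plus, Re_3half; lra).
  assert (H4 : (0 < Re (1 / 2))%R) by (rewrite Re_half; lra).
  assert (H5 : (0 < Re 1)%R) by (simpl; lra).
  assert (RG : forall z, (0 < Re z)%R -> rGamma z = / Gamma z).
  { intros z Hz. rewrite Gamma_rGamma; auto. assert (N := rGamma_neq_0 z Hz). field; auto. }
  rewrite !RG by auto. rewrite Mel_Gamma by auto. rewrite Gamma_1, Gamma_succ by auto.
  assert (G0 := Gamma_neq_0 s Hs). assert (G2 := Gamma_neq_0 _ H2). assert (G3 := Gamma_neq_0 _ H3). assert (G4 := Gamma_neq_0 _ H4).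
  assert (GH := Gamma_half_sqr). assert (P := PI2_pos).
  assert (P0 : RtoC PI <> 0) by (apply RtoC_neq; lra).
  assert (s0 : s <> 0) by (intros E; rewrite E in Hs; simpl in Hs; lra).
  assert (GI : / Gamma (1 / 2) * / Gamma (1 / 2) = / PI) by (rewrite <- GH; field; auto).
  set (g := Gamma s) in *. set (g2 := Gamma (s + 1 / 2)) in *. set (g3 := Gamma (s + 3 / 2)) in *.
  set (gh := / Gamma (1 / 2)) in *. set (h := mishev_sum (moment_point s)).
  rewrite RtoC_div by lra.
  transitivity (PI ^ 3 / 8 * s ^ 2 * g ^ 4 * (/ PI * (/ 1 * / g3 * / g2 * (/ (s * g) * / g * (gh * gh))) * - h)).
  rewrite GI. field. auto. ring.
Qed.

Theorem mainTheorem11 (s : C) (hs : (0 < Re s)%R) :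
  is_RInt_gen (V := C_R_NormedModule)
    (fun x : R => Rpow_C x (2 * s - 1) * ellE' x * ellK' x)
    (at_right 0) (at_left 1)
    (PI ^ 3 / 8 * s ^ 2 * Gamma s ^ 4
     * mishevL (s + 1) s (1 / 2) (1 / 2) 1 (s + 3 / 2) (s + 1 / 2)).
Proof.
  rewrite <- value_main by exact hs. apply improper_is_RInt_gen.
  apply improper_ext with (2 := improper_main s hs).
  intros x Hx. rewrite ellE'_ef, ellK'_kf by lra. reflexivity.
Qed.
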